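(* The following problem is decidable. Input: two finite alphabets $A$ and $B$, an endomorphism $\sigma : A^* \to A^*$ prolongable on a letter $a\in A$, and a morphism $\phi : A^* \to B^*$. Question: is the sequence $\phi(\sigma^\infty(a))$ uniformly recurrent?
   Context: An endomorphism $\sigma : A^*\to A^*$ is prolongable on $a$ if $\sigma(a)=au$ for some non-empty word $u\in A^+$ and $\lim_{n\to\infty}|\sigma^n(a)|=+\infty$; then $\sigma^\infty(a)$ denotes the limit of the words $\sigma^n(a)$, an infinite sequence fixed by $\sigma$. A morphic sequence is a sequence of the form $\phi(\sigma^\infty(a))$ with $\phi : A^*\to B^*$ a morphism (when it is an infinite sequence). A sequence is uniformly recurrent if every factor appears infinitely often and the gaps between successive occurrences of each factor are bounded. Equivalently, the theorem states that uniform recurrence of morphic sequences is decidable. *)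

(* Defs.v *)
From mathcomp Require Import all_boot.

Set Implicit Arguments.
Unset Strict Implicit.
Unset Printing Implicit Defensive.

(* Partial recursive functions, on argument lists of untracked length.        *)

Inductive recfun : Type :=
  | Zero
  | Succ
  | Proj of nat
  | Comp of recfun & seq recfun
  | Prec of recfun & recfun
  | Mu of recfun.

(* eval f v y : the partial function denoted by f is defined at v, with value *)
(* y.  In eval_mu, k records the values of f before its first zero.           *)
Inductive eval : recfun -> seq nat -> nat -> Prop :=
  | eval_zero v : eval Zero v 0
  | eval_succ x v : eval Succ (x :: v) x.+1
  | eval_proj i v : i < size v -> eval (Proj i) v (nth 0 v i)
  | eval_comp f gs v w y :
      size w = size gs ->
      (forall i, i < size gs -> eval (nth Zero gs i) v (nth 0 w i)) ->
      eval f w y -> eval (Comp f gs) v y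
  | eval_prec0 f g v y : eval f v y -> eval (Prec f g) (0 :: v) y
  | eval_precS f g n v z y :
      eval (Prec f g) (n :: v) z -> eval g [:: n, z & v] y ->
      eval (Prec f g) (n.+1 :: v) y
  | eval_mu f v n (k : nat -> nat) :
      (forall i, i < n -> eval f (i :: v) (k i).+1) ->
      eval f (n :: v) 0 -> eval (Mu f) v n.

Lemma eval_inj f v y1 y2 : eval f v y1 -> eval f v y2 -> y1 = y2.
Proof.
move=> ev1; elim: ev1 y2 => {f v y1}.
- by move=> v y2 ev2; inversion ev2.
- by move=> x v y2 ev2; inversion ev2.
- by move=> i v lt_i y2 ev2; inversion ev2.
- move=> f gs v w y sz_w _ IHgs _ IHf y2 ev2; inversion ev2; subst.
  apply: IHf; suff -> : w = w0 by [].
  apply: (@eq_from_nth _ 0) => [|i]; first by rewrite sz_w.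
  by rewrite sz_w => lt_i; apply: IHgs => //; auto.
- by move=> f g v y _ IH y2 ev2; inversion ev2; subst; apply: IH.
- move=> f g n v z y _ IHz _ IHy y2 ev2; inversion ev2; subst.
  by apply: IHy; rewrite (IHz z0).
- move=> f v n k _ IHk _ IH0 y2 ev2; inversion ev2; subst.
  case: (ltngtP n y2) => // lt.
    have evS : eval f (n :: v) (k0 n).+1 by auto.
    by have := IH0 _ evS.
  have ev0 : eval f (y2 :: v) 0 by [].
  by have := IHk _ lt _ ev0.
Qed.

(* On input n, the program d halts and outputs the truth value of P.          *)
Definition decides (d : recfun) (n : nat) (P : Prop) : Prop :=
  exists b : bool, eval d [:: n] b /\ (b = true <-> P).

(* A morphism A^* -> B^* is given by the images of the letters.               *)
Definition extend (A B : Type) (f : A -> seq B) (w : seq A) : seq B :=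
  flatten [seq f x | x <- w].

Definition prolongable (A : Type) (sigma : A -> seq A) (a : A) : Prop :=
  (exists2 u, u <> [::] & sigma a = a :: u) /\
  (forall L, exists N, forall n, N <= n ->
     L <= size (iter n (extend sigma) [:: a])).

Definition word_limit (A : Type) (w : nat -> seq A) (x : nat -> A) : Prop :=
  forall i, exists N, forall n, N <= n -> onth (w n) i = Some (x i).

(* x = sigma^oo(a) *)
Definition is_fixpoint (A : Type) (sigma : A -> seq A) (a : A) (x : nat -> A) :=
  word_limit (fun n => iter n (extend sigma) [:: a]) x.

(* y = phi(x), as an infinite sequence; there is no such y when phi(x) is a   *)
(* finite word.                                                               *)
Definition is_image (A B : Type) (phi : A -> seq B) (x : nat -> A)
    (y : nat -> B) :=
  word_limit (fun n => extend phi (mkseq x n)) y.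

Definition occurs (B : Type) (y : nat -> B) (w : seq B) (i : nat) : Prop :=
  mkseq (fun k => y (i + k)) (size w) = w.

Definition successive_occurrences (B : Type) (y : nat -> B) (w : seq B)
    (i j : nat) : Prop :=
  [/\ i < j, occurs y w i, occurs y w j &
      forall k, i < k < j -> ~ occurs y w k].

Definition uniformly_recurrent (B : Type) (y : nat -> B) : Prop :=
  forall w, (exists i, occurs y w i) ->
    (forall N, exists2 i, N <= i & occurs y w i) /\
    (exists L, forall i j, successive_occurrences y w i j -> j - i <= L).

(* CodeSeq.code is a computable bijection from seq nat to nat; letters are    *)
(* numbered by enum_rank.                                                     *)
Definition code_word (A : finType) (w : seq A) : nat :=
  CodeSeq.code [seq val (enum_rank x) | x <- w].

Definition code_morphism (A B : finType) (f : A -> seq B) : nat :=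
  CodeSeq.code [seq code_word (f x) | x <- enum A].

Definition code_input (A B : finType) (sigma : A -> seq A) (a : A)
    (phi : A -> seq B) : nat :=
  CodeSeq.code [:: #|A|; #|B|; val (enum_rank a);
                   code_morphism sigma; code_morphism phi].

(* Main.v *)
Require Import Defs.
From mathcomp Require Import all_boot zify.
From mathcomp Require Import boolp.

Set Implicit Arguments.
Unset Strict Implicit.
Unset Printing Implicit Defensive.

(** Both answers have finite certificates that can be checked by a primitive
    recursive program, so a search through all certificates decides the question.
    Write W_n = phi sigma^n, x = sigma^oo(a) and y = phi(x) = W_n(x).

    Whether y is infinite is read off the n for which W_n vanishes on letters, an
    eventually periodic information.  If y is not uniformly recurrent, some factor
    w is avoided by arbitrarily long factors of y; pumping the derivation trees of
    these factors against the automaton that recognises the words avoiding w gives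
    a letter g and an N such that sigma^N(g) = u g v, where the words W_n(r), for
    r = u or r = v and n in an arithmetic progression, loop on a live state, and
    such a loop produces arbitrarily long factors without w.

    If y is uniformly recurrent, it is the image Theta(z) of a fixed point z of a
    primitive substitution lambda, and z is the output of a finite transducer
    reading x, in a way compatible with sigma^N and lambda; finitely many word
    identities express this.  For aperiodic y the transducer comes from return
    words, as in Durand's work: after deleting the letters erased by W_n, y is
    linearly recurrent, the letters growing under sigma have comparable growth at
    infinitely many levels n, and so the return words to a prefix of y of length
    about |sigma^n(a)|, and the parts of them pending at the cuts of y = W_n(x),
    are boundedly many.  Two levels with the same transition table give the
    certificate. *)

(** * Recursive functions *)

(** No bound has to be computed: the search only needs that some certificate exists. Completeness
    may therefore use classical choice, infinite pigeonholes and extremal letters, while the checker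
    tests finitely many word identities. The periodic case stands apart because the counting of
    words rests on a lower bound for return times: in a linearly recurrent sequence, a word that
    recurs too early overlaps itself so far that the whole sequence becomes periodic. The obstacle
    in the aperiodic case is that letters may grow at different rates. Runs of bounded letters are
    short, since long ones would be pumped into arbitrarily high powers. A growing letter that is
    negligible at infinitely many levels is excluded by counting: it would produce many factors
    [g T g'] with [g], [g'] not negligible and [T] negligible, whose images at one level have
    distinct lengths of the same order and the same long ends, and linear recurrence allows only
    boundedly many such words. The same count bounds the pending words, once each is prolonged up to
    the image of a nearby growing letter. *)

Definition rec1 (f : nat -> nat) :=
  exists r, forall x v, eval r (x :: v) (f x).
Definition rec2 (f : nat -> nat -> nat) :=
  exists r, forall x y v, eval r [:: x, y & v] (f x y).
Definition rec3 (f : nat -> nat -> nat -> nat) :=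
  exists r, forall x y z v, eval r [:: x, y, z & v] (f x y z).

Lemma eval_comp1 f g v w y : eval g v w -> eval f [:: w] y -> eval (Comp f [:: g]) v y.
Proof. by move=> eg ef; apply: (@eval_comp _ _ _ [:: w]) => // -[]. Qed.

Lemma eval_comp2 f g h v a b y :
  eval g v a -> eval h v b -> eval f [:: a; b] y -> eval (Comp f [:: g; h]) v y.
Proof. by move=> eg eh ef; apply: (@eval_comp _ _ _ [:: a; b]) => // -[|[]]. Qed.

Lemma eval_comp3 f g h k v a b c y :
  eval g v a -> eval h v b -> eval k v c -> eval f [:: a; b; c] y ->
  eval (Comp f [:: g; h; k]) v y.
Proof.
by move=> eg eh ek ef; apply: (@eval_comp _ _ _ [:: a; b; c]) => // -[|[|[]]].
Qed.

Lemma eval_proj0 x v : eval (Proj 0) (x :: v) x.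
Proof. exact: (@eval_proj 0 (x :: v)). Qed.
Lemma eval_proj1 x y v : eval (Proj 1) [:: x, y & v] y.
Proof. exact: (@eval_proj 1 [:: x, y & v]). Qed.
Lemma eval_proj2 x y z v : eval (Proj 2) [:: x, y, z & v] z.
Proof. exact: (@eval_proj 2 [:: x, y, z & v]). Qed.
#[local] Hint Resolve eval_proj0 eval_proj1 eval_proj2 : core.

Lemma rec1_id : rec1 id.
Proof. by exists (Proj 0). Qed.
Lemma rec1_succ : rec1 succn.
Proof. by exists Succ => x v; constructor. Qed.
Lemma rec1_const n : rec1 (fun=> n).
Proof.
elim: n => [|n [r Hr]]; first by exists Zero => *; constructor.
by exists (Comp Succ [:: r]) => x v; apply: eval_comp1 (Hr _ _) _; constructor.
Qed.

Lemma rec1_comp f g : rec1 f -> rec1 g -> rec1 (fun x => f (g x)).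
Proof.
move=> [rf Hf] [rg Hg]; exists (Comp rf [:: rg]) => x v.
exact: eval_comp1 (Hg _ _) (Hf _ _).
Qed.
Lemma rec1_comp2 f g h : rec2 f -> rec1 g -> rec1 h -> rec1 (fun x => f (g x) (h x)).
Proof.
move=> [rf Hf] [rg Hg] [rh Hh]; exists (Comp rf [:: rg; rh]) => x v.
exact: eval_comp2 (Hg _ _) (Hh _ _) (Hf _ _ _).
Qed.

(** The same program serves, because [rec1] asks it to work whatever arguments follow the first. *)
Lemma rec2_fst f : rec1 f -> rec2 (fun x _ => f x).
Proof. by move=> [r Hr]; exists r => *; apply: Hr. Qed.
Lemma rec2_snd f : rec1 f -> rec2 (fun _ y => f y).
Proof.
move=> [r Hr]; exists (Comp r [:: Proj 1]) => x y v.
exact: eval_comp1 (eval_proj1 _ _ _) (Hr _ _).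
Qed.
Lemma rec2_comp1 f g : rec1 f -> rec2 g -> rec2 (fun x y => f (g x y)).
Proof.
move=> [rf Hf] [rg Hg]; exists (Comp rf [:: rg]) => x y v.
exact: eval_comp1 (Hg _ _ _) (Hf _ _).
Qed.
Lemma rec2_comp f g h : rec2 f -> rec2 g -> rec2 h -> rec2 (fun x y => f (g x y) (h x y)).
Proof.
move=> [rf Hf] [rg Hg] [rh Hh]; exists (Comp rf [:: rg; rh]) => x y v.
exact: eval_comp2 (Hg _ _ _) (Hh _ _ _) (Hf _ _ _).
Qed.
Lemma rec3_comp2 f g h : rec2 f -> rec3 g -> rec3 h -> rec3 (fun x y z => f (g x y z) (h x y z)).
Proof.
move=> [rf Hf] [rg Hg] [rh Hh]; exists (Comp rf [:: rg; rh]) => x y z v.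
exact: eval_comp2 (Hg _ _ _ _) (Hh _ _ _ _) (Hf _ _ _).
Qed.
Lemma rec3_12 f : rec2 f -> rec3 (fun x y _ => f x y).
Proof. by move=> [r Hr]; exists r => *; apply: Hr. Qed.
Lemma rec3_23 f : rec2 f -> rec3 (fun _ y z => f y z).
Proof.
move=> [r Hr]; exists (Comp r [:: Proj 1; Proj 2]) => x y z v.
exact: eval_comp2 (eval_proj1 _ _ _) (eval_proj2 _ _ _ _) (Hr _ _ _).
Qed.
Lemma rec3_13 f : rec2 f -> rec3 (fun x _ z => f x z).
Proof.
move=> [r Hr]; exists (Comp r [:: Proj 0; Proj 2]) => x y z v.
exact: eval_comp2 (eval_proj0 _ _) (eval_proj2 _ _ _ _) (Hr _ _ _).
Qed.

Lemma rec2_prec (h : nat -> nat -> nat) f g :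
  rec1 f -> rec3 g -> (forall y, h 0 y = f y) ->
  (forall n y, h n.+1 y = g n (h n y) y) -> rec2 h.
Proof.
move=> [rf Hf] [rg Hg] h0 hS; exists (Prec rf rg) => n y v.
elim: n => [|n IHn]; first by rewrite h0; constructor.
by rewrite hS; econstructor; eauto.
Qed.

Lemma rec2_swap f : rec2 f -> rec2 (fun x y => f y x).
Proof. by move=> H; apply: rec2_comp => //; [apply: rec2_snd | apply: rec2_fst]; apply: rec1_id. Qed.

Lemma rec1_prec (h : nat -> nat) g : rec2 g ->
  (forall n, h n.+1 = g n (h n)) -> rec1 h.
Proof.
move=> Hg hS; have: rec2 (fun x _ => h x).
  by apply: (@rec2_prec _ (fun=> h 0) (fun n z _ => g n z)) => //; [apply: rec1_const | apply: rec3_12].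
by move=> H; apply: (rec1_comp2 H); apply: rec1_id.
Qed.

Lemma rec2_add : rec2 addn.
Proof.
apply: (@rec2_prec _ id (fun _ z _ => z.+1)) => //; first exact: rec1_id.
by apply: rec3_12; apply: rec2_snd; apply: rec1_succ.
Qed.
Lemma rec2_mul : rec2 muln.
Proof.
apply: (@rec2_prec _ (fun=> 0) (fun _ z y => y + z)) => //; first exact: rec1_const.
by apply: rec3_23; apply: rec2_swap; apply: rec2_add.
Qed.
Lemma rec1_pred : rec1 predn.
Proof. by apply: (@rec1_prec _ (fun n _ => n)) => //; apply: rec2_fst; apply: rec1_id. Qed.
Lemma rec2_sub : rec2 subn.
Proof.
apply: (@rec2_swap (fun y x => x - y)).
apply: (@rec2_prec _ id (fun _ z _ => z.-1)); [exact: rec1_id| |move=> *; lia|move=> *; lia].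
by apply: rec3_12; apply: rec2_snd; apply: rec1_pred.
Qed.
Lemma rec1_exp2 : rec1 (expn 2).
Proof.
apply: (@rec1_prec _ (fun _ z => z + z)) => [|n]; last by rewrite expnS mul2n addnn.
by apply: rec2_snd; apply: rec1_comp2 rec2_add rec1_id rec1_id.
Qed.
Lemma rec1_odd : rec1 (fun n => odd n).
Proof.
apply: (@rec1_prec _ (fun _ z => 1 - z)) => [|n] /=; last by case: odd.
by apply: rec2_snd; apply: rec1_comp2 rec2_sub (rec1_const _) rec1_id.
Qed.
Lemma rec1_half : rec1 half.
Proof.
apply: (@rec1_prec _ (fun n z => n - z)) => [|n] /=; last by rewrite uphalf_half; lia.
exact: rec2_sub.
Qed.
Lemma rec3_if : rec3 (fun b x y => if b != 0 then x else y).
Proof.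
have Hz : rec1 (fun b => (b != 0 : nat)) by apply: (@rec1_prec _ (fun _ _ => 1)) => //; apply: rec2_fst; apply: rec1_const.
have: rec3 (fun b x y => (b != 0) * x + (1 - (b != 0)) * y).
  apply: rec3_comp2; first exact: rec2_add.
    by apply: rec3_12; apply: rec2_comp rec2_mul _ _; [apply: rec2_fst | apply: rec2_snd; apply: rec1_id].
  apply: rec3_13; apply: rec2_comp rec2_mul _ _; last by apply: rec2_snd; apply: rec1_id.
  by apply: rec2_fst; apply: rec1_comp2 rec2_sub (rec1_const _) Hz.
by move=> [r Hr]; exists r => b x y v; have := Hr b x y v; case: (b != 0); rewrite ?mul1n ?mul0n ?addn0.
Qed.
Lemma rec2_iter f : rec2 f -> rec3 (fun e n s => iter n (f e) s).
Proof.
move=> [r Hr].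
exists (Comp (Prec (Proj 1) (Comp r [:: Proj 2; Proj 1])) [:: Proj 1; Proj 0; Proj 2]) => e n s v.
apply: eval_comp3 (eval_proj1 _ _ _) (eval_proj0 _ _) (eval_proj2 _ _ _ _) _.
elim: n => [|n IHn] /=; first by constructor.
econstructor; first exact: IHn.
exact: eval_comp2 (eval_proj2 _ _ _ _) (eval_proj1 _ _ _) (Hr _ _ _).
Qed.

Lemma rec2_eq : rec2 (fun x y => x == y).
Proof.
have: rec2 (fun x y => 1 - ((x - y) + (y - x))).
  apply: rec2_comp1; first exact: rec1_comp2 rec2_sub (rec1_const 1) rec1_id.
  by apply: rec2_comp rec2_add rec2_sub (rec2_swap rec2_sub).
by move=> [r Hr]; exists r => x y v; have := Hr x y v; congr eval; case: eqP => /=; lia.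
Qed.
Lemma rec2_leq : rec2 (fun x y => x <= y).
Proof.
have: rec2 (fun x y => 1 - (x - y)).
  by apply: rec2_comp1; [exact: rec1_comp2 rec2_sub (rec1_const 1) rec1_id | exact: rec2_sub].
by move=> [r Hr]; exists r => x y v; have := Hr x y v; congr eval; case: leqP => /=; lia.
Qed.

Definition ccons n m := 2 ^ n * m.*2.+1.
(** [ccons] is the cons of [CodeSeq.code]. As [chalf] stops at odd numbers, iterating it on a code
    strips the power of two. The code exceeds the exponent ([ccons_gt]), so it can itself serve as
    the number of iterations, and [chead] counts the even iterates. *)
Definition chalf n := if odd n then n else n./2.
Definition ctail n := (iter n chalf n)./2.
Definition chead n := \sum_(j < n) ~~ odd (iter j chalf n).

Lemma rec2_ccons : rec2 ccons.
Proof.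
apply: rec2_comp rec2_mul _ _; first by apply: rec2_fst; apply: rec1_exp2.
apply: rec2_snd; apply: rec1_comp; first exact: rec1_succ.
have H : rec1 (fun x => x + x) := rec1_comp2 rec2_add rec1_id rec1_id.
by have [r Hr] := H; exists r => x v; rewrite -addnn; apply: Hr.
Qed.
Lemma rec1_chalf : rec1 chalf.
Proof.
have [r Hr] := rec3_if; have [rh Hh] := rec1_half; have [ro Ho] := rec1_odd.
exists (Comp r [:: ro; Proj 0; rh]) => x v; have := Hr (odd x) x x./2.
rewrite eqb0 negbK => Hr'; by apply: eval_comp3 (Ho _ _) (eval_proj0 _ _) (Hh _ _) (Hr' _).
Qed.
Lemma rec2_iterchalf : rec2 (fun j n => iter j chalf n).
Proof.
have [r Hr] := rec2_iter (rec2_snd rec1_chalf).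
exists (Comp r [:: Zero; Proj 0; Proj 1]) => j n v.
by apply: (eval_comp3 _ _ _ (Hr 0 j n _)) => //; constructor.
Qed.
Lemma rec1_ctail : rec1 ctail.
Proof. exact: rec1_comp rec1_half (rec1_comp2 rec2_iterchalf rec1_id rec1_id). Qed.
Lemma rec1_chead : rec1 chead.
Proof.
have H : rec2 (fun m n => \sum_(j < m) ~~ odd (iter j chalf n)).
  apply: (@rec2_prec _ (fun=> 0) (fun m z n => z + (1 - odd (iter m chalf n)))) => [||y|m y].
  - exact: rec1_const.
  - apply: rec3_comp2; first exact: rec2_add.
      by apply: rec3_12; apply: rec2_snd; apply: rec1_id.
    apply: rec3_13; apply: (@rec2_comp1 (fun t => 1 - odd t) _ _ rec2_iterchalf).
    by apply: rec1_comp2 rec2_sub (rec1_const 1) rec1_odd.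
  - by rewrite big_ord0.
  - by rewrite big_ord_recr /=; case: odd.
exact: rec1_comp2 H rec1_id rec1_id.
Qed.

Lemma iter_chalf_ccons n m j : iter j chalf (ccons n m) = ccons (n - j) m.
Proof.
elim: j => [|j IHj] /=; first by rewrite subn0.
rewrite IHj /chalf /ccons oddM oddX /= odd_double /=.
rewrite andbT orbF subnS; case: (n - j) => [|k] //=.
by rewrite expnS -mulnA mul2n doubleK.
Qed.
Lemma ccons_gt n m : n < ccons n m.
Proof. by rewrite /ccons; have := ltn_expl n (isT : 1 < 2); nia. Qed.
Lemma ctail_ccons n m : ctail (ccons n m) = m.
Proof.
rewrite /ctail iter_chalf_ccons; have /ltnW/eqP-> := ccons_gt n m.
by rewrite /ccons mul1n /= uphalf_double.
Qed.
Lemma chead_ccons n m : chead (ccons n m) = n.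
Proof.
rewrite /chead -(big_mkord xpredT (fun j => nat_of_bool (~~ odd (iter j chalf (ccons n m))))).
rewrite (@big_cat_nat _ _ _ n) //=; last exact: ltnW (ccons_gt n m).
rewrite (@eq_big_nat _ _ _ 0 n _ (fun=> 1)) => [|i /andP[_ lt_in]].
  rewrite big_nat_cond (@eq_big_nat _ _ _ n _ _ (fun=> 0)) => [|i /andP[le_ni _]].
    by rewrite -!big_nat_cond big_const_nat iter_addn_0 subn0 mul1n big1 ?addn0.
  by rewrite iter_chalf_ccons (eqP le_ni) /ccons mul1n /= odd_double.
by rewrite iter_chalf_ccons /ccons oddM oddX /= subn_eq0 leqNgt lt_in.
Qed.
Lemma ccons_neq0 n m : ccons n m != 0.
Proof. by rewrite -lt0n (leq_ltn_trans _ (ccons_gt n m)). Qed.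

(** * Computable functions on coded data *)

Class coded (T : Type) := { enc : T -> nat; enc_inj : injective enc }.
Arguments enc {T coded} _ : simpl never.

#[export] Instance coded_nat : coded nat := {| enc := id; enc_inj := @inj_id nat |}.

Lemma nat_of_bool_inj : injective nat_of_bool.
Proof. by case=> -[]. Qed.
#[export] Instance coded_bool : coded bool := {| enc := nat_of_bool; enc_inj := nat_of_bool_inj |}.

Definition enc_seq T (cT : coded T) (s : seq T) := CodeSeq.code (map enc s).
Lemma enc_seq_inj T (cT : coded T) : injective (@enc_seq T cT).
Proof. by move=> s t /(can_inj CodeSeq.codeK) /inj_map; apply; apply: enc_inj. Qed.
#[export] Instance coded_seq T (cT : coded T) : coded (seq T) :=
  {| enc := @enc_seq T cT; enc_inj := @enc_seq_inj T cT |}.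

Definition enc_pair S T (cS : coded S) (cT : coded T) (p : S * T) := ccons (enc p.1) (enc p.2).
Lemma enc_pair_inj S T (cS : coded S) (cT : coded T) : injective (@enc_pair S T cS cT).
Proof.
move=> [a b] [c d] /= e.
have := congr1 ctail e; have := congr1 chead e.
rewrite /enc_pair !chead_ccons !ctail_ccons => e1 e2.
congr pair; [exact: (@enc_inj _ cS) | exact: (@enc_inj _ cT)].
Qed.
#[export] Instance coded_pair S T (cS : coded S) (cT : coded T) : coded (S * T) :=
  {| enc := @enc_pair S T cS cT; enc_inj := @enc_pair_inj S T cS cT |}.

Lemma enc_cons T (cT : coded T) (x : T) s : enc (x :: s) = ccons (enc x) (enc s).
Proof. by []. Qed.

(* [f] is realised on codes by a total recursive function; the argument of [f] *)
(* plays the role of the environment of an open term.                          *)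
Definition computable E T (cE : coded E) (cT : coded T) (f : E -> T) :=
  exists2 g, rec1 g & forall e, g (enc e) = enc (f e).
Arguments computable {E T cE cT} f.

Section Closure.
Context {E : Type} {cE : coded E}.

Lemma c_id : computable (fun e : E => e).
Proof. by exists id => //; apply: rec1_id. Qed.

Lemma c_const {T} {cT : coded T} (t : T) : computable (fun _ : E => t).
Proof. by exists (fun=> enc t) => //; apply: rec1_const. Qed.

Lemma c_comp {T U} {cT : coded T} {cU : coded U} (f : E -> T) (g : T -> U) :
  computable g -> computable f -> computable (fun e => g (f e)).
Proof.
move=> [gc Rg Hg] [fc Rf Hf]; exists (fun n => gc (fc n)); first exact: rec1_comp.
by move=> e; rewrite Hf Hg.
Qed.

Lemma c_pair {T U} {cT : coded T} {cU : coded U} (f : E -> T) (g : E -> U) :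
  computable f -> computable g -> computable (fun e => (f e, g e)).
Proof.
move=> [fc Rf Hf] [gc Rg Hg]; exists (fun n => ccons (fc n) (gc n)).
  exact: rec1_comp2 rec2_ccons Rf Rg.
by move=> e; rewrite Hf Hg.
Qed.

Lemma c_cons {T} {cT : coded T} (f : E -> T) (g : E -> seq T) :
  computable f -> computable g -> computable (fun e => f e :: g e).
Proof.
move=> [fc Rf Hf] [gc Rg Hg]; exists (fun n => ccons (fc n) (gc n)).
  exact: rec1_comp2 rec2_ccons Rf Rg.
by move=> e; rewrite Hf Hg.
Qed.

Lemma c_fst {T U} {cT : coded T} {cU : coded U} (f : E -> T * U) :
  computable f -> computable (fun e => (f e).1).
Proof.
move=> [fc Rf Hf]; exists (fun n => chead (fc n)); first exact: rec1_comp rec1_chead Rf.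
by move=> e; rewrite Hf /= /enc_pair chead_ccons.
Qed.

Lemma c_snd {T U} {cT : coded T} {cU : coded U} (f : E -> T * U) :
  computable f -> computable (fun e => (f e).2).
Proof.
move=> [fc Rf Hf]; exists (fun n => ctail (fc n)); first exact: rec1_comp rec1_ctail Rf.
by move=> e; rewrite Hf /= /enc_pair ctail_ccons.
Qed.

Lemma c_nat2 (op : nat -> nat -> nat) (f g : E -> nat) : rec2 op ->
  computable f -> computable g -> computable (fun e => op (f e) (g e)).
Proof.
move=> Rop [fc Rf Hf] [gc Rg Hg]; exists (fun n => op (fc n) (gc n)).
  exact: rec1_comp2 Rop Rf Rg.
by move=> e; rewrite Hf Hg.
Qed.

Lemma c_add (f g : E -> nat) : computable f -> computable g -> computable (fun e => f e + g e).
Proof. exact: c_nat2 rec2_add. Qed.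
Lemma c_sub (f g : E -> nat) : computable f -> computable g -> computable (fun e => f e - g e).
Proof. exact: c_nat2 rec2_sub. Qed.

Lemma c_bool2 (op : nat -> nat -> bool) (f g : E -> nat) : rec2 (fun x y => op x y) ->
  computable f -> computable g -> computable (fun e => op (f e) (g e)).
Proof.
move=> Rop [fc Rf Hf] [gc Rg Hg]; exists (fun n => op (fc n) (gc n)).
  exact: rec1_comp2 Rop Rf Rg.
by move=> e; rewrite Hf Hg.
Qed.

Lemma c_leq (f g : E -> nat) : computable f -> computable g -> computable (fun e => f e <= g e).
Proof. exact: c_bool2 rec2_leq. Qed.

Lemma c_succ (f : E -> nat) : computable f -> computable (fun e => (f e).+1).
Proof. by move=> [fc Rf Hf]; exists (fun n => (fc n).+1); [exact: rec1_comp rec1_succ Rf | move=> e; rewrite Hf]. Qed.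

Lemma c_eq {T : eqType} {cT : coded T} (f g : E -> T) :
  computable f -> computable g -> computable (fun e => f e == g e).
Proof.
move=> [fc Rf Hf] [gc Rg Hg]; exists (fun n => fc n == gc n).
  exact: rec1_comp2 rec2_eq Rf Rg.
by move=> e; rewrite Hf Hg (inj_eq enc_inj).
Qed.

Lemma c_if {T} {cT : coded T} (b : E -> bool) (f g : E -> T) :
  computable b -> computable f -> computable g ->
  computable (fun e => if b e then f e else g e).
Proof.
move=> [bc [rb Rb] Hb] [fc [rf Rf] Hf] [gc [rg Rg] Hg].
exists (fun n => if bc n != 0 then fc n else gc n).
  have [r Hr] := rec3_if; exists (Comp r [:: rb; rf; rg]) => x v.
  exact: eval_comp3 (Rb _ _) (Rf _ _) (Rg _ _) (Hr _ _ _ _).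
by move=> e; rewrite Hb Hf Hg /= eqb0 negbK; case: (b e).
Qed.

Lemma c_and (f g : E -> bool) : computable f -> computable g -> computable (fun e => f e && g e).
Proof. by move=> cf cg; apply: c_if => //; apply: c_const. Qed.
Lemma c_or (f g : E -> bool) : computable f -> computable g -> computable (fun e => f e || g e).
Proof. by move=> cf cg; apply: c_if => //; apply: c_const. Qed.
Lemma c_neg (f : E -> bool) : computable f -> computable (fun e => ~~ f e).
Proof. by move=> cf; apply: c_if => //; apply: c_const. Qed.

Lemma c_iter {T} {cT : coded T} (n : E -> nat) (h : E -> T -> T) (i : E -> T) :
  computable n -> computable i -> computable (fun p : E * T => h p.1 p.2) ->
  computable (fun e => iter (n e) (h e) (i e)).
Proof.
move=> [nc [rn Rn] Hn] [ic [ri Ri] Hi] [hc Rh Hh].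
exists (fun m => iter (nc m) (fun s => hc (ccons m s)) (ic m)).
  have [r Hr] := rec2_iter (rec2_comp1 Rh rec2_ccons).
  exists (Comp r [:: Proj 0; rn; ri]) => x v.
  exact: eval_comp3 (eval_proj0 _ _) (Rn _ _) (Ri _ _) (Hr _ _ _ _).
move=> e; rewrite Hn Hi [enc (n e)]/=; elim: (n e) => [|k IHk] //=.
by rewrite IHk; exact: (Hh (e, _)).
Qed.
End Closure.

Section Lists.
Context {E : Type} {cE : coded E}.

Lemma c_behead {T} {cT : coded T} (l : E -> seq T) : computable l -> computable (fun e => behead (l e)).
Proof.
move=> [lc Rl Hl]; exists (fun n => ctail (lc n)); first exact: rec1_comp rec1_ctail Rl.
by move=> e; rewrite Hl; case: (l e) => [|x s] //=; rewrite enc_cons ctail_ccons.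
Qed.

Lemma c_nilp {T} {cT : coded T} (l : E -> seq T) : computable l -> computable (fun e => nilp (l e)).
Proof.
move=> [lc Rl Hl]; exists (fun n => lc n == 0); first exact: rec1_comp2 rec2_eq Rl (rec1_const 0).
move=> e; rewrite Hl; case: (l e) => [|x s] //=.
by rewrite enc_cons (negbTE (ccons_neq0 _ _)).
Qed.

Lemma c_head {T} {cT : coded T} (x0 : T) (l : E -> seq T) :
  computable l -> computable (fun e => head x0 (l e)).
Proof.
move=> cl; have [lc Rl Hl] := cl.
have [zc Rz Hz] := c_nilp cl.
have := @c_if E cE nat coded_nat (fun e => nilp (l e)) (fun=> enc x0) (fun e => chead (enc (l e))).
case=> [|||g Rg Hg]; first by exists zc.
- exact: c_const.
- by exists (fun n => chead (lc n)); [exact: rec1_comp rec1_chead Rl | move=> e; rewrite Hl].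
exists g => // e; rewrite Hg; case: (l e) => [|x s] //=.
exact: chead_ccons.
Qed.

Lemma size_enc {T} {cT : coded T} (s : seq T) : size s <= enc s.
Proof.
elim: s => //= x s IHs; apply: leq_ltn_trans IHs _.
by rewrite enc_cons /ccons; have := ltn_expl (enc x) (isT : 1 < 2); nia.
Qed.

Lemma c_foldl {T U} {cT : coded T} {cU : coded U} (h : E -> U -> T -> U) (i : E -> U) (l : E -> seq T) :
  computable (fun p : E * U * T => h p.1.1 p.1.2 p.2) -> computable i -> computable l ->
  computable (fun e => foldl (h e) (i e) (l e)).
Proof.
move=> [hc Rh Hh] [ic [ri Ri] Hi] [lc [rl Rl] Hl].
(* The state pairs the code of the unread list with that of the accumulator. The code of the list,
   which is at least its length, serves as the number of steps; surplus steps meet the code [0] of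
   the empty list and do nothing. *)
pose step m st := if chead st != 0 then
  ccons (ctail (chead st)) (hc (ccons (ccons m (ctail st)) (chead (chead st)))) else st.
have Rstep : rec2 step.
  have R0 : rec2 (fun m st => st) by apply: rec2_snd; apply: rec1_id.
  have Rh' : rec2 (fun m st => chead st) by apply: rec2_snd; apply: rec1_chead.
  have [r1 H1] := Rh'.
  have [r2 H2] : rec2 (fun m st => ccons (ctail (chead st))
      (hc (ccons (ccons m (ctail st)) (chead (chead st))))).
    apply: rec2_comp rec2_ccons _ _; first by apply: rec2_comp1 rec1_ctail Rh'.
    apply: rec2_comp1 Rh _; apply: rec2_comp rec2_ccons _ _; last by apply: rec2_comp1 rec1_chead Rh'.
    apply: rec2_comp rec2_ccons _ _; first by apply: rec2_fst; apply: rec1_id.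
    by apply: rec2_snd; apply: rec1_ctail.
  have [r Hr] := rec3_if; exists (Comp r [:: r1; r2; Proj 1]) => m st v.
  exact: eval_comp3 (H1 _ _ _) (H2 _ _ _) (eval_proj1 _ _ _) (Hr _ _ _ _).
exists (fun m => ctail (iter (lc m) (step m) (ccons (lc m) (ic m)))).
  apply: rec1_comp rec1_ctail _.
  have [rc Hc] := rec2_ccons; have [r Hr] := rec2_iter Rstep.
  exists (Comp r [:: Proj 0; rl; Comp rc [:: rl; ri]]) => x v.
  apply: eval_comp3 (eval_proj0 _ _) (Rl _ _) _ (Hr _ _ _ _).
  exact: eval_comp2 (Rl _ _) (Ri _ _) (Hc _ _ _).
move=> e; rewrite Hl Hi.
have step0 k u : ctail (iter k (step (enc e)) (ccons 0 (enc u))) = enc u.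
  have -> : iter k (step (enc e)) (ccons 0 (enc u)) = ccons 0 (enc u).
    by elim: k => //= j ->; rewrite /step chead_ccons.
  by rewrite ctail_ccons.
have [K leK EK] : exists2 K, size (l e) <= K & K = enc (l e) by exists (enc (l e)) => //; apply: size_enc.
rewrite -{1}EK {EK}.
elim: K (l e) (i e) leK => [|k IHk] [|x s] u // le_sk; try exact: step0.
rewrite iterSr {2}/step enc_cons !chead_ccons ccons_neq0 !ctail_ccons.
by rewrite (Hh (e, u, x)) IHk.
Qed.

Lemma c_rev {T} {cT : coded T} (l : E -> seq T) : computable l -> computable (fun e => rev (l e)).
Proof.
move=> cl; have H : computable (fun e => foldl (fun a x => x :: a) [::] (l e)).
  apply: c_foldl => //; last exact: c_const.
  by apply: c_cons; [apply: c_snd; apply: c_id | do 2![apply: c_snd || apply: c_fst]; apply: c_id].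
have [g Rg Hg] := H; exists g => // e; rewrite Hg; congr enc.
by rewrite /rev; elim: (l e) [::] => //= x s IHs a; rewrite IHs.
Qed.

Lemma c_foldr {T U} {cT : coded T} {cU : coded U} (h : E -> T -> U -> U) (i : E -> U) (l : E -> seq T) :
  computable (fun p : E * T * U => h p.1.1 p.1.2 p.2) -> computable i -> computable l ->
  computable (fun e => foldr (h e) (i e) (l e)).
Proof.
move=> ch ci cl.
have H : computable (fun e => foldl (fun u x => h e x u) (i e) (rev (l e))).
  apply: c_foldl => //; last exact: c_rev.
  apply: (@c_comp _ _ _ _ _ _ (fun p : E * U * T => (p.1.1, p.2, p.1.2)) _ ch).
  apply: c_pair; last by do 2![apply: c_snd || apply: c_fst]; apply: c_id.
  by apply: c_pair; [do 2!apply: c_fst; apply: c_id | apply: c_snd; apply: c_id].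
by have [g Rg Hg] := H; exists g => // e; rewrite Hg foldl_rev.
Qed.
End Lists.

Lemma c_ext {E T} {cE : coded E} {cT : coded T} (f g : E -> T) :
  (forall e, f e = g e) -> computable f -> computable g.
Proof. by move=> fg [h Rh Hh]; exists h => // e; rewrite -fg. Qed.

Ltac comp_base := repeat (cbn beta; lazymatch goal with
  | |- computable (fun e => e) => exact: c_id
  | |- computable (@fst _ _) => exact: (c_fst c_id)
  | |- computable (@snd _ _) => exact: (c_snd c_id)
  | |- computable (fun e => @fst _ _ _) => apply: c_fst
  | |- computable (fun e => @snd _ _ _) => apply: c_snd
  | |- computable (fun e => (_, _)) => apply: c_pair
  | |- computable (fun e => _ :: _) => first [exact: c_const | apply: c_cons]
  | |- computable (fun e => if _ then _ else _) => apply: c_if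
  | |- computable (fun e => iter _ _ _) => apply: c_iter
  | |- computable (fun e => foldl _ _ _) => apply: c_foldl
  | |- computable (fun e => foldr _ _ _) => apply: c_foldr
  | |- computable (fun e => nilp _) => apply: c_nilp
  | |- computable (fun e => behead _) => apply: c_behead
  | |- computable (fun e => head _ _) => apply: c_head
  | |- computable (fun e => rev _) => apply: c_rev
  | |- computable (fun e => (_ == _)) => apply: c_eq
  | |- computable (fun e => (_ <= _)) => apply: c_leq
  | |- computable (fun e => (_ - _)) => apply: c_sub
  | |- computable (fun e => (_ + _)) => apply: c_add
  | |- computable (fun e => (_ && _)) => apply: c_and
  | |- computable (fun e => (_ || _)) => apply: c_or
  | |- computable (fun e => ~~ _) => apply: c_neg
  | |- computable (fun e => _.+1) => first [exact: c_const | apply: c_succ]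
  | |- computable (fun e => _) => first [exact: c_const | assumption]
  end).

Lemma c_at1 {E} {cE : coded E} {T U} {cT : coded T} {cU : coded U} (f : E -> T) :
  computable f -> computable (fun p : E * U => f p.1).
Proof. by move=> cf; apply: (c_comp cf (c_fst c_id)). Qed.

Lemma c_cat {E} {cE : coded E} {T} {cT : coded T} (f g : E -> seq T) :
  computable f -> computable g -> computable (fun e => f e ++ g e).
Proof.
move=> cf cg; apply: (@c_ext _ _ _ _ (fun e => foldr cons (g e) (f e))).
  by move=> e; elim: (f e) => //= x s ->.
by apply: c_foldr => //; comp_base.
Qed.

Lemma c_map {E} {cE : coded E} {T U} {cT : coded T} {cU : coded U} (h : E -> T -> U) (l : E -> seq T) :
  computable (fun p : E * T => h p.1 p.2) -> computable l -> computable (fun e => map (h e) (l e)).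
Proof.
move=> ch cl; apply: (@c_ext _ _ _ _ (fun e => foldr (fun x s => h e x :: s) [::] (l e))).
  by move=> e; elim: (l e) => //= x s ->.
apply: c_foldr => //; comp_base; exact: (@c_comp _ _ _ _ _ _ (fun p : E * T * seq U => p.1) _ ch (c_fst c_id)).
Qed.

Lemma c_flatten {E} {cE : coded E} {T} {cT : coded T} (l : E -> seq (seq T)) :
  computable l -> computable (fun e => flatten (l e)).
Proof.
move=> cl; apply: (@c_ext _ _ _ _ (fun e => foldr (fun s t => s ++ t) [::] (l e))) => //.
by apply: c_foldr => //; comp_base; apply: c_cat; comp_base.
Qed.

Lemma c_size {E} {cE : coded E} {T} {cT : coded T} (l : E -> seq T) : computable l -> computable (fun e => size (l e)).
Proof.
move=> cl; apply: (@c_ext _ _ _ _ (fun e => foldr (fun _ n => n.+1) 0 (l e))).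
  by move=> e; elim: (l e) => //= x s ->.
by apply: c_foldr => //; comp_base.
Qed.

Lemma c_all {E} {cE : coded E} {T} {cT : coded T} (h : E -> T -> bool) (l : E -> seq T) :
  computable (fun p : E * T => h p.1 p.2) -> computable l -> computable (fun e => all (h e) (l e)).
Proof.
move=> ch cl; apply: (@c_ext _ _ _ _ (fun e => foldr (fun x b => h e x && b) true (l e))).
  by move=> e; elim: (l e) => //= x s ->.
apply: c_foldr => //; comp_base; exact: (@c_comp _ _ _ _ _ _ (fun p : E * T * bool => p.1) _ ch (c_fst c_id)).
Qed.

Lemma c_has {E} {cE : coded E} {T} {cT : coded T} (h : E -> T -> bool) (l : E -> seq T) :
  computable (fun p : E * T => h p.1 p.2) -> computable l -> computable (fun e => has (h e) (l e)).
Proof.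
move=> ch cl; apply: (@c_ext _ _ _ _ (fun e => ~~ all (fun x => ~~ h e x) (l e))).
  by move=> e; rewrite -has_predC; apply: eq_has => x /=; rewrite negbK.
by apply: c_neg; apply: c_all => //; apply: c_neg.
Qed.

Lemma c_drop {E} {cE : coded E} {T} {cT : coded T} (n : E -> nat) (l : E -> seq T) :
  computable n -> computable l -> computable (fun e => drop (n e) (l e)).
Proof.
move=> cn cl; apply: (@c_ext _ _ _ _ (fun e => iter (n e) behead (l e))).
  by move=> e; elim: (n e) => /= [|k ->]; rewrite ?drop0 // -drop1 drop_drop add1n.
by apply: c_iter => //; comp_base.
Qed.

Lemma c_take {E} {cE : coded E} {T} {cT : coded T} (n : E -> nat) (l : E -> seq T) :
  computable n -> computable l -> computable (fun e => take (n e) (l e)).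
Proof.
move=> cn cl; apply: (@c_ext _ _ _ _ (fun e => rev (drop (size (l e) - n e) (rev (l e))))).
  move=> e; rewrite -{2}[l e]revK drop_rev revK revK -{3}(cat_take_drop (n e) (l e)).
  have [le|lt] := leqP (n e) (size (l e)).
    by rewrite subKn // take_cat size_takel // ltnn subnn take0 cats0.
  by rewrite cat_take_drop (eqP (ltnW lt)) subn0 take_size take_oversize // ltnW.
by apply: c_rev; apply: c_drop; [apply: c_sub => //; apply: c_size | apply: c_rev].
Qed.

Lemma c_nth {E} {cE : coded E} {T} {cT : coded T} (x0 : T) (l : E -> seq T) (n : E -> nat) :
  computable l -> computable n -> computable (fun e => nth x0 (l e) (n e)).
Proof.
move=> cl cn; apply: (@c_ext _ _ _ _ (fun e => head x0 (drop (n e) (l e)))).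
  by move=> e; rewrite -nth0 nth_drop addn0.
by apply: c_head; apply: c_drop.
Qed.

Lemma c_iota {E} {cE : coded E} (m n : E -> nat) : computable m -> computable n -> computable (fun e => iota (m e) (n e)).
Proof.
move=> cm cn; apply: (@c_ext _ _ _ _ (fun e => rev (iter (n e) (fun s => (m e + size s) :: s) [::]))).
  move=> e; elim: (n e) => // k IHk; rewrite iterS rev_cons IHk -[in RHS]addn1 iotaD cats1 /=.
  by rewrite -[size _]size_rev IHk size_iota.
apply: c_rev; apply: c_iter => //; first exact: c_const.
by apply: c_cons; [apply: c_add; [exact: c_at1 | apply: c_size; comp_base] | comp_base].
Qed.

(** Every number codes a list, so any number is a candidate certificate and its fields need no test
    of well-formedness. Since [enc] undoes these functions, they are realised on codes by the
    identity. *)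
Definition dec1 : nat -> seq nat := CodeSeq.decode.
Definition dec2 n : seq (seq nat) := map dec1 (CodeSeq.decode n).
Definition dec3 n : seq (seq (seq nat)) := map dec2 (CodeSeq.decode n).

Lemma enc_dec1 n : enc (dec1 n) = n.
Proof. by rewrite /enc /= /enc_seq map_id CodeSeq.decodeK. Qed.
Lemma enc_dec2 n : enc (dec2 n) = n.
Proof.
rewrite {1}/enc /= /enc_seq -map_comp (@eq_map _ _ _ id) ?map_id ?CodeSeq.decodeK // => k /=.
exact: enc_dec1.
Qed.
Lemma enc_dec3 n : enc (dec3 n) = n.
Proof.
rewrite {1}/enc /= /enc_seq -map_comp (@eq_map _ _ _ id) ?map_id ?CodeSeq.decodeK // => k /=.
exact: enc_dec2.
Qed.

Lemma enc_seqK (s : seq nat) : dec1 (enc s) = s.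
Proof. by apply: (@enc_inj _ (coded_seq coded_nat)); rewrite enc_dec1. Qed.
Lemma enc_seq2K (s : seq (seq nat)) : dec2 (enc s) = s.
Proof. by apply: (@enc_inj _ (coded_seq (coded_seq coded_nat))); rewrite enc_dec2. Qed.
Lemma enc_seq3K (s : seq (seq (seq nat))) : dec3 (enc s) = s.
Proof. by apply: (@enc_inj _ (coded_seq (coded_seq (coded_seq coded_nat)))); rewrite enc_dec3. Qed.

Lemma c_dec {E T} {cE : coded E} {cT : coded T} (d : nat -> T) (f : E -> nat) :
  (forall n, enc (d n) = n) -> computable f -> computable (fun e => d (f e)).
Proof. by move=> dK [g Rg Hg]; exists g => // e; rewrite Hg dK. Qed.

Ltac comp := repeat (comp_base; lazymatch goal with
  | |- computable (fun e => _ ++ _) => apply: c_cat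
  | |- computable (fun e => map _ _) => apply: c_map
  | |- computable (fun e => flatten _) => apply: c_flatten
  | |- computable (fun e => size _) => apply: c_size
  | |- computable (fun e => all _ _) => apply: c_all
  | |- computable (fun e => has _ _) => apply: c_has
  | |- computable (fun e => drop _ _) => apply: c_drop
  | |- computable (fun e => take _ _) => apply: c_take
  | |- computable (fun e => nth _ _ _) => apply: c_nth
  | |- computable (fun e => iota _ _) => apply: c_iota
  | |- computable (fun e => dec1 _) => apply: (c_dec enc_dec1)
  | |- computable (fun e => dec2 _) => apply: (c_dec enc_dec2)
  | |- computable (fun e => dec3 _) => apply: (c_dec enc_dec3)
  end).

(** The value [0] means that [k] proves nothing, [1] that it refutes [P], [2] that it proves [P].
    The program takes the least [k] with a nonzero value and tells which of the two it is. *)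
Lemma search_decides (chk : nat * nat -> nat) : computable chk ->
  exists d, forall n P, (exists k, chk (n, k) != 0) ->
    (forall k, chk (n, k) = 1 -> ~ P) -> (forall k, chk (n, k) = 2 -> P) ->
    (forall k, chk (n, k) <= 2) -> decides d n P.
Proof.
move=> [g Rg Hg].
have R2 : rec2 (fun k n => g (ccons n k)) by apply: rec2_comp1 Rg (rec2_swap rec2_ccons).
have [rf Hf] : rec2 (fun k n => 1 - g (ccons n k)).
  by apply: (@rec2_comp1 (fun t => 1 - t) _ _ R2); apply: rec1_comp2 rec2_sub (rec1_const 1) rec1_id.
have [ro Ho] : rec2 (fun k n => (g (ccons n k) == 2 : nat)).
  apply: (@rec2_comp1 (fun t => t == 2 : nat) _ _ R2).
  exact: rec1_comp2 rec2_eq rec1_id (rec1_const 2).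
exists (Comp ro [:: Mu rf; Proj 0]) => n P exk no yes le2.
have gE k : g (ccons n k) = chk (n, k) by rewrite (Hg (n, k)).
case: (ex_minnP exk) => k chk_k min_k.
exists (g (ccons n k) == 2); split.
  apply: eval_comp2 (eval_proj0 _ _) (Ho _ _ _).
  (* Before the first success [1 - chk] equals [1], the successor of [0]. *)
  apply: (@eval_mu _ _ _ (fun=> 0)) => [i lt_ik|].
    have := Hf i n [::]; rewrite gE.
    have -> // : chk (n, i) = 0.
    by apply/eqP; apply: contraTT lt_ik => /min_k; rewrite -leqNgt.
  have E : 1 - chk (n, k) = 0 by move: chk_k; lia.
  by have := Hf k n [::]; rewrite gE E.
rewrite gE; move: (no k) (yes k) (le2 k) chk_k; case: (chk _) => [|[|[]]] //= no1 yes2 _ _.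
  by split=> // /no1; case.
by split=> // _; apply: yes2.
Qed.

(** * Words, powers of morphisms, images of sequences *)

Lemma extend_cat A B (f : A -> seq B) u v : extend f (u ++ v) = extend f u ++ extend f v.
Proof. by rewrite /extend map_cat flatten_cat. Qed.

Lemma extend_cons A B (f : A -> seq B) c v : extend f (c :: v) = f c ++ extend f v.
Proof. by []. Qed.

Lemma extend1 A B (f : A -> seq B) c : extend f [:: c] = f c.
Proof. by rewrite extend_cons cats0. Qed.

Lemma extend_extend A B C (f : A -> seq B) (g : B -> seq C) w :
  extend g (extend f w) = extend (extend g \o f) w.
Proof. by elim: w => //= c w IHw; rewrite !extend_cons extend_cat IHw. Qed.

Lemma eq_extend A B (f g : A -> seq B) w : f =1 g -> extend f w = extend g w.
Proof. by move=> fg; rewrite /extend (eq_map fg). Qed.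

Lemma size_extend_le A B (f : A -> seq B) M w : (forall c, size (f c) <= M) -> size (extend f w) <= M * size w.
Proof.
by move=> le; elim: w => // c w IHw; rewrite extend_cons size_cat mulnS leq_add.
Qed.

Lemma size_extend_ge A B (f : A -> seq B) w : (forall c, f c <> [::]) -> size w <= size (extend f w).
Proof.
move=> ne; elim: w => // c w IHw; rewrite extend_cons size_cat /=.
by have := ne c; case: (f c) => //= b s _; lia.
Qed.

Lemma extend_rev A B (f : A -> seq B) w : extend (rev \o f) (rev w) = rev (extend f w).
Proof.
by elim: w => // c w IHw; rewrite rev_cons -cats1 extend_cat IHw extend1 extend_cons rev_cat.
Qed.

Section Powers.
Variables (A : Type) (s : A -> seq A).

Definition mpow n (c : A) := iter n (extend s) [:: c].

Lemma iter_extend_cat n u v :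
  iter n (extend s) (u ++ v) = iter n (extend s) u ++ iter n (extend s) v.
Proof. by elim: n => //= n ->; rewrite extend_cat. Qed.

Lemma iter_extend_nil n : iter n (extend s) [::] = [::].
Proof. by elim: n => //= n ->. Qed.

Lemma extend_mpow n w : extend (mpow n) w = iter n (extend s) w.
Proof.
elim: w => [|c w IHw]; first by rewrite iter_extend_nil.
by rewrite extend_cons IHw -iter_extend_cat.
Qed.

Lemma mpowD n m c : mpow (n + m) c = extend (mpow n) (mpow m c).
Proof. by rewrite extend_mpow /mpow iterD. Qed.

Lemma extend_mpowD n m w : extend (mpow (n + m)) w = extend (mpow n) (extend (mpow m) w).
Proof. by rewrite !extend_mpow iterD. Qed.

Lemma mpow0 c : mpow 0 c = [:: c]. Proof. by []. Qed.
Lemma mpow1 c : mpow 1 c = s c. Proof. exact: extend1. Qed.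
Lemma extend_mpow0 w : extend (mpow 0) w = w. Proof. by rewrite extend_mpow. Qed.
Lemma extend_mpow1 w : extend (mpow 1) w = extend s w. Proof. by rewrite extend_mpow. Qed.
Lemma mpowSr n c : mpow n.+1 c = extend (mpow n) (s c).
Proof. by rewrite -addn1 mpowD mpow1. Qed.
End Powers.

Lemma mpow_mpow A (s : A -> seq A) p n c : mpow (mpow s p) n c = mpow s (p * n) c.
Proof.
elim: n c => [|n IHn] c; first by rewrite muln0.
by rewrite mulnS mpowD -IHn /mpow iterS -extend_mpow.
Qed.

Definition wpow A B (s : A -> seq A) (f : A -> seq B) n c := extend f (mpow s n c).

Lemma extend_wpow A B (s : A -> seq A) (f : A -> seq B) n w :
  extend (wpow s f n) w = extend f (extend (mpow s n) w).
Proof. by rewrite extend_extend. Qed.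

Lemma extend_wpowD A B (s : A -> seq A) (f : A -> seq B) n m w :
  extend (wpow s f (n + m)) w = extend (wpow s f n) (extend (mpow s m) w).
Proof. by rewrite !extend_wpow extend_mpowD. Qed.

Lemma wpowD A B (s : A -> seq A) (f : A -> seq B) n m c :
  wpow s f (n + m) c = extend (wpow s f n) (mpow s m c).
Proof. by rewrite -[LHS]extend1 extend_wpowD extend1. Qed.

Lemma wpow0 A B (s : A -> seq A) (f : A -> seq B) c : wpow s f 0 c = f c.
Proof. exact: extend1. Qed.

Lemma wpowSr A B (s : A -> seq A) (f : A -> seq B) n c : wpow s f n.+1 c = extend (wpow s f n) (s c).
Proof. by rewrite -addn1 wpowD mpow1. Qed.

Section Occurrences.
Variable B : Type.
Implicit Types (y : nat -> B) (u v w : seq B).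

Definition seg y i n := mkseq (fun k => y (i + k)) n.

Lemma size_seg y i n : size (seg y i n) = n. Proof. exact: size_mkseq. Qed.

Lemma segD y i m n : seg y i (m + n) = seg y i m ++ seg y (i + m) n.
Proof.
rewrite /seg /mkseq iotaD map_cat add0n; congr (_ ++ _).
by rewrite -[m]addn0 iotaDl -map_comp; apply: eq_map => k /=; rewrite addn0 addnA.
Qed.

Lemma nth_seg b y i n k : k < n -> nth b (seg y i n) k = y (i + k).
Proof. exact: nth_mkseq. Qed.

Lemma mkseq_seg y n : mkseq y n = seg y 0 n. Proof. by []. Qed.

Lemma occurs_seg y i n : occurs y (seg y i n) i.
Proof. by rewrite /occurs size_seg. Qed.

Lemma occursE y w i : occurs y w i -> w = seg y i (size w).
Proof. by []. Qed.

Lemma occurs_cat y u v i : occurs y (u ++ v) i <-> occurs y u i /\ occurs y v (i + size u).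
Proof.
rewrite /occurs -!/(seg _ _ _) size_cat segD; split=> [e|[-> ->]] //.
by split; [have := congr1 (take (size u)) e | have := congr1 (drop (size u)) e];
  rewrite ?take_size_cat ?drop_size_cat ?size_seg.
Qed.

Lemma occurs_cons y b w i : occurs y (b :: w) i <-> y i = b /\ occurs y w i.+1.
Proof.
rewrite -cat1s occurs_cat addn1 /occurs /mkseq /= addn0.
by split=> -[H1 H2]; split=> //; [case: H1 | rewrite H1].
Qed.

Lemma occurs_nth b y w i k : occurs y w i -> k < size w -> nth b w k = y (i + k).
Proof. by move=> /occursE e lt; rewrite e nth_seg. Qed.

Definition factor y w := exists i, occurs y w i.

Lemma factor_infix y u v w : factor y (u ++ v ++ w) -> factor y v.
Proof. by move=> [i /occurs_cat[_ /occurs_cat[Hv _]]]; exists (i + size u). Qed.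

Lemma factor_seg y i n : factor y (seg y i n).
Proof. by exists i; apply: occurs_seg. Qed.

Lemma seg_sub y i n j m : i <= j -> j + m <= i + n ->
  seg y i n = seg y i (j - i) ++ seg y j m ++ seg y (j + m) (i + n - (j + m)).
Proof.
move=> le1 le2; have -> : n = (j - i) + (m + (i + n - (j + m))) by lia.
rewrite segD segD; congr (_ ++ (seg _ _ _ ++ seg _ _ _)); lia.
Qed.

Lemma seg_eq y i j n : (forall k, k < n -> y (i + k) = y (j + k)) -> seg y i n = seg y j n.
Proof.
move=> e; rewrite /seg /mkseq; apply/eq_in_map => k; rewrite mem_iota add0n.
exact: e.
Qed.

Lemma eq_seg y i j n k : seg y i n = seg y j n -> k < n -> y (i + k) = y (j + k).
Proof. by move=> e lt; rewrite -(nth_seg (y 0) y i lt) e nth_seg. Qed.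
End Occurrences.

Section Images.

(** Equivalent to [is_image] ([is_imageP]), but stated on prefixes, which makes it stable under
    composition. *)
Definition img A B (f : A -> seq B) (x : nat -> A) (y : nat -> B) :=
  (forall n, occurs y (extend f (mkseq x n)) 0) /\
  (forall L, exists n, L <= size (extend f (mkseq x n))).

(** The position in the image sequence at which the block [f (x j)] starts. *)
Definition cut A B (f : A -> seq B) (x : nat -> A) j := size (extend f (mkseq x j)).

Lemma cut0 A B (f : A -> seq B) x : cut f x 0 = 0. Proof. by []. Qed.

Lemma cutD A B (f : A -> seq B) x i n : cut f x (i + n) = cut f x i + size (extend f (seg x i n)).
Proof. by rewrite /cut !mkseq_seg segD extend_cat size_cat. Qed.

Lemma cutS A B (f : A -> seq B) x i : cut f x i.+1 = cut f x i + size (f (x i)).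
Proof. by rewrite -addn1 cutD /seg /mkseq /= addn0 extend1. Qed.

Lemma cut_le A B (f : A -> seq B) x i j : i <= j -> cut f x i <= cut f x j.
Proof. by move=> /subnKC <-; rewrite cutD leq_addr. Qed.

Lemma img_occurs A B (f : A -> seq B) x y w i :
  img f x y -> occurs x w i -> occurs y (extend f w) (cut f x i).
Proof.
move=> [pre _] ow; have := pre (i + size w).
rewrite mkseq_seg segD extend_cat => /occurs_cat[_]; rewrite add0n.
by rewrite add0n -(occursE ow).
Qed.

Lemma img_factor A B (f : A -> seq B) x y w : img f x y -> factor x w -> factor y (extend f w).
Proof. by move=> im [i o]; exists (cut f x i); apply: img_occurs. Qed.

Lemma img_seg A B (f : A -> seq B) x y i n : img f x y ->
  extend f (seg x i n) = seg y (cut f x i) (size (extend f (seg x i n))).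
Proof. by move=> im; apply: occursE; apply: img_occurs im _; apply: occurs_seg. Qed.

Lemma img_letter A B (f : A -> seq B) x y i : img f x y ->
  f (x i) = seg y (cut f x i) (size (f (x i))).
Proof. by move=> im; have := img_seg i 1 im; rewrite /seg /mkseq /= addn0 extend1. Qed.

Lemma img_inf A B (f : A -> seq B) x y P : img f x y -> exists j, P <= cut f x j.
Proof. by case=> _ /(_ P). Qed.

Lemma img_comp A B C (f : A -> seq B) (g : B -> seq C) x y z :
  img f x y -> img g y z -> img (extend g \o f) x z.
Proof.
move=> im1 im2; split=> [n|L]; rewrite -?extend_extend.
  by have := img_occurs im2 (im1.1 n).
have [m Hm] := im2.2 L; have [n Hn] := im1.2 m; exists n.
rewrite -extend_extend; apply: leq_trans Hm _.
rewrite (occursE (im1.1 n)) mkseq_seg -(subnKC Hn) segD extend_cat size_cat.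
exact: leq_addr.
Qed.

Lemma eq_img A B (f g : A -> seq B) x y : f =1 g -> img f x y -> img g x y.
Proof.
move=> fg [pre inf]; split=> [n|L]; first by rewrite -(eq_extend _ fg).
by have [n Hn] := inf L; exists n; rewrite -(eq_extend _ fg).
Qed.

Lemma img_ex A B (f : A -> seq B) x :
  (forall L, exists n, L <= cut f x n) -> exists y, img f x y.
Proof.
move=> inf; have [n0 Hn0] := inf 1.
have [b0 _] : exists b : B, True.
  by move: Hn0; rewrite /cut; case: (extend _ _) => // b s _; exists b.
pose N i := projT1 (cid (inf i.+1)).
have HN i : i < cut f x (N i) by rewrite /N; case: cid.
pose y i := nth b0 (extend f (mkseq x (N i))) i.
exists y; split=> // n; rewrite /occurs; apply: (@eq_from_nth _ b0); rewrite size_mkseq // => i lt.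
rewrite nth_mkseq // add0n /y.
case: (leqP n (N i)) => [le|/ltnW le].
  rewrite mkseq_seg -(subnKC le) segD extend_cat nth_cat -mkseq_seg lt //.
by rewrite [in RHS]mkseq_seg -(subnKC le) segD extend_cat nth_cat -mkseq_seg HN.
Qed.

Lemma img_factor_through A B C (d : A -> seq B) (g : B -> seq C) x x2 z :
  img d x x2 -> img (extend g \o d) x z -> img g x2 z.
Proof.
move=> im1 im2; split=> [n|L].
  have [j Hj] := im1.2 n; have := im2.1 j.
  rewrite -extend_extend (occursE (im1.1 j)) -(subnKC Hj) segD extend_cat => /occurs_cat[].
  by rewrite -mkseq_seg.
have [j Hj] := im2.2 L; exists (cut d x j).
by rewrite -extend_extend (occursE (im1.1 j)) -mkseq_seg in Hj.
Qed.

Lemma img_cut_comp A B C (f : A -> seq B) (g : B -> seq C) x y j :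
  img f x y -> cut (extend g \o f) x j = cut g y (cut f x j).
Proof. by move=> im; rewrite /cut -extend_extend {1}(occursE (im.1 j)). Qed.

Lemma img_iter A (s : A -> seq A) x n : img s x x -> img (mpow s n) x x.
Proof.
move=> im; elim: n => [|n IHn].
  split=> [n|L]; first by rewrite extend_mpow0 mkseq_seg; apply: occurs_seg.
  by exists L; rewrite extend_mpow0 size_mkseq.
by apply: eq_img (img_comp im IHn) => c; rewrite mpowSr.
Qed.

Lemma img_wpow A B (s : A -> seq A) (f : A -> seq B) x y n :
  img s x x -> img f x y -> img (wpow s f n) x y.
Proof. by move=> imx imy; apply: img_comp (img_iter n imx) imy. Qed.

End Images.

Lemma ex_least (P : nat -> Prop) : (exists n, P n) -> exists2 n, P n & forall m, m < n -> ~ P m.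
Proof.
move=> exP; have ex : exists n, `[< P n >] by case: exP => n Pn; exists n; apply/asboolP.
case: (ex_minnP ex) => n /asboolP Pn min; exists n => // m lt_mn Pm.
have /min : `[< P m >] by apply/asboolP.
by rewrite leqNgt lt_mn.
Qed.

Lemma ex_greatest (P : nat -> Prop) b : (exists n, P n) -> (forall n, P n -> n <= b) ->
  exists2 n, P n & forall m, n < m -> ~ P m.
Proof.
move=> [n0 Pn0] bd; have [k [Pk lek] min] := @ex_least (fun k => P (b - k) /\ k <= b)
  (ex_intro _ (b - n0) (conj (eq_ind_r P Pn0 (subKn (bd _ Pn0))) (leq_subr _ _))).
exists (b - k) => // m lt_m Pm; have le_mb := bd _ Pm.
by apply: (min (b - m)); [lia | split; [rewrite subKn | lia]].
Qed.

Lemma pigeonhole_inf (T : finType) (P : nat -> Prop) (f : nat -> T) :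
  (forall n, exists2 m, n <= m & P m) -> exists t, forall n, exists2 m, n <= m & P m /\ f m = t.
Proof.
move=> inf; apply: contrapT => noT.
have {}noT t : exists n, forall m, n <= m -> P m -> f m <> t.
  apply: contrapT => H; apply: noT; exists t => n; apply: contrapT => H2; apply: H; exists n => m le Pm e.
  by apply: H2; exists m.
pose N t := projT1 (cid (noT t)).
have HN t : forall m, N t <= m -> P m -> f m <> t by rewrite /N; case: cid.
have [m le Pm] := inf (\max_t N t).
by apply: (HN (f m) m _ Pm) => //; apply: leq_trans le; apply: (leq_bigmax (f m)).
Qed.

(** * Limits of words and the fixed point of a prolongable morphism *)

Section Limits.

Lemma onth_some T (x0 : T) s i : i < size s -> onth s i = Some (nth x0 s i).
Proof. by elim: s i => [|x s IHs] [|i] //= /IHs. Qed.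

Lemma onth_size T (s : seq T) i x : onth s i = Some x -> i < size s.
Proof. by elim: s i => [|b s IHs] [|i] //= /IHs. Qed.

Lemma is_imageP A B (f : A -> seq B) x y : is_image f x y <-> img f x y.
Proof.
split=> [lim|im].
  split=> [n|L]; last first.
    by have [N HN] := lim L; exists N; apply: ltnW; apply: (onth_size (HN N (leqnn _))).
  rewrite /occurs; set s := extend f _; apply: (@eq_from_nth _ (y 0)); rewrite size_mkseq // => i lt.
  rewrite nth_mkseq // add0n; have [N /(_ (N + n) (leq_addr _ _)) /(onth_nth (y 0)) <-] := lim i.
  by rewrite addnC mkseq_seg segD extend_cat nth_cat -mkseq_seg -/s lt.
move=> i; have [N HN] := img_inf i.+1 im; exists N => n le.
have lt : i < cut f x n by apply: leq_trans HN (cut_le _ _ le).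
rewrite (onth_some (y 0)) // (occurs_nth _ (im.1 n)) //.
Qed.

Variables (A : Type) (s : A -> seq A) (a : A).
Hypothesis pro : prolongable s a.

Lemma mpow_prefix n : exists v, mpow s n.+1 a = mpow s n a ++ v.
Proof.
have [[u _ sa] _] := pro; exists (extend (mpow s n) u).
by rewrite mpowSr sa extend_cons.
Qed.

Lemma mpow_prefixD n k : exists v, mpow s (n + k) a = mpow s n a ++ v.
Proof.
elim: k => [|k [v IH]]; first by exists [::]; rewrite addn0 cats0.
by have [v' e] := mpow_prefix (n + k); exists (v ++ v'); rewrite addnS e IH catA.
Qed.

Lemma mpow_unbounded L : exists n, L <= size (mpow s n a).
Proof. by have [_ /(_ L) [N HN]] := pro; exists N; apply: HN. Qed.

Lemma fixpoint_ex : exists2 x, is_fixpoint s a x & forall n, occurs x (mpow s n a) 0.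
Proof.
pose N i := projT1 (cid (mpow_unbounded i.+1)).
have HN i : i < size (mpow s (N i) a) by rewrite /N; case: cid.
pose x i := nth a (mpow s (N i) a) i.
have xE n i : i < size (mpow s n a) -> nth a (mpow s n a) i = x i.
  move=> lt; rewrite /x; case: (leqP n (N i)) => le.
    by have [v e] := mpow_prefixD n (N i - n); move: e; rewrite subnKC // => ->; rewrite nth_cat lt.
  have [v e] := mpow_prefixD (N i) (n - N i); move: e; rewrite (subnKC (ltnW le)) => ->.
  by rewrite nth_cat HN.
exists x => [i|n]; last first.
  by rewrite /occurs; apply: (@eq_from_nth _ a); rewrite size_mkseq // => i lt; rewrite nth_mkseq // xE.
exists (N i) => n le; have lt : i < size (mpow s n a).
  have [v e] := mpow_prefixD (N i) (n - N i); move: e; rewrite (subnKC le) => ->.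
  by rewrite size_cat ltn_addr.
by rewrite -/(mpow s n a) (onth_some a) // xE.
Qed.

Lemma fixpoint_uniq x x' : is_fixpoint s a x -> is_fixpoint s a x' -> x = x'.
Proof.
move=> lx lx'; apply: funext => i; have [N HN] := lx i; have [N' HN'] := lx' i.
have := HN (N + N') (leq_addr _ _); rewrite HN' ?leq_addl // => -[] //.
Qed.

Lemma fixpoint_occurs x n : is_fixpoint s a x -> occurs x (mpow s n a) 0.
Proof. by have [x' fx' Hx'] := fixpoint_ex; move=> /(fixpoint_uniq fx') <-. Qed.

Lemma fixpoint_img x : is_fixpoint s a x -> img s x x.
Proof.
move=> fx; have ox n := fixpoint_occurs n fx.
have key n : exists m, mkseq x n = take n (mpow s m a) /\ n <= size (mpow s m a).
  have [m Hm] := mpow_unbounded n; exists m; split=> //.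
  by rewrite (occursE (ox m)) -(subnKC Hm) segD -mkseq_seg take_size_cat ?size_mkseq.
split=> [n|L].
  have [m [e le]] := key n; have := ox m.+1.
  rewrite /mpow iterS -/(mpow s m a) -(cat_take_drop n (mpow s m a)) extend_cat -e.
  by case/occurs_cat.
have [m Hm] := mpow_unbounded L; case: m Hm => [|m] Hm.
  have [m' Hm'] := mpow_unbounded 2; case: m' Hm' => // m' Hm'.
  exists (size (mpow s m' a)); rewrite mkseq_seg -(occursE (ox m')).
  by apply: leq_trans Hm (ltnW _); rewrite -[extend s _]/(mpow s m'.+1 a).
exists (size (mpow s m a)); rewrite mkseq_seg -(occursE (ox m)).
by rewrite -[extend s _]/(mpow s m.+1 a).
Qed.

Lemma fixpoint_0 x : is_fixpoint s a x -> x 0 = a.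
Proof. by move=> /(fixpoint_occurs 0) /occurs_cons[]. Qed.
End Limits.

(** * Uniform recurrence as bounded waiting times *)

Section UniformRecurrence.
Variables (B : Type) (y : nat -> B).

Definition window w L := forall i, exists2 j, i <= j <= i + L & occurs y w j.

Lemma ur_window w : uniformly_recurrent y -> factor y w -> exists L, window w L.
Proof.
move=> ur fw; have [inf [L gap]] := ur w fw; have [i0 o0] := fw.
(* The gap bound says nothing about positions before the first occurrence; [i0] accounts for
   them. *)
exists (L + i0) => i.
have [j [le oj] minj] := @ex_least (fun j => i <= j /\ occurs y w j)
  (let: ex_intro2 j le o := inf i in ex_intro _ j (conj le o)).
exists j => //; rewrite le /=.
have [[k lt ok]|no] := pselect (exists2 k, k < i & occurs y w k).
  have [k' [lt' ok'] mx] := @ex_greatest (fun k => k < i /\ occurs y w k) i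
    (ex_intro _ k (conj lt ok)) (fun n H => ltnW H.1).
  have := gap k' j; case/(_ _)/Wrap; last by lia.
  split=> //; first by lia.
  move=> l /andP[lt1 lt2] ol; case: (leqP i l) => leil; first exact: (minj l lt2).
  exact: (mx l lt1).
case: (leqP i i0) => [le0|lt0]; last by case: no; exists i0.
have : ~ (i0 < j) by move=> lt; apply: (minj i0 lt).
by move=> /negP; rewrite -leqNgt; lia.
Qed.

Lemma window_ur : (forall w, factor y w -> exists L, window w L) -> uniformly_recurrent y.
Proof.
move=> win w fw; have [L HL] := win w fw; split=> [N|].
  by have [j /andP[le _] oj] := HL N; exists j.
exists L.+1 => i j [lt oi oj no]; have [k /andP[le1 le2] ok] := HL i.+1.
case: (ltnP k j) => lek; last by lia.
by case: (no k) => //; rewrite le1.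
Qed.

Lemma window_infix w L v : window w L -> factor y v -> L + size w <= size v ->
  exists v1 v2, v = v1 ++ w ++ v2.
Proof.
move=> win [i ov] le; have [j /andP[le1 le2] oj] := win i.
rewrite (occursE ov) (@seg_sub _ y i (size v) j (size w)) //; last by lia.
by rewrite -(occursE oj); do 2!eexists.
Qed.
End UniformRecurrence.

Lemma ur_inj B C (f : B -> C) y : injective f -> uniformly_recurrent (f \o y) -> uniformly_recurrent y.
Proof.
move=> finj ur; apply: window_ur => w [i o].
have oE j : occurs (f \o y) (map f w) j -> occurs y w j.
  by rewrite /occurs size_map /mkseq (map_comp f) => /(inj_map finj).
have [|L HL] := @ur_window _ (f \o y) (map f w) ur.
  by exists i; rewrite /occurs size_map /mkseq (map_comp f); congr map.
by exists L => k; have [j lej /oE oj] := HL k; exists j.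
Qed.

Lemma img_window A B (f : A -> seq B) z y w M : img f z y ->
  (forall i, size (f (z i)) <= M) -> (forall i, exists u v, f (z i) = u ++ w ++ v) ->
  window y w (M + M).
Proof.
move=> im leM has i.
have [j gt min] := @ex_least (fun j => i < cut f z j) (img_inf i.+1 im).
have [u [v e]] := has j; exists (cut f z j + size u).
  case: j gt min e => [|j] gt min e; first by rewrite cut0 in gt.
  have := min j (ltnSn _) => /negP; rewrite -leqNgt => lej.
  have := leM j; have := leM j.+1; rewrite e !size_cat cutS.
  by move: gt; rewrite cutS; lia.
have : occurs y (f (z j)) (cut f z j) by rewrite [f _](img_letter j im); apply: occurs_seg.
rewrite e.
by case/occurs_cat=> _ /occurs_cat[].
Qed.

(* Every block [Theta (lam^(j+1) r)] contains [Theta (lam^j (z 0))], and these *)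
(* words exhaust [y].                                                          *)
Lemma ur_of_primitive (R : eqType) B (Theta : R -> seq B) (lam : R -> seq R) z y (rs : seq R) :
  img Theta z y -> img lam z z -> (forall i, z i \in rs) ->
  (forall r, r \in rs -> 1 < size (lam r)) ->
  (forall r r', r \in rs -> r' \in rs -> r' \in lam r) ->
  uniformly_recurrent y.
Proof.
move=> imT imL zrs big prim; apply: window_ur => w [i oi].
have imp j := img_iter j imL.
have pre j : mpow lam j (z 0) = mkseq z (size (mpow lam j (z 0))).
  by have := img_letter 0 (imp j); rewrite cut0.
have szp j : j < size (mpow lam j (z 0)).
  elim: j => // j IHj; rewrite /mpow iterS -/(mpow lam j (z 0)).
  have ge m : m + m <= size (extend lam (mkseq z m)).
    elim: m => // m IHm; rewrite mkseqS -cats1 extend_cat size_cat extend1.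
    by have := big _ (zrs m); lia.
  by rewrite pre; have := ge (size (mpow lam j (z 0))); lia.
(* [J] letters of [z] are enough for their image to contain the given occurrence of [w]. *)
have [J HJ] := img_inf (i + size w) imT.
pose f := extend Theta \o mpow lam J.+1.
have imf : img f z y by apply: img_comp (imp J.+1) imT.
have has k : exists u v, f (z k) = u ++ w ++ v.
  have [v1 [v2 e]] : exists v1 v2, lam (z k) = v1 ++ z 0 :: v2.
    by have /splitPr[v1 v2] := prim _ _ (zrs k) (zrs 0); exists v1, v2.
  rewrite /f /comp mpowSr e !(extend_cat, extend_cons) pre -(subnKC (ltnW (szp J))) mkseq_seg segD.
  rewrite extend_cat (occursE (imT.1 J)) -/(cut Theta z J).
  rewrite (@seg_sub _ y 0 (cut Theta z J) i (size w)) // -(occursE oi).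
  by exists (extend Theta (extend (mpow lam J) v1) ++ seg y 0 (i - 0)); eexists; rewrite -!catA.
exists (\max_(r <- rs) size (f r) + \max_(r <- rs) size (f r)).
apply: img_window imf _ has => k.
by apply: (@leq_bigmax_seq _ rs xpredT (fun r => size (f r))).
Qed.

(** * Pumping derivation trees *)

Lemma mpow_rev A (s : A -> seq A) n c : mpow (rev \o s) n c = rev (mpow s n c).
Proof.
elim: n => // n IHn; rewrite /mpow !iterS -/(mpow _ n c) IHn -/(mpow s n c).
exact: extend_rev.
Qed.

Lemma wpow_rev A B (s : A -> seq A) (f : A -> seq B) n c :
  wpow (rev \o s) (rev \o f) n c = rev (wpow s f n c).
Proof. by rewrite /wpow mpow_rev extend_rev. Qed.

Lemma extend_wpow_rev A B (s : A -> seq A) (f : A -> seq B) n v :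
  extend (wpow (rev \o s) (rev \o f) n) (rev v) = rev (extend (wpow s f n) v).
Proof. by rewrite -extend_rev; apply: eq_extend => c; rewrite wpow_rev. Qed.

Lemma cat_prefix T (u x v y : seq T) : u ++ x = v ++ y -> size u <= size v ->
  exists2 t, v = u ++ t & x = t ++ y.
Proof.
elim: u v => [|b u IHu] [|b' v] //=; first by exists [::].
- by move=> -> _; exists (b' :: v).
- by move=> [-> /IHu IH] /IH[t -> ->]; exists t.
Qed.

(** Pigeonhole: of the [size v] blocks, the one that meets [w] most contains a part [w'] of at least
    the average size. The final alternatives record that [w] leaves this block on a side only if
    [w'] reaches the end of the block there. *)
Lemma largest_overlap A B (f : A -> seq B) v pre w post :
  extend f v = pre ++ w ++ post -> w <> [::] ->
  exists v1 c v2 pre' w' post' wl wr,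
    [/\ v = v1 ++ c :: v2, f c = pre' ++ w' ++ post', w = wl ++ w' ++ wr,
        w' <> [::] & size w <= size v * size w'] /\
    [/\ post' ++ extend f v2 = wr ++ post, extend f v1 ++ pre' = pre ++ wl,
        wr = [::] \/ post' = [::] & wl = [::] \/ pre' = [::]].
Proof.
elim: v pre w => [|c v IHv] pre w.
  by move=> /(congr1 size); rewrite !size_cat /=; case: w => // b w; rewrite /= => e; exfalso; lia.
rewrite extend_cons => e ne.
case: (leqP (size (f c)) (size pre)) => [le|lt].
  have [t preE e2] := cat_prefix e le.
  have [v1 [c' [v2 [pre' [w' [post' [wl [wr [[-> e3 e4 ne' lew] [e5 e6 o1 o2]]]]]]]]]] := IHv _ _ e2 ne.
  exists (c :: v1), c', v2, pre', w', post', wl, wr; split; split=> //.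
    by apply: leq_trans lew _; rewrite leq_mul2r leqnSn orbT.
  by rewrite extend_cons -catA e6 catA -preE.
have [t e1 {}e] := cat_prefix (esym e) (ltnW lt).
have net : t <> [::] by move=> t0; move: lt; rewrite e1 t0 cats0 ltnn.
case: (leqP (size w) (size t)) => [le|lt2].
  have [p tE pE] := cat_prefix e le.
  exists [::], c, v, pre, w, p, [::], [::]; split; split=> //; rewrite ?cats0 //; try by left.
  - by rewrite e1 tE.
  - by rewrite /= mulSn leq_addr.
have [w2 wE {}e] := cat_prefix (esym e) (ltnW lt2).
have ne2 : w2 <> [::] by move=> w20; move: lt2; rewrite wE w20 cats0 ltnn.
have [v1 [c' [v2 [pre' [w' [post' [wl [wr [[vE e3 e4 ne' lew] [e5 e6 o1 o2]]]]]]]]]] := IHv [::] _ e ne2.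
case: (leqP (size t) (size w')) => [le|/ltnW le].
  exists (c :: v1), c', v2, pre', w', post', (t ++ wl), wr; split; split=> //.
  - by rewrite vE.
  - by rewrite wE e4 -!catA.
  - by rewrite wE size_cat /= mulSn leq_add.
  - by rewrite extend_cons e1 -!catA e6.
  - right; case: o2 => // wl0; move: e6; rewrite wl0.
    by move/(congr1 size); rewrite size_cat /=; case: (pre') => //= b p; lia.
exists [::], c, v, pre, t, [::], [::], w2; split; split=> //; rewrite ?cats0 //; try by [left | right].
rewrite wE size_cat /= mulSn leq_add2l; apply: leq_trans lew _.
by rewrite leq_mul2l le orbT.
Qed.

Section Chains.
Variables (A : Type) (B : Type) (s : A -> seq A) (f : A -> seq B).
Let node := (nat * A * seq B)%type.

(* A node [(d, g, R)] is a subtree of height [d] rooted at [g] of the          *)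
(* derivation tree; [R] is the text to the right of a chosen leaf inside it.   *)
Definition below (strict : bool) (t n : node) :=
  let: (d', g', R') := t in let: (d, g, R) := n in
  d + strict <= d' /\ exists u v, [/\ mpow s (d' - d) g' = u ++ g :: v,
    R' = R ++ extend (wpow s f d) v & strict -> extend (wpow s f d) v <> [::]].

Lemma below_refl n : below false n n.
Proof. by case: n => [[d g] R]; split; [lia | exists [::], [::]; rewrite subnn cats0]. Qed.

Lemma below_trans b1 b2 t m n : below b1 t m -> below b2 m n -> below (b1 || b2) t n.
Proof.
case: t m n => [[d3 g3] R3] [[d2 g2] R2] [[d1 g1] R1] /= [le1 [u [v [e1 r1 n1]]]] [le2 [u' [v' [e2 r2 n2]]]].
split; first by move: le1 le2; case: (b1); case: (b2) => /=; lia.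
exists (extend (mpow s (d2 - d1)) u ++ u'), (v' ++ extend (mpow s (d2 - d1)) v).
have dE : d3 - d1 = (d2 - d1) + (d3 - d2) by move: le1 le2; case: (b1); case: (b2) => /=; lia.
have d2E : d2 = d1 + (d2 - d1) by move: le1 le2; case: (b1); case: (b2) => /=; lia.
have wE : extend (wpow s f d2) v = extend (wpow s f d1) (extend (mpow s (d2 - d1)) v).
  by rewrite -extend_wpowD -d2E.
split.
- by rewrite dE mpowD e1 extend_cat extend_cons e2 -!catA.
- by rewrite r1 r2 extend_cat catA wE.
- rewrite extend_cat -wE; case: b1 n1 {le1} => [/(_ isT) n1 _|_ /n2 {}n2].
    by case: (extend _ v) n1 => // b t _; case: (extend _ v').
  by case: (extend _ v') n2.
Qed.

Lemma below_weak b t n : below b t n -> below false t n.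
Proof.
by case: t n => [[d g] r] [[d' g'] r'] [le1 [u [v [? ? _]]]]; split; [case: b le1; lia | exists u, v].
Qed.

(** A descending path in the derivation tree, restricted to nodes between which the text on the
    right loses a nonempty piece. *)
Fixpoint chain (n : node) (D : seq node) :=
  if D is n' :: D' then below true n n' /\ chain n' D' else True.

Lemma chain_rel n0 n D i j : chain n D -> i < j < (size D).+1 ->
  below true (nth n0 (n :: D) i) (nth n0 (n :: D) j).
Proof.
elim: D n i j => [|n' D IHD] n i j /=; first by lia.
move=> [r ch] /andP[lt1 lt2]; case: j lt1 lt2 => // j lt1 lt2.
case: i lt1 => [|i] lt1; last by apply: IHD => //; apply/andP.
case: j {lt1} lt2 => [|j] lt2 //; apply: below_trans r (IHD n' 0 j.+1 ch _).
by rewrite /=.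
Qed.

(** [h] counts the levels at which [w] sticks out of the chosen child to the right. Each of them
    yields a node of the chain, except the topmost one when [post] is nonempty: its right text runs
    past the end of [w], and above it [w] never sticks out on the right again. Hence the correction
    [~~ nilp post]. *)
Definition covered (m : nat) (c : A) (post w : seq B) (h : nat) :=
  exists R n D, [/\ below false (m, c, R) n, chain n D,
    exists x1 x2, w = x1 ++ n.2 ++ x2,
    post = [::] -> exists x1, w = x1 ++ R & h <= size D + ~~ nilp post].

Lemma covered0 c pre w post : wpow s f 0 c = pre ++ w ++ post -> covered 0 c post w 0.
Proof.
move=> _; exists [::], (0, c, [::]), [::]; split=> //.
- exact: below_refl.
- by exists w, [::]; rewrite /= cats0.
- by exists w; rewrite cats0.
Qed.

Lemma coveredS m c c' v1 v2 post post' w w' wl wr h :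
  s c = v1 ++ c' :: v2 -> w = wl ++ w' ++ wr ->
  post' ++ extend (wpow s f m) v2 = wr ++ post -> wr = [::] \/ post' = [::] ->
  covered m c' post' w' h -> covered m.+1 c post w (h + ~~ nilp wr).
Proof.
move=> sc wE pE o [R [n [D [bn ch [x1 [x2 cov]] fin le]]]].
pose R' := R ++ extend (wpow s f m) v2.
have bT (b : bool) : (b -> extend (wpow s f m) v2 <> [::]) -> below b (m.+1, c, R') (m, c', R).
  by move=> ne; split; [case: b ne; lia | exists v1, v2; rewrite subSnn mpow1].
case: wr pE o wE => [|b wr] /= pE o wE.
  exists R', n, D; split=> //.
  - by apply: (below_trans (bT false _) bn).
  - by exists (wl ++ x1), x2; rewrite wE cats0 cov !catA.
  - move=> p0; move: pE; rewrite p0; case: (post') fin => //= fin e.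
    by have [x1' e'] := fin erefl; exists (wl ++ x1'); rewrite wE e' /R' e !cats0 catA.
  - rewrite addn0; apply: leq_trans le _; rewrite leq_add2l -pE.
    by case: (post').
case: o => // p0; move: pE; rewrite p0 /= => pE.
have bT' : below true (m.+1, c, R') n by apply: (below_trans (bT true _) bn); rewrite pE.
move: le; rewrite p0 /= addn0 => le.
case: post pE => [|b' post] pE.
  exists R', (m.+1, c, R'), (n :: D); split.
  - exact: below_refl.
  - by [].
  - have [x1' e] := fin p0; exists (wl ++ x1'), [::].
    by rewrite wE e /R' pE !cats0 !catA.
  - move=> _; have [x1' e] := fin p0; exists (wl ++ x1').
    by rewrite wE e /R' pE !cats0 !catA.
  - by rewrite /=; lia.
exists R', n, D; split=> //; last by rewrite /=; lia.
- exact: below_weak bT'.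
- by exists (wl ++ x1), (x2 ++ b :: wr); rewrite wE cov -!catA.
Qed.

Lemma chain_repeat (T : finType) (lab : node -> T) n D : chain n D -> #|T| < size (n :: D) ->
  exists t n', [/\ below false n t, below true t n' & lab t = lab n'].
Proof.
move=> ch szT.
have /uniqPn : ~~ uniq (map lab (n :: D)).
  by apply: contraL szT => /card_uniqP e; rewrite -leqNgt -(size_map lab) -e max_card.
move=> /(_ (lab n)) [i [j [ltij ltj]]]; rewrite size_map in ltj.
rewrite !(nth_map n) //; last exact: ltn_trans ltij ltj.
move=> e; exists (nth n (n :: D) i), (nth n (n :: D) j); split=> //.
  case: i ltij {e} => [|i] ltij; first exact: below_refl.
  by apply: (@below_weak true); apply: (chain_rel n ch (i := 0)); move: ltj => /=; lia.
by apply: chain_rel => //; rewrite ltij.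
Qed.
End Chains.

Section Pumping.
Variables (A : finType) (B : Type) (s : A -> seq A) (f : A -> seq B).
Variables (Q : finType) (delta : Q -> B -> Q) (alive : pred Q).
Hypothesis absorb : forall q b, alive (delta q b) -> alive q.

(** The state maps alone would not tell an empty image from a nonempty one acting trivially; the
    pumped words have to stay nonempty. *)
Definition profile n : {ffun A -> {ffun Q -> Q} * bool} :=
  [ffun c => ([ffun q => foldl delta q (wpow s f n c)], nilp (wpow s f n c))].

Lemma alive_prefix q u v : alive (foldl delta q (u ++ v)) -> alive (foldl delta q u).
Proof.
by rewrite foldl_cat; elim/last_ind: v => //= v b IHv; rewrite foldl_rcons => /absorb.
Qed.

Definition pump_at c := exists k g N n u v q,
  [/\ g \in mpow s k c, 0 < N, mpow s N g = u ++ g :: v & profile n = profile (n + N)] /\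
  alive q /\ exists2 r, r = u \/ r = v &
    extend (wpow s f n) r <> [::] /\ foldl delta q (extend (wpow s f n) r) = q.

(** Descending to the child with the largest overlap divides the size by at most the length of an
    image, and only at levels where [w] sticks out of that child, to the right (counted by [hr]) or
    to the left (counted by [hl], on the reversed morphisms). *)
Lemma pumping_bound m c pre w post : wpow s f m c = pre ++ w ++ post -> w <> [::] ->
  exists hr hl, [/\ size w <= (\max_c size (f c)) * (\max_c size (s c)).+1 ^ (hr + hl),
    covered s f m c post w hr & covered (rev \o s) (rev \o f) m c (rev pre) (rev w) hl].
Proof.
set k0 := \max_c size (f c); set k := (\max_c size (s c)).+1.
elim: m c pre w post => [|m IHm] c pre w post e ne.
  exists 0, 0; split; last 2 [exact: covered0 e]; last first.
    by apply: covered0; rewrite wpow_rev e !rev_cat -catA.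
  rewrite muln1; apply: leq_trans (leq_bigmax c); rewrite -(wpow0 s f) e !size_cat; lia.
move: e; rewrite wpowSr => e.
have [v1 [c' [v2 [pre' [w' [post' [wl [wr [[sc e3 e4 ne' lew] [e5 e6 o1 o2]]]]]]]]]] := largest_overlap e ne.
have [hr [hl [le cr cl]]] := IHm _ _ _ _ e3 ne'.
exists (hr + ~~ nilp wr), (hl + ~~ nilp wl); split.
- have [/nilP wr0|nr] := boolP (nilp wr); last first.
    rewrite addn1 addSn expnS; apply: leq_trans lew _; rewrite mulnCA leq_mul //.
      exact/leqW/leq_bigmax.
    by apply: leq_trans le _; rewrite leq_mul //; apply: leq_pexp2l => //; lia.
  have [/nilP wl0|nl] := boolP (nilp wl).
    by rewrite e4 wr0 wl0 /= cats0 !addn0.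
  rewrite addn0 addn1 addnS expnS; apply: leq_trans lew _; rewrite mulnCA leq_mul //.
  exact/leqW/leq_bigmax.
- exact: coveredS sc e4 e5 o1 cr.
- have scr : (rev \o s) c = rev v2 ++ c' :: rev v1.
    by rewrite /= sc rev_cat rev_cons cat_rcons.
  rewrite -[nilp wl]/(size wl == 0) -size_rev; apply: coveredS scr _ _ _ cl.
  + by rewrite e4 !rev_cat -catA.
  + by rewrite extend_wpow_rev -!rev_cat e6.
  + by case: o2 => ->; [left | right].
Qed.

Lemma pumping : exists L, forall m c pre w post q0,
  wpow s f m c = pre ++ w ++ post -> alive (foldl delta q0 w) -> L <= size w -> pump_at c.
Proof.
(* Two nodes with the same label have the same letter, which gives [u ++ g :: v], the same profile,
   which compares their heights, and the same state, so that the text between them is a loop of the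
   automaton. *)
pose T : finType := (A * {ffun A -> {ffun Q -> Q} * bool} * Q)%type.
exists ((\max_c size (f c)) * (\max_c size (s c)).+1 ^ (#|T| + #|T|)).+1 => m c pre w post q0 e al gt.
have ne : w <> [::] by move=> w0; rewrite w0 in gt.
have [hr [hl [le cr cl]]] := pumping_bound e ne.
have : (#|T| < hr) || (#|T| < hl).
  apply: contraLR gt; rewrite negb_or -!leqNgt => /andP[le1 le2].
  by apply: leq_trans le _; rewrite leq_mul //; apply: leq_pexp2l => //; apply: leq_add.
have in_mpow (s' : A -> seq A) (f' : A -> seq B) t R (b : bool) :
    below s' f' b (m, c, R) t -> t.1.2 \in mpow s' (m - t.1.1) c.
  by case: t => [[d g] R'] [_ [u [v [-> _ _]]]]; rewrite mem_cat inE eqxx orbT.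
case/orP=> lt.
  have [R [n [D [bn ch [x1 [x2 wE]] _ szD]]]] := cr.
  have szT : #|T| < size (n :: D) by move: szD lt => /=; case: nilp => /=; lia.
  have [[[d' g'] R'] [[[d g] R2] [nt tn]]] := chain_repeat
    (fun n => (n.1.2, profile n.1.1, foldl delta (foldl delta q0 x1) n.2) : T) ch szT.
  move=> [gE pE stE]; move: (tn) => [lt_d [u [v [muv rE /(_ isT) nev]]]].
  have [z nE] : exists z, n.2 = R2 ++ z.
    case: (n) nt => [[dn gn] Rn] [_ [u' [v' [_ /= -> _]]]].
    by rewrite rE -catA; eexists.
  exists (m - d'), g', (d' - d), d, u, v, (foldl delta (foldl delta q0 x1) R2); split; [split|split].
  - exact: (in_mpow _ _ _ _ _ (below_trans bn nt)).
  - by move: lt_d => /=; lia.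
  - by rewrite muv gE.
  - by rewrite subnKC //; move: lt_d => /=; lia.
  - by rewrite -foldl_cat; apply: (@alive_prefix _ _ (z ++ x2)); rewrite -catA (catA R2) -nE -wE.
  - by exists v; [right | split=> //; rewrite -foldl_cat -rE stE].
have [R [n [D [bn ch [x1 [x2 wE]] _ szD]]]] := cl.
have szT : #|T| < size (n :: D) by move: szD lt => /=; case: nilp => /=; lia.
(* Mirrored back, the text of a node is a suffix of [rev n.2], so the state is taken just before
   that suffix. *)
pose st (r : seq B) := foldl delta q0 (rev x2 ++ take (size n.2 - size r) (rev n.2)).
have [[[d' g'] R'] [[[d g] R2] [nt tn]]] := chain_repeat
  (fun n => (n.1.2, profile n.1.1, st n.2) : T) ch szT.
move=> [gE pE stE]; move: (tn) => [lt_d [u [v [muv rE /(_ isT) nev]]]].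
have [z nE] : exists z, n.2 = R' ++ z.
  by case: (n) nt => [[dn gn] Rn] [_ [u' [v' [_ /= -> _]]]]; eexists.
have wE' : w = rev x2 ++ rev n.2 ++ rev x1 by rewrite -[w]revK wE !rev_cat -catA.
have vE : extend (wpow (rev \o s) (rev \o f) d) v = rev (extend (wpow s f d) (rev v)).
  by rewrite -extend_wpow_rev revK.
have stS : st R2 = foldl delta (st R') (extend (wpow s f d) (rev v)).
  rewrite /st -foldl_cat -catA; congr (foldl _ _ (_ ++ _)).
  rewrite nE rE vE !rev_cat revK !size_cat size_rev.
  rewrite [in RHS]take_size_cat ?size_rev; last by lia.
  by rewrite catA take_size_cat // size_cat size_rev; lia.
exists (m - d'), g', (d' - d), d, (rev v), (rev u), (st R2); split; [split|split].
- by have := in_mpow _ _ _ _ _ (below_trans bn nt); rewrite mpow_rev mem_rev.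
- by move: lt_d => /=; lia.
- by move: muv; rewrite mpow_rev => /(congr1 rev); rewrite revK rev_cat rev_cons cat_rcons gE.
- by rewrite subnKC //; move: lt_d => /=; lia.
- apply: (@alive_prefix _ _ (drop (size n.2 - size R2) (rev n.2) ++ rev x1)).
  by rewrite -catA (catA (take _ _)) cat_take_drop -wE'.
- exists (rev v); first by left.
  by split; [move=> v0; apply: nev; rewrite vE v0 | rewrite -{1}stE -stS].
Qed.
End Pumping.

(** * Infinite images and sequences that are not uniformly recurrent *)

Section Emptiness.
Variables (A : finType) (B : Type) (s : A -> seq A) (f : A -> seq B).
Let W := wpow s f.

Definition empties n : {ffun A -> bool} := [ffun c => nilp (W n c)].

Lemma extend_nilp (C D : eqType) (E : Type) (g : C -> seq E) (w : seq C) :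
  nilp (extend g w) = all (fun c => nilp (g c)) w.
Proof.
elim: w => // c w IHw; rewrite extend_cons /= -IHw /nilp size_cat addn_eq0 //.
Qed.

(** [W n.+1 c] is a product of words [W n d], so emptiness at one level determines it at the
    next. *)
Lemma empties_step n m : empties n = empties m -> empties n.+1 = empties m.+1.
Proof.
move=> e; apply/ffunP => c; rewrite !ffunE /W !wpowSr !(extend_nilp A); apply: eq_all => d.
by have := congr1 (fun h : {ffun A -> bool} => h d) e; rewrite !ffunE.
Qed.

Lemma empties_period i N k j : empties i = empties (i + N) -> empties (i + k) = empties (i + N * j + k).
Proof.
move=> e; have step n m l : empties n = empties m -> empties (n + l) = empties (m + l).
  by move=> h; elim: l => [|l IH]; rewrite ?addn0 // !addnS; apply: empties_step.
apply: (step _ _ k); elim: j => [|j IH]; first by rewrite muln0 addn0.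
have -> : i + N * j.+1 = i + N + N * j by lia.
by rewrite -(step _ _ (N * j) e).
Qed.

Lemma empties_word n m w : empties n = empties m -> nilp (extend (W n) w) = nilp (extend (W m) w).
Proof.
move=> e; rewrite !(extend_nilp A); apply: eq_all => d.
by have := congr1 (fun h : {ffun A -> bool} => h d) e; rewrite !ffunE.
Qed.

Lemma empties_repeat : exists i1 i2, i1 < i2 /\ empties i1 = empties i2.
Proof.
have [t Ht] := @pigeonhole_inf _ (fun=> True) empties (fun n => ex_intro2 _ _ n (leqnn n) I).
have [i1 _ [_ e1]] := Ht 0; have [i2 lt [_ e2]] := Ht i1.+1.
by exists i1, i2; rewrite e1 e2.
Qed.

Variables (a : A) (u : seq A).
Hypothesis sa : s a = a :: u.

(** Unrolls [sigma^n(a) = a u sigma(u) ... sigma^(n-1)(u)]. *)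
Lemma size_wpow_fix n : size (W n a) = size (f a) + \sum_(i < n) size (extend (W i) u).
Proof.
elim: n => [|n IHn]; first by rewrite big_ord0 addn0 /W wpow0.
by rewrite /W wpowSr sa extend_cons size_cat big_ord_recr /= addnA -IHn.
Qed.

(** By periodicity [u] has a nonempty image once in every period of levels, and [W n a] gains at
    least one letter each time. *)
Lemma image_infinite i1 i2 i : i1 < i2 -> empties i1 = empties i2 -> i1 <= i < i2 ->
  extend (W i) u <> [::] -> forall L, exists n, L <= size (W n a).
Proof.
move=> lt e /andP[le1 le2] ne L; pose N := i2 - i1.
have ne' j : 0 < size (extend (W (i + N * j)) u).
  have e' : empties i1 = empties (i1 + N) by rewrite subnKC // ltnW.
  have := empties_word u (empties_period (i - i1) j e').
  have -> : i1 + N * j + (i - i1) = i + N * j by lia.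
  rewrite subnKC // /nilp lt0n => <-; apply/negP => /eqP/size0nil; exact: ne.
exists (i + N * L); rewrite size_wpow_fix; apply: leq_trans (leq_addl _ _).
elim: L => // L IHL; have -> : i + N * L.+1 = (i + N * L) + N by lia.
rewrite -(big_mkord xpredT (fun k => size (extend (W k) u))) (@big_cat_nat _ _ _ (i + N * L)) ?leq_addr //=.
rewrite big_mkord -addn1 leq_add // big_ltn; last by rewrite /N; lia.
by rewrite addn_gt0 ne'.
Qed.

Lemma image_finite i1 i2 : i1 < i2 -> empties i1 = empties i2 ->
  (forall i, i1 <= i < i2 -> extend (W i) u = [::]) -> exists L, forall n, size (W n a) <= L.
Proof.
move=> lt e em; pose N := i2 - i1.
have em' i : i1 <= i -> extend (W i) u = [::].
  move=> le; have e' : empties i1 = empties (i1 + N) by rewrite subnKC // ltnW.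
  have := empties_word u (empties_period ((i - i1) %% N) ((i - i1) %/ N) e').
  have -> : i1 + N * ((i - i1) %/ N) + (i - i1) %% N = i.
    by rewrite -addnA mulnC -divn_eq subnKC.
  by rewrite em /= => [/esym/nilP //|]; have := @ltn_pmod (i - i1) N; rewrite /N; lia.
exists (size (W i1 a)) => n; case: (leqP n i1) => [le|/ltnW le].
  rewrite !size_wpow_fix leq_add2l -!(big_mkord xpredT (fun k => size (extend (W k) u))).
  by rewrite [X in _ <= X](@big_cat_nat _ _ _ n) //= leq_addr.
rewrite !size_wpow_fix leq_add2l -!(big_mkord xpredT (fun k => size (extend (W k) u))).
rewrite [X in X <= _](@big_cat_nat _ _ _ i1) //= -[X in _ <= X]addn0 leq_add2l.
by rewrite big_nat_cond big1 // => i /andP[/andP[le1 _] _]; rewrite em'.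
Qed.
End Emptiness.

Section NotUR.
Variables (A B : finType) (s : A -> seq A) (f : A -> seq B).
Variables (a : A) (x : nat -> A) (y : nat -> B).
Hypotheses (fx : forall n, occurs x (mpow s n a) 0) (imx : img s x x) (imy : img f x y).

Lemma wpow_factor k n g u v : mpow s k a = u ++ g ++ v -> factor y (extend (wpow s f n) g).
Proof.
move=> e; apply: img_factor (img_wpow n imx imy) _.
by apply: (@factor_infix _ _ u _ v); exists 0; rewrite -e; apply: fx.
Qed.

Variables (Q : finType) (delta : Q -> B -> Q) (alive : pred Q).
Hypothesis absorb : forall q b, alive (delta q b) -> alive q.

Lemma profile_step n m : profile s f delta n = profile s f delta m ->
  profile s f delta n.+1 = profile s f delta m.+1.
Proof.
move=> e; have ed d : (foldl delta)^~ (wpow s f n d) =1 (foldl delta)^~ (wpow s f m d) /\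
    nilp (wpow s f n d) = nilp (wpow s f m d).
  have := congr1 (fun h : {ffun A -> {ffun Q -> Q} * bool} => h d) e; rewrite !ffunE => -[/ffunP e1 e2].
  by split=> // q; have := e1 q; rewrite !ffunE.
apply/ffunP => c; rewrite !ffunE !wpowSr; congr pair.
  apply/ffunP => q; rewrite !ffunE; elim: (s c) q => // d w IHw q.
  by rewrite !extend_cons !foldl_cat (ed d).1 IHw.
by rewrite !(extend_nilp A); apply: eq_all => d; apply: (ed d).2.
Qed.

Lemma profile_word n m w q : profile s f delta n = profile s f delta m ->
  foldl delta q (extend (wpow s f n) w) = foldl delta q (extend (wpow s f m) w) /\
  nilp (extend (wpow s f n) w) = nilp (extend (wpow s f m) w).
Proof.
move=> e; have ed d := congr1 (fun h : {ffun A -> {ffun Q -> Q} * bool} => h d) e.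
split; last by rewrite !(extend_nilp A); apply: eq_all => d; have := ed d; rewrite !ffunE => -[].
elim: w q => // d w IHw q; rewrite !extend_cons !foldl_cat IHw.
have := ed d; rewrite !ffunE => -[/ffunP/(_ q)]; rewrite !ffunE => -> //.
Qed.

(** Iterating [sigma^N(g) = u g v] puts the product of the words [sigma^(N i)(r)], for [i < j], into
    [sigma^(N j)(g)]. Under [W_n] its factors become the words [W_(n + N i)(r)], all nonempty and
    all looping on [q], so the image has length at least [j] and cannot contain the killing word
    [w]. *)
Lemma pump_not_ur w g k N n u v q r :
  factor y w -> (forall q, ~~ alive (foldl delta q w)) ->
  g \in mpow s k a -> mpow s N g = u ++ g :: v -> profile s f delta n = profile s f delta (n + N) ->
  alive q -> r = u \/ r = v -> extend (wpow s f n) r <> [::] ->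
  foldl delta q (extend (wpow s f n) r) = q -> ~ uniformly_recurrent y.
Proof.
move=> fw dead gk muv prof al ruv ne fix_q ur.
have [L win] := ur_window ur fw.
have profj j : profile s f delta n = profile s f delta (n + N * j).
  elim: j => [|j IHj]; first by rewrite muln0 addn0.
  have step m m' l : profile s f delta m = profile s f delta m' -> profile s f delta (m + l) = profile s f delta (m' + l).
    by move=> h; elim: l => [|l IH]; rewrite ?addn0 // !addnS; apply: profile_step.
  by rewrite prof mulnS addnA; apply: (@trans_eq _ _ (profile s f delta (n + N * j + N)));
    [apply: step | congr profile; lia].
have fixj j : foldl delta q (extend (wpow s f (n + N * j)) r) = q.
  by rewrite -(profile_word r q (profj j)).1.
have nej j : 0 < size (extend (wpow s f (n + N * j)) r).
  have := (profile_word r q (profj j)).2; rewrite /nilp lt0n => <-.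
  by apply/negP => /eqP/size0nil; apply: ne.
have key j : exists T t1 t2, [/\ mpow s (N * j) g = t1 ++ T ++ t2,
    foldl delta q (extend (wpow s f n) T) = q & j <= size (extend (wpow s f n) T)].
  have eS t t2 : mpow s (N * j) g = t ++ g :: t2 -> mpow s (N * j.+1) g =
      (extend (mpow s (N * j)) u ++ t) ++ g :: (t2 ++ extend (mpow s (N * j)) v).
    by move=> e; rewrite mulnSr mpowD muv extend_cat extend_cons e -!catA.
  case: ruv => rE.
    suff [t [t2 [e fT szT]]] : exists t t2, [/\ mpow s (N * j) g = t ++ g :: t2,
        foldl delta q (extend (wpow s f n) t) = q & j <= size (extend (wpow s f n) t)].
      by exists t, [::], (g :: t2).
    elim: j {eS} => [|j [t [t2 [e fT szT]]]].
      by exists [::], [::]; rewrite muln0.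
    exists (extend (mpow s (N * j)) u ++ t), (t2 ++ extend (mpow s (N * j)) v).
    rewrite extend_cat -extend_wpowD -rE foldl_cat fixj size_cat; split=> //.
      by rewrite mulnSr mpowD muv extend_cat extend_cons e -!catA -rE.
    by have := nej j; lia.
  suff [t [t2 [e fT szT]]] : exists t t2, [/\ mpow s (N * j) g = t ++ g :: t2,
      foldl delta q (extend (wpow s f n) t2) = q & j <= size (extend (wpow s f n) t2)].
    by exists t2, (rcons t g), [::]; rewrite cats0 cat_rcons.
  elim: j {eS} => [|j [t [t2 [e fT szT]]]].
    by exists [::], [::]; rewrite muln0.
  exists (extend (mpow s (N * j)) u ++ t), (t2 ++ extend (mpow s (N * j)) v).
  rewrite extend_cat -extend_wpowD -rE foldl_cat fT fixj size_cat; split=> //.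
    by rewrite mulnSr mpowD muv extend_cat extend_cons e -!catA -rE.
  by have := nej j; lia.
have [T [t1 [t2 [e fT szT]]]] := key (L + size w).
have [g1 [g2 gE]] : exists g1 g2, mpow s k a = g1 ++ g :: g2.
  by move: gk => /splitPr[g1 g2]; exists g1, g2.
have fac : factor y (extend (wpow s f n) T).
  apply: (@wpow_factor (N * (L + size w) + k) n T (extend (mpow s (N * (L + size w))) g1 ++ t1)
    (t2 ++ extend (mpow s (N * (L + size w))) g2)).
  by rewrite mpowD gE extend_cat extend_cons e -!catA.
have [v1 [v2 E]] := window_infix win fac szT.
move: al; rewrite -fT E catA => /(alive_prefix absorb); rewrite foldl_cat.
by apply/negP.
Qed.

End NotUR.

(* A live state consists of the last [size w] letters read; [None] is reached  *)
(* once [w] has been read.                                                     *)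
Section AvoidingAutomaton.
Variables (B : finType) (w : seq B).

Definition avoid_step (q : option ((size w).-bseq B)) (b : B) : option ((size w).-bseq B) :=
  if q is Some t then
    if suffix w (rcons t b) then None
    else Some (insub_bseq (size w) (if size t < size w then rcons t b else behead (rcons t b)))
  else None.

Lemma avoid_absorb q b : isSome (avoid_step q b) -> isSome q.
Proof. by case: q. Qed.

Definition lastn n (v : seq B) := drop (size v - n) v.

Lemma avoid_run v t : foldl avoid_step (Some t) v = None \/
  exists2 t', foldl avoid_step (Some t) v = Some t' & (t' : seq B) = lastn (size w) (t ++ v).
Proof.
elim/last_ind: v => [|v b [IH|[t' IH tE]]]; rewrite ?foldl_rcons.
- right; exists t => //; rewrite cats0 /lastn.
  by have := size_bseq t; rewrite /leq => /eqP ->; rewrite drop0.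
- by left; rewrite IH.
rewrite IH /=; case: ifP => _; first by left.
right; eexists; first by [].
have sz : size (if size t' < size w then rcons t' b else behead (rcons t' b)) <= size w.
  by case: ifP => lt; rewrite ?size_behead size_rcons //= size_bseq.
rewrite /insub_bseq insubdK // tE /lastn -rcons_cat size_rcons.
have := size_bseq t'; rewrite tE /lastn size_drop => le.
case: ifP => lt.
  rewrite drop_rcons; last by lia.
  by congr (rcons (drop _ _) _); lia.
rewrite -drop1 -drop_rcons; last by lia.
by rewrite drop_drop; congr drop; lia.
Qed.

Lemma avoid_dead q : w <> [::] -> foldl avoid_step q w = None.
Proof.
have foldN v : foldl avoid_step None v = None by elim: v.
move=> ne; case: q => [t|]; last exact: foldN.
have : exists v b, w = rcons v b by case/lastP: (w) ne => // v b _; exists v, b.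
move=> [v [b wE]]; rewrite [X in foldl _ _ X]wE foldl_rcons; case: (avoid_run v t) => [-> //|[t' -> tE]] /=.
case: ifP => // /negP[]; rewrite tE /lastn; move: (bseqval t) => t0; rewrite wE.
apply/suffixP; exists (drop (size (t0 ++ v) - size (rcons v b)) t0).
rewrite -rcons_cat; congr rcons; rewrite drop_cat size_cat size_rcons.
case: ltnP => // ge; have -> : size t0 + size v - (size v).+1 - size t0 = 0 by lia.
by rewrite drop0 drop_oversize.
Qed.

Lemma avoid_alive v : w <> [::] -> (forall v1 v2, v <> v1 ++ w ++ v2) ->
  isSome (foldl avoid_step (Some [bseq]) v).
Proof.
move=> ne; elim/last_ind: v => // v b IHv no; rewrite foldl_rcons.
case: (avoid_run v [bseq]) IHv => [->|[t -> tE]] IHv.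
  by apply: IHv => v1 v2 e; apply: (no v1 (rcons v2 b)); rewrite e -!rcons_cat.
rewrite /=; case: ifP => // /suffixP[z]; rewrite tE /= /lastn => e.
case: (no (take (size v - size w) v ++ z) [::]); rewrite cats0 -catA -e -rcons_cat cat_take_drop //.
Qed.
End AvoidingAutomaton.

(** If the window for [w] fails, some segment of [y] as long as the pumping constant avoids [w]; it
    lies in some [W_m(a)] and keeps the avoiding automaton alive. *)
Lemma not_ur_pump (A B : finType) (s : A -> seq A) (f : A -> seq B) a x y :
  (forall n, occurs x (mpow s n a) 0) -> (forall L, exists n, L <= size (mpow s n a)) ->
  img s x x -> img f x y -> ~ uniformly_recurrent y ->
  exists w, [/\ w <> [::], factor y w & pump_at s f (@avoid_step B w) isSome a].
Proof.
move=> fx inf imx imy nur; apply: contrapT => no; apply: nur; apply: window_ur => w fw.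
have [->|ne] := pselect (w = [::]); first by exists 0 => i; exists i; rewrite ?addn0 ?leqnn.
have [L pump] := pumping s f (@avoid_absorb B w).
exists (L + size w) => i; apply: contrapT => noj; apply: no; exists w; split=> //.
have [j lej] := img_inf (i + L + size w) imy; have [m lem] := inf j.
have [pre' [post e]] : exists pre post, wpow s f m a = pre ++ seg y i (L + size w) ++ post.
  rewrite /wpow (occursE (img_occurs imy (fx m))) cut0.
  rewrite (@seg_sub _ y 0 _ i (L + size w)) //; first by do 2!eexists.
  apply: leq_trans (_ : cut f x j <= _); first by lia.
  rewrite (occursE (fx m)) -mkseq_seg -[X in _ <= X]/(cut f x _).
  exact: cut_le.
apply: (pump m a _ _ _ (Some [bseq]) e); last by rewrite size_seg leq_addr.
apply: avoid_alive => // v1 v2 e2; apply: noj; exists (i + size v1).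
  have := congr1 size e2; rewrite size_seg !size_cat; lia.
have := occurs_seg y i (L + size w); rewrite e2 => /occurs_cat[_ /occurs_cat[]] //.
Qed.

(** * Transducer certificates *)

Section Transducers.
Variables (A : eqType) (B : Type).

(* [ct_E] is a partial transducer reading the fixed point [x] of [sigma]; in   *)
(* state [q] the word [ct_t q] over [B] is still to be parsed.  Its output [z] *)
(* satisfies [y = ct_T z], and [ct_v], [ct_g] express how the run on           *)
(* [sigma^ct_N w] follows from the run on [w], whence [z = ct_l z].            *)
Record certificate := Certificate {
  ct_n : nat; ct_N : nat; ct_K : nat;
  ct_E : nat -> A -> option (nat * seq nat);
  ct_t : nat -> seq B; ct_T : nat -> seq B;
  ct_l : nat -> seq nat; ct_v : nat -> seq nat; ct_g : nat -> nat; ct_rs : seq nat }.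

Fixpoint run (E : nat -> A -> option (nat * seq nat)) q w : option (nat * seq nat) :=
  if w is c :: w' then
    if E q c is Some (q', p) then
      if run E q' w' is Some (q'', o) then Some (q'', p ++ o) else None
    else None
  else Some (q, [::]).

Lemma run_cat E q u w : run E q (u ++ w) =
  if run E q u is Some (q', o) then
    if run E q' w is Some (q'', o') then Some (q'', o ++ o') else None
  else None.
Proof.
elim: u q => [|c u IHu] q /=; first by case: run => [[]|].
case: (E q c) => [[q' p]|] //; rewrite IHu; case: (run E q' u) => [[q1 o1]|] //.
by case: (run E q1 w) => [[q2 o2]|] //; rewrite catA.
Qed.

Variables (s : A -> seq A) (f : A -> seq B) (a : A).

(** [ct_v q] is a lag: the output over the image under [sigma^N] of the letters read so far exceeds
    the [ct_l]-image of the output on these letters by [ct_v q]. With one output letter [z] is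
    constant, hence fixed by the substitution doubling that letter, and the identity is replaced by
    [size (ct_rs C) = 1]. *)
Definition step_ok (C : certificate) q c q' p :=
  [/\ q' < ct_K C, ct_t C q ++ wpow s f (ct_n C) c = extend (ct_T C) p ++ ct_t C q',
      all (mem (ct_rs C)) p &
      exists2 o, run (ct_E C) (ct_g C q) (mpow s (ct_N C) c) = Some (ct_g C q', o) &
        size (ct_rs C) = 1 \/ ct_v C q ++ o = extend (ct_l C) p ++ ct_v C q'].

Definition certifies (C : certificate) :=
  [/\ ct_t C 0 = [::], ct_g C 0 = 0, ct_v C 0 = [::], ct_E C 0 a <> None & 0 < ct_N C] /\
  [/\ forall q, q < ct_K C -> ct_g C q < ct_K C, forall q c q' p, ct_E C q c = Some (q', p) -> step_ok C q c q' p,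
      forall r, r \in ct_rs C -> 1 < size (ct_l C r) &
      forall r r', r \in ct_rs C -> r' \in ct_rs C -> r' \in ct_l C r].

Lemma nested_limit T (o : nat -> seq T) : o 0 = [::] -> (forall M, exists d, o M.+1 = o M ++ d) ->
  (forall L, exists M, L <= size (o M)) -> exists z, forall M, occurs z (o M) 0.
Proof.
move=> o0 nest inf; pose d M := projT1 (cid (nest M)).
have dE M : o M.+1 = o M ++ d M by rewrite /d; case: cid.
have oE M : extend d (mkseq id M) = o M.
  by elim: M => [|M IH]; rewrite ?o0 // mkseqS -cats1 extend_cat extend1 IH dE.
have [z [imz _]] : exists z, img d id z.
  by apply: img_ex => L; have [M HM] := inf L; exists M; rewrite /cut oE.
by exists z => M; rewrite -oE.
Qed.

Variables (C : certificate) (x : nat -> A) (y : nat -> B).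
Hypotheses (pro : prolongable s a) (fx : is_fixpoint s a x) (imy : img f x y) (cert : certifies C).
Let n := ct_n C.
Let N := ct_N C.
Let E := ct_E C.
Let rs := ct_rs C.

Lemma run_power q w q' o : run E q w = Some (q', o) ->
  exists2 o', run E (ct_g C q) (extend (mpow s N) w) = Some (ct_g C q', o') &
    size rs = 1 \/ ct_v C q ++ o' = extend (ct_l C) o ++ ct_v C q'.
Proof.
have [_ [_ stepP _ _]] := cert.
elim: w q o => [|c w IHw] q o /=; first by case=> <- <-; exists [::] => //; right; rewrite cats0.
case Eqc: (E q c) => [[q1 p]|] //; case Er: (run E q1 w) => [[q2 o2]|] // [eq <-].
rewrite eq in Er; have [_ _ _ [o1 r1 v1]] := stepP _ _ _ _ Eqc.
have [o3 r3 v3] := IHw _ _ Er; exists (o1 ++ o3).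
  by rewrite extend_cons run_cat r1 r3.
case: v1 => [|v1]; first by left.
case: v3 => [|v3]; first by left.
by right; rewrite extend_cat catA v1 -!catA v3.
Qed.

Lemma run_text q w q' o : run E q w = Some (q', o) ->
  [/\ ct_t C q ++ extend (wpow s f n) w = extend (ct_T C) o ++ ct_t C q',
      all (mem rs) o & w = [::] \/ q' < ct_K C].
Proof.
have [_ [_ stepP _ _]] := cert.
elim: w q o => [|c w IHw] q o /=; first by case=> <- <-; split=> //; [rewrite cats0 | left].
case Eqc: (E q c) => [[q1 p]|] //; case Er: (run E q1 w) => [[q2 o2]|] // [eq <-].
rewrite eq in Er; have [lt1 t1 rs1 _] := stepP _ _ _ _ Eqc.
have [t2 rs2 lt2] := IHw _ _ Er.
split; first by rewrite extend_cons catA t1 -catA t2 extend_cat catA.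
  by rewrite all_cat rs1.
by right; case: lt2 => // w0; move: Er; rewrite w0 /= => -[<-].
Qed.

Lemma run_fix M : exists q o, run E 0 (mpow s (N * M) a) = Some (q, o) /\
  (size rs = 1 \/ exists2 o', run E 0 (mpow s (N * M.+1) a) = Some (ct_g C q, o') &
     o' = extend (ct_l C) o ++ ct_v C q).
Proof.
have [[_ g0 v0 E0 _] _] := cert.
suff [q [o e]] : exists q o, run E 0 (mpow s (N * M) a) = Some (q, o).
  exists q, o; split=> //; have [o' r' v'] := run_power e.
  case: v'; first by left.
  rewrite v0 g0 in r' *; right; exists o' => //.
  by rewrite mulnS mpowD.
elim: M => [|M [q [o e]]].
  rewrite muln0 /=; have E0' : E 0 a <> None by []; case: (E 0 a) E0' => [[q p]|] // _.
  by exists q, (p ++ [::]).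
have [o' r' _] := run_power e; exists (ct_g C q), o'.
by rewrite mulnS mpowD; rewrite g0 in r'.
Qed.

Theorem certificate_ur : uniformly_recurrent y.
Proof.
have [[t0 g0 v0 E0 N0] [_ stepP lam2 prim]] := cert.
have imx := fixpoint_img pro fx.
have imW := img_wpow n imx imy.
pose qo M := projT1 (cid (run_fix M)); pose o M := projT1 (cid (projT2 (cid (run_fix M)))).
have roP M : run E 0 (mpow s (N * M) a) = Some (qo M, o M) /\
    (size rs = 1 \/ exists2 o', run E 0 (mpow s (N * M.+1) a) = Some (ct_g C (qo M), o') &
      o' = extend (ct_l C) (o M) ++ ct_v C (qo M)).
  by rewrite /o /qo; case: cid => q /= [o1 H]; case: cid.
have text M : extend (wpow s f n) (mpow s (N * M) a) = extend (ct_T C) (o M) ++ ct_t C (qo M).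
  by have [e _ _] := run_text (roP M).1; rewrite t0 in e.
have ors M : all (mem rs) (o M) by have [_ ? _] := run_text (roP M).1.
have qlt M : qo M < ct_K C.
  have [_ _ []] // := run_text (roP M).1.
  by have := mpow_prefixD pro 0 (N * M); rewrite add0n => -[v' ->].
have nest M : exists d, o M.+1 = o M ++ d.
  have [d e] := mpow_prefixD pro (N * M) N; have := (roP M.+1).1.
  rewrite mulnSr e run_cat (roP M).1; case: run => [[q2 o2]|] // [_ <-].
  by exists o2.
pose tm := \max_(q < ct_K C) size (ct_t C q).
(* The text still to be parsed takes finitely many values, so its length [tm] is bounded and the
   parsed part is unbounded. *)
have inf L : exists M, L <= size (extend (ct_T C) (o M)).
  have [j Hj] := img_inf (L + tm) imW; have [k Hk] := mpow_unbounded pro j.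
  exists k; have Hk2 : j <= size (mpow s (N * k) a).
    have le : k <= N * k by rewrite leq_pmull.
    by have [d e] := mpow_prefixD pro k (N * k - k); rewrite subnKC // in e; rewrite e size_cat; lia.
  have := congr1 size (text k); rewrite size_cat.
  have tle : size (ct_t C (qo k)) <= tm by apply: (leq_bigmax (Ordinal (qlt k))).
  have : L + tm <= size (extend (wpow s f n) (mpow s (N * k) a)).
    rewrite (occursE (fixpoint_occurs pro (N * k) fx)) -mkseq_seg.
    exact: leq_trans Hj (cut_le _ _ Hk2).
  by lia.
pose Tm := \max_(r <- rs) size (ct_T C r).
have szT w : all (mem rs) w -> size (extend (ct_T C) w) <= Tm * size w.
  elim: w => // r w IHw /= /andP[rrs /IHw le]; rewrite extend_cons size_cat mulnS leq_add //.
  exact: (@leq_bigmax_seq _ rs xpredT (fun r => size (ct_T C r))).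
have inf' L : exists M, L <= size (o M).
  have [M HM] := inf (Tm * L); exists M; case: (leqP L (size (o M))) => // lt.
  have := leq_trans HM (szT _ (ors M)); case: (posnP Tm) => [T0 _|Tp]; last by rewrite leq_pmul2l // leqNgt lt.
  by have [M1 HM1] := inf 1; have := leq_trans HM1 (szT _ (ors M1)); rewrite T0 mul0n.
(* Shifted by one: [nested_limit] starts from the empty word, while [o 0] is the output on the first
   letter. *)
have [z Hz] : exists z, forall M, occurs z (if M is M'.+1 then o M' else [::]) 0.
  apply: nested_limit => // [[|M]|L]; [by exists (o 0) | exact: nest|].
  by have [M HM] := inf' L; exists M.+1.
have {}Hz M := Hz M.+1.
have pre k : exists M d, o M = mkseq z k ++ d.
  have [M HM] := inf' k; exists M, (seg z k (size (o M) - k)).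
  by rewrite {1}(occursE (Hz M)) -{1}(subnKC HM) segD.
have imT : img (ct_T C) z y.
  split=> [k|L].
    have [M [d e]] := pre k; have := img_occurs imW (fixpoint_occurs pro (N * M) fx).
    by rewrite text e extend_cat => /occurs_cat[/occurs_cat[]].
  by have [M HM] := inf L; exists (size (o M)); rewrite mkseq_seg -(occursE (Hz M)).
have zrs k : z k \in rs.
  have [M [d e]] := pre k.+1; have := ors M; rewrite e all_cat => /andP[/allP H _]; apply: H.
  by rewrite mkseqS mem_rcons inE eqxx.
have [rs1|rsn] := eqVneq (size rs) 1.
  have zc k : z k = z 0.
    have := zrs k; have := zrs 0; case: (rs) rs1 => // r [|//] _.
    by rewrite !inE => /eqP-> /eqP.
  have le2 r : r \in rs -> r = z 0.
    have := zrs 0; case: (rs) rs1 => // r' [|//] _.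
    by rewrite !inE => /eqP-> /eqP.
  apply: (@ur_of_primitive _ _ (ct_T C) (fun=> [:: z 0; z 0]) z y rs imT) => //; last first.
    by move=> r r' _ /le2 ->; rewrite inE eqxx.
  have extE k : extend (fun=> [:: z 0; z 0]) (mkseq z k) = mkseq z (k + k).
    elim: k => // k IHk; rewrite mkseqS -cats1 extend_cat extend1 IHk addSn addnS !mkseqS !zc.
    by rewrite -!cats1 -catA.
  split=> [k|L]; first by rewrite extE mkseq_seg; apply: occurs_seg.
  by exists L; rewrite extE size_mkseq leq_addr.
apply: (@ur_of_primitive _ _ (ct_T C) (ct_l C) z y rs imT) => //.
have key M : exists d, o M.+1 = extend (ct_l C) (o M) ++ d.
  have [_ [/eqP|[o' r' e]]] := roP M; first by rewrite (negbTE rsn).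
  by have := (roP M.+1).1; rewrite r' => -[_ <-]; exists (ct_v C (qo M)).
split=> [k|L].
  have [M [d e]] := pre k; have [d' e'] := key M; have := Hz M.+1.
  by rewrite e' e extend_cat => /occurs_cat[/occurs_cat[]].
exists L; have : size (mkseq z L) <= size (extend (ct_l C) (mkseq z L)).
  have : all (mem rs) (mkseq z L) by apply/allP => r /mapP[i _ ->]; apply: zrs.
  elim: (mkseq z L) => // r w IHw /= /andP[rrs /IHw le]; rewrite extend_cons size_cat.
  by have := lam2 _ rrs; lia.
by rewrite size_mkseq.
Qed.
End Transducers.

(** * Certificates from a run along the positions of the fixed point *)

Section CertificateOfRun.
Variables (A : eqType) (B : Type) (s : A -> seq A) (f : A -> seq B).
Variables (x : nat -> A) (y : nat -> B).
Hypothesis imx : img s x x.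
Variables (n N K : nat) (st : nat -> nat) (p : nat -> seq nat) (t : nat -> seq B).
Variables (Th : nat -> seq B) (lam : nat -> seq nat) (v : nat -> seq nat) (rs : seq nat).
Let J := cut (mpow s N) x.
Hypotheses (N0 : 0 < N) (st0 : st 0 = 0) (stK : forall j, st j < K) (t0 : t 0 = [::]) (v0 : v 0 = [::]).
Hypothesis det : forall i j, st i = st j ->
  [/\ t i = t j, st (J i) = st (J j), v i = v j & x i = x j -> st i.+1 = st j.+1 /\ p i = p j].
Hypothesis text : forall j, t j ++ wpow s f n (x j) = extend Th (p j) ++ t j.+1.
Hypothesis prs : forall j, all (mem rs) (p j).
Hypothesis conj : size rs = 1 \/
  forall j, v j ++ flatten [seq p k | k <- iota (J j) (J j.+1 - J j)] = extend lam (p j) ++ v j.+1.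
Hypothesis lam2 : forall r, r \in rs -> 1 < size (lam r).
Hypothesis prim : forall r r', r \in rs -> r' \in rs -> r' \in lam r.

(** By [det] the data at a position depend only on its state, so any position in state [q]
    represents it. The default [0] keeps [ct_g] below [K] on states that are never reached. *)
Definition pos q := if pselect (exists j, st j = q) is left h then projT1 (cid h) else 0.
Lemma posP j : st (pos (st j)) = st j.
Proof. by rewrite /pos; case: pselect => [h|[]]; [case: cid | exists j]. Qed.

Definition run_cert := @Certificate A B n N K
  (fun q c => if pselect (exists j, st j = q /\ x j = c) is left h then
     Some (st (projT1 (cid h)).+1, p (projT1 (cid h))) else None)
  (fun q => t (pos q)) Th lam (fun q => v (pos q)) (fun q => st (J (pos q))) rs.

Lemma run_cert_E q c q' p' : ct_E run_cert q c = Some (q', p') <->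
  exists j, [/\ st j = q, x j = c, q' = st j.+1 & p' = p j].
Proof.
rewrite /=; case: pselect => [h|no]; last by split=> // -[j [? ? _ _]]; case: no; exists j.
case: cid => i [/= si xi]; split=> [[<- <-]|[j [sj xj -> ->]]]; first by exists i.
have [_ _ _ H] := det (etrans si (esym sj)).
by case: H => [|-> ->] //; rewrite xi xj.
Qed.

Lemma run_cert_seg i l : run (ct_E run_cert) (st i) (seg x i l) =
  Some (st (i + l), flatten [seq p k | k <- iota i l]).
Proof.
have Ei k : ct_E run_cert (st k) (x k) = Some (st k.+1, p k) by apply/run_cert_E; exists k.
move: (ct_E run_cert) Ei => E Ei.
elim: l i => [|l IHl] i; first by rewrite addn0.
by rewrite -[l.+1]add1n segD addn1 /= addn0 Ei IHl addSnnS.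
Qed.

Lemma run_certP : certifies s f (x 0) run_cert.
Proof.
have p0 : st (pos 0) = st 0 by rewrite -{1}st0 posP.
have [tp gp vp _] := det p0.
split; split=> //.
- by rewrite /= tp.
- by rewrite /= gp.
- by rewrite /= vp.
- have /run_cert_E -> // : exists j, [/\ st j = 0, x j = x 0, st 1 = st j.+1 & p 0 = p j] by exists 0.
- by move=> q _; apply: stK.
- move=> q c q' p' /run_cert_E[j [<- <- -> ->]].
  have [tj gj vj _] := det (posP j); have [tj' gj' vj' _] := det (posP j.+1).
  split=> //=; first by rewrite tj tj' text.
  rewrite gj gj' vj vj'; exists (flatten [seq p k | k <- iota (J j) (J j.+1 - J j)]).
    have := img_letter j (img_iter N imx); rewrite -/J => ->.
    rewrite (run_cert_seg (J j)) /J cutS; congr (Some (st _, flatten [seq p k | k <- iota _ _])); lia.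
  by case: conj => [|/(_ j)]; [left | right].
Qed.
End CertificateOfRun.

(** The state is the position of the cut modulo [d], and every complete period outputs the single
    label [0]. Levels [n] and [n + N] are chosen with the same image lengths modulo [d], so that
    applying [sigma^N] leaves the state unchanged. *)
Lemma periodic_certificate (A : finType) B (s : A -> seq A) (f : A -> seq B) x y d :
  img s x x -> img f x y -> 0 < d -> (forall i, y (i + d) = y i) ->
  exists C, certifies s f (x 0) C.
Proof.
move=> imx imy d0 per.
have perk k i : y (i + k * d) = y i.
  by elim: k => [|k IHk]; rewrite ?addn0 // mulSn addnCA addnC per.
have permod i : y i = y (i %% d) by rewrite {1}(divn_eq i d) addnC perk.
pose sz n : {ffun A -> 'I_d} := [ffun c => Ordinal (ltn_pmod (size (wpow s f n c)) d0)].
have [t Ht] := @pigeonhole_inf _ (fun=> True) sz (fun n => ex_intro2 _ _ n (leqnn n) I).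
have [n _ [_ en]] := Ht 0; have [n' lt [_ en']] := Ht n.+1.
pose N := n' - n; pose W := wpow s f n.
have szN c : size (wpow s f (n + N) c) = size (W c) %[mod d].
  have : sz n' c = sz n c by rewrite en en'.
  by rewrite subnKC ?(ltnW lt) // !ffunE => -[].
have imW := img_wpow n imx imy; pose st j := cut W x j %% d.
have stJ j : st (cut (mpow s N) x j) = st j.
  rewrite /st -(img_cut_comp W j (img_iter N imx)).
  have -> : cut (extend W \o mpow s N) x j = cut (wpow s f (n + N)) x j.
    by rewrite /cut; congr size; apply: eq_extend => c; rewrite wpowD.
  by elim: j => // j IHj; rewrite !cutS -modnDm IHj szN modnDm.
have blocks k r : seg y 0 (k * d + r) = extend (fun=> seg y 0 d) (nseq k 0) ++ seg y 0 r.
  elim: k => [|k IHk] //; rewrite mulSn -addnA segD add0n /= extend_cons -catA -IHk; congr (_ ++ _).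
  by apply: seg_eq => i _; rewrite addnC per.
eexists; apply: (@run_certP _ _ s f x imx n N d st
  (fun j => nseq ((st j + size (W (x j))) %/ d) 0) (fun j => seg y 0 (st j))
  (fun=> seg y 0 d) (fun=> [:: 0; 0]) (fun=> [::]) [:: 0]) => //.
- by rewrite subn_gt0.
- by rewrite /st cut0 mod0n.
- by move=> j; rewrite ltn_mod.
- by rewrite /st cut0 mod0n.
- move=> i j e; rewrite !stJ e; split=> // xe; rewrite xe; split=> //.
  by rewrite /st !cutS -modnDml -/(st i) e xe modnDml.
- move=> j; have -> : st j.+1 = (st j + size (W (x j))) %% d by rewrite /st cutS modnDml.
  rewrite -blocks -divn_eq segD; congr (_ ++ _); rewrite [LHS](img_letter j imW).
  by apply: seg_eq => i _; rewrite add0n [LHS]permod [RHS]permod /st modnDml.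
- by move=> j; apply/allP => r /nseqP[->]; rewrite inE.
- by left.
- by move=> r r' _; rewrite !inE => /eqP->.
Qed.

(** * Growth in aperiodic uniformly recurrent sequences *)

Lemma flatten_nseqSr T k (t : seq T) : flatten (nseq k.+1 t) = flatten (nseq k t) ++ t.
Proof. by elim: k => [|k IHk] /=; rewrite ?cats0 // -catA -IHk. Qed.

Section Periodicity.
Variables (B : Type) (y : nat -> B).
Hypotheses (ur : uniformly_recurrent y) (aper : forall d, 0 < d -> ~ forall i, y (i + d) = y i).

Lemma nth_flatten_nseq (b : B) k t j : j + size t < size (flatten (nseq k t)) ->
  nth b (flatten (nseq k t)) (j + size t) = nth b (flatten (nseq k t)) j.
Proof.
case: k => [|k] // lt.
have e := flatten_nseqSr k t.
have lt2 : j < size (flatten (nseq k t)) by move: lt; rewrite e size_cat; lia.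
by rewrite {2}e [in RHS]nth_cat lt2 /= nth_cat ltnNge leq_addl /= addnK.
Qed.

(** By uniform recurrence a high power of [t] contains each factor of length [(size t).+1], whose
    two end letters then agree: [y] would have period [size t]. *)
Lemma no_powers t : t <> [::] -> ~ forall k, factor y (flatten (nseq k t)).
Proof.
move=> net pow; have d0 : 0 < size t by case: t net {pow}.
apply: (aper d0) => i.
have [L win] := ur_window ur (factor_seg y i (size t).+1).
pose k := L + (size t).+1.
have szk : k <= size (flatten (nseq k t)).
  by elim: k => // k IHk; rewrite /= size_cat; lia.
have [|v1 [v2 e]] := window_infix win (pow k); first by rewrite size_seg.
have := congr1 size e; rewrite !size_cat size_seg => sz.
have := @nth_flatten_nseq (y 0) k t (size v1); rewrite sz e !nth_cat ltnn subnn.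
case/(_ _)/Wrap; first by lia.
by rewrite !size_seg ltnNge leq_addr addKn ltnSn !nth_seg // addn0.
Qed.
End Periodicity.

Lemma extend_mpowS A (s : A -> seq A) n w : extend (mpow s n.+1) w = extend s (extend (mpow s n) w).
Proof. by rewrite !extend_mpow. Qed.

Lemma extend_id A (w : seq A) : extend (fun c => [:: c]) w = w.
Proof. by elim: w => // c w IHw; rewrite extend_cons IHw. Qed.

Section Towers.
Variables (A : Type) (s : A -> seq A) (N : nat) (g : A) (u v : seq A).
Hypothesis muv : mpow s N g = u ++ g :: v.

Lemma tower_right j : exists t, mpow s (N * j) g =
  t ++ g :: flatten [seq extend (mpow s (N * i)) v | i <- iota 0 j].
Proof.
elim: j => [|j [t e]]; first by exists [::]; rewrite muln0.
exists (extend (mpow s (N * j)) u ++ t).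
by rewrite mulnSr mpowD muv extend_cat extend_cons e -[j.+1]addn1 iotaD map_cat flatten_cat /= cats0 -!catA.
Qed.

Lemma tower_left j : exists t, mpow s (N * j) g =
  flatten [seq extend (mpow s (N * i)) u | i <- rev (iota 0 j)] ++ g :: t.
Proof.
elim: j => [|j [t e]]; first by exists [::]; rewrite muln0.
exists (t ++ extend (mpow s (N * j)) v).
by rewrite mulnSr mpowD muv extend_cat extend_cons e -[j.+1]addn1 iotaD rev_cat /= -!catA.
Qed.
End Towers.

Lemma map_iota_period T (h : nat -> T) j P k : (forall i, j <= i -> h (i + P) = h i) ->
  map h (iota j (k * P)) = flatten (nseq k (map h (iota j P))).
Proof.
move=> per; elim: k => // k IHk; rewrite mulSn iotaD map_cat /= -IHk; congr (_ ++ _).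
rewrite addnC iotaDl -map_comp; apply/eq_in_map => i; rewrite mem_iota => /andP[le _] /=.
by rewrite addnC per.
Qed.

Lemma rev_flatten_nseq T k (H : seq T) : rev (flatten (nseq k H)) = flatten (nseq k (rev H)).
Proof.
by elim: k => // k IHk; rewrite [RHS]flatten_nseqSr -IHk /= rev_cat.
Qed.

Lemma flatten_flatten_nseq T k (H : seq (seq T)) :
  flatten (flatten (nseq k H)) = flatten (nseq k (flatten H)).
Proof. by elim: k => //= k IHk; rewrite flatten_cat IHk. Qed.

Section Growth.
Variables (A : finType) (s : A -> seq A).
Hypothesis sne : forall c, s c <> [::].

Definition growing c := forall L, exists n, L <= size (mpow s n c).
Definition gro c := `[< growing c >].

Definition sigma_max := \max_c size (s c).

Lemma sigma_max_gt0 (c : A) : 0 < sigma_max.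
Proof.
by apply: leq_trans (leq_bigmax c); case: (s c) (@sne c).
Qed.

Lemma size_mpow_word n k w : size (extend (mpow s n) w) <= size (extend (mpow s (n + k)) w).
Proof.
elim: k => [|k IHk]; rewrite ?addn0 //; apply: leq_trans IHk _.
by rewrite addnS extend_mpowS; apply: size_extend_ge.
Qed.

Lemma leq_size_mpow n m w : n <= m -> size (extend (mpow s n) w) <= size (extend (mpow s m) w).
Proof. by move=> /subnKC <-; apply: size_mpow_word. Qed.

Lemma size_mpow_add n k w : size (extend (mpow s (n + k)) w) <= sigma_max ^ k * size (extend (mpow s n) w).
Proof.
elim: k => [|k IHk]; rewrite ?addn0 ?mul1n // expnS -mulnA addnS extend_mpowS.
apply: leq_trans (leq_mul (leqnn _) IHk).
by apply: size_extend_le => c; apply: (leq_bigmax c).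
Qed.

Lemma mpow_gt0 n c : 0 < size (mpow s n c).
Proof. by have := leq_size_mpow [:: c] (leq0n n); rewrite extend_mpow0 extend1. Qed.

Lemma mem_mpow_size c d n k : d \in mpow s k c -> size (mpow s n d) <= size (mpow s (n + k) c).
Proof.
rewrite mpowD => /splitPr[u v]; rewrite extend_cat extend_cons !size_cat.
by rewrite addnCA leq_addr.
Qed.

Lemma bounded_word w : ~~ has gro w -> exists L, forall n, size (extend (mpow s n) w) <= L.
Proof.
elim: w => [|c w IHw] /=; first by exists 0 => n.
rewrite negb_or => /andP[/asboolPn/existsNP[L HL] /IHw[L' HL']].
exists (L + L') => n; rewrite extend_cons size_cat leq_add //.
by case: (leqP (size (mpow s n c)) L) => // lt; case: HL; exists n; apply: ltnW.
Qed.

Lemma growing_step c : gro c -> has gro (s c).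
Proof.
move=> /asboolP gc; apply: contrapT => /negP /bounded_word[L HL].
have [n Hn] := gc (L + 2); case: n Hn => [|n]; first by rewrite /=; lia.
by rewrite mpowSr; have := HL n; lia.
Qed.

Lemma count_mpow n w : count gro w <= count gro (extend (mpow s n) w).
Proof.
elim: n => [|n IHn]; first by rewrite extend_mpow0.
apply: leq_trans IHn _; rewrite extend_mpowS.
elim: (extend _ w) => // c v IHv; rewrite extend_cons count_cat /= leq_add //.
by case gc: (gro c) => //; rewrite -has_count; apply: growing_step.
Qed.

Lemma has_growing_mpow n w : has gro w -> has gro (extend (mpow s n) w).
Proof. by rewrite !has_count => h; apply: leq_trans h (count_mpow _ _). Qed.

End Growth.

Section Rep.
Variables (A : finType) (B : Type) (s : A -> seq A) (f : A -> seq B).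
Variables (x : nat -> A) (y : nat -> B).
Hypotheses (imx : img s x x) (imy : img f x y).
Hypotheses (sne : forall c, s c <> [::]) (fne : forall c, f c <> [::]).
Hypotheses (allx : forall c, exists j, x j = c) (grow0 : growing s (x 0)).
Hypotheses (ur : uniformly_recurrent y) (aper : forall d, 0 < d -> ~ forall i, y (i + d) = y i).
Local Notation W := (wpow s f).
Local Notation gro := (gro s).

Lemma prefix_mpow n : occurs x (mpow s n (x 0)) 0.
Proof. by rewrite [mpow _ _ _](img_letter 0 (img_iter n imx)) cut0; apply: occurs_seg. Qed.

Lemma factor_in_mpow w : factor x w -> exists k u v, mpow s k (x 0) = u ++ w ++ v.
Proof.
move=> [i o]; have [k Hk] := grow0 (i + size w); exists k.
rewrite (occursE (prefix_mpow k)) (@seg_sub _ x 0 _ i (size w)) // -(occursE o).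
by do 2!eexists.
Qed.

Lemma letter_factor c : factor x [:: c].
Proof. by have [j e] := allx c; exists j; apply/occurs_cons. Qed.

Lemma factor_mpow n w : factor x w -> factor x (extend (mpow s n) w).
Proof. exact: img_factor (img_iter n imx). Qed.

Lemma factor_wpow n w : factor x w -> factor y (extend (W n) w).
Proof. exact: img_factor (img_wpow n imx imy). Qed.

(** Pump a long run with the automaton that dies on growing letters: [sigma^N(g) = u g v] where [u]
    or [v] becomes a nonempty word [r'] without growing letters. The words [h i] have bounded
    length, hence are eventually periodic in [i], and the towers over [g] contain all powers of one
    period [T], against [no_powers]. *)
Lemma bounded_runs : exists rho, forall w, factor x w -> ~~ has gro w -> size w <= rho.
Proof.
pose delta (q : bool) c := q && ~~ gro c.
have absorb q b : delta q b -> q by case/andP.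
have runE q w : foldl delta q w = q && ~~ has gro w.
  by elim: w q => [|c w IHw] q /=; rewrite ?andbT // IHw /delta negb_or andbA.
have [L pump] := pumping s (fun c => [:: c]) absorb.
exists L => w fw nw; case: (leqP (size w) L) => // /ltnW lt; exfalso.
have [k [pre [post e]]] := factor_in_mpow fw.
have [|||k' [g [N [n [u [v [q [[gk N0 muv _] [alq [r ruv [ner fixr]]]]]]]]]]] := pump k (x 0) pre w post true.
- by rewrite /wpow extend_id.
- by rewrite runE.
- by [].
rewrite alq in fixr; rewrite !extend_wpow extend_id in ner fixr.
move: fixr; rewrite runE /= => nr; set r' := extend (mpow s n) r in ner nr.
have [Lr HLr] := bounded_word nr.
pose h i := extend (mpow s (N * i)) r'.
have [t Ht] := @pigeonhole_inf _ (fun=> True) (fun i => insub_bseq Lr (h i)) (fun n => ex_intro2 _ _ n (leqnn n) I).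
have [j1 _ [_ e1]] := Ht 0; have [j2 lt12 [_ e2]] := Ht j1.+1.
have leh i : size (h i) <= Lr by apply: HLr.
have hE : h j1 = h j2.
  have vE i : (insub_bseq Lr (h i) : seq A) = h i by apply: insubdK; apply: leh.
  by rewrite -(vE j1) -(vE j2) e1 e2.
pose P := j2 - j1.
have per i : j1 <= i -> h (i + P) = h i.
  move=> le; have -> : i + P = (i - j1) + j2 by rewrite /P; lia.
  have {2}-> : i = (i - j1) + j1 by lia.
  by rewrite /h !mulnDr !extend_mpowD -/(h j1) -/(h j2) hE.
have P0 : 0 < P by rewrite subn_gt0.
have neh i : h i <> [::].
  have : 0 < size r' by case: (r') ner.
  have := leq_size_mpow sne r' (leq0n (N * i)); rewrite extend_mpow0 -/(h i).
  by case: (h i) => //=; lia.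
have fxj j : factor x (extend (mpow s n) (mpow s (N * j) g)).
  apply: factor_mpow; have := factor_mpow (N * j) (letter_factor g); by rewrite extend1.
have nef H : H <> [::] -> {in H, forall i, 0 <= i} -> flatten [seq h i | i <- H] <> [::].
  by case: H => // i H _ _ /=; case: (h i) (neh i).
have hr i : extend (mpow s n) (extend (mpow s (N * i)) r) = h i.
  by rewrite /h /r' -!extend_mpowD addnC.
have flatE H : extend (mpow s n) (flatten [seq extend (mpow s (N * i)) r | i <- H]) = flatten [seq h i | i <- H].
  by elim: H => // i H IHH; rewrite /= extend_cat hr IHH.
have iotaP k2 : iota 0 (j1 + k2 * P) = iota 0 j1 ++ iota j1 (k2 * P) by rewrite iotaD add0n.
case: ruv => rE.
  pose T := flatten [seq h i | i <- rev (iota j1 P)].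
  apply: (@no_powers _ y ur aper (extend f T)).
    have : T <> [::] by apply: nef => //; case: (P) P0 => // P' _; rewrite /= rev_cons; case: (rev _).
    by case: (T) => // c T' _; rewrite extend_cons; case: (f c) (@fne c).
  move=> k2; have [t2 e3] := tower_left muv (j1 + k2 * P).
  have := fxj (j1 + k2 * P); rewrite e3 extend_cat -rE flatE iotaP rev_cat map_cat flatten_cat.
  rewrite (map_rev _ (iota j1 (k2 * P))) (map_iota_period _ per) rev_flatten_nseq flatten_flatten_nseq.
  rewrite -map_rev -/T -catA => fx.
  have {fx} : factor x (flatten (nseq k2 T)).
    exact: (@factor_infix _ x [::] _ _ fx).
  move=> /(img_factor imy); congr factor; elim: (k2) => // k3 IHk; by rewrite /= extend_cat IHk.
pose T := flatten [seq h i | i <- iota j1 P].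
apply: (@no_powers _ y ur aper (extend f T)).
  have : T <> [::] by apply: nef => //; case: (P) P0.
  by case: (T) => // c T' _; rewrite extend_cons; case: (f c) (@fne c).
move=> k2; have [t2 e3] := tower_right muv (j1 + k2 * P).
have := fxj (j1 + k2 * P); rewrite e3 extend_cat extend_cons -rE flatE iotaP map_cat flatten_cat.
rewrite (map_iota_period _ per) flatten_flatten_nseq -/T => fx.
have {fx} : factor x (flatten (nseq k2 T)).
  move: fx; rewrite !catA => -[i /occurs_cat[_ o]]; by eexists; apply: o.
by move=> /(img_factor imy); congr factor; elim: (k2) => // k3 IHk; rewrite /= extend_cat IHk.
Qed.

Lemma size_by_count rho w : (forall u v v', w = u ++ v ++ v' -> ~~ has gro v -> size v <= rho) ->
  size w <= rho.+1 * (count gro w).+1.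
Proof.
move=> runs; suff key r : ~~ has gro r -> (forall u v v', r ++ w = u ++ v ++ v' -> ~~ has gro v -> size v <= rho) ->
    size (r ++ w) <= rho.+1 * (count gro w).+1 by apply: (key [::]).
elim: w r {runs} => [|c w IHw] r nr runs.
  have := runs [::] r [::]; rewrite cats0 => /(_ erefl nr) le; rewrite muln1; lia.
case gc: (gro c); last first.
  rewrite /= gc -cat_rcons; apply: IHw; last by rewrite cat_rcons.
  by rewrite has_rcons gc.
have ler : size r <= rho by apply: (runs [::] r (c :: w)).
have le : size w <= rho.+1 * (count gro w).+1.
  by apply: (IHw [::]) => // u v v' e; apply: (runs (r ++ c :: u) v v'); rewrite -catA /= -e.
rewrite /= gc size_cat /= add1n mulnS; lia.
Qed.

(** Bounded runs force long words to contain many growing letters, so after [q] steps each growing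
    letter has at least two growing descendants and their number doubles. Sizes of images are
    comparable with this number as soon as it is positive. *)
Lemma doubling : exists2 e, 0 < e & forall w k, factor x w -> has gro w ->
  2 * size (extend (W k) w) <= size (extend (W (k + e)) w).
Proof.
have [rho runs] := bounded_runs.
have szc w : factor x w -> size w <= rho.+1 * (count gro w).+1.
  move=> fw; apply: size_by_count => u v v' e; apply: runs.
  by apply: (@factor_infix _ x u v v'); rewrite -e.
have ex c : exists n, gro c -> 2 <= count gro (mpow s n c).
  case gc: (gro c); last by exists 0.
  have [n Hn] := elimT (asboolP _) gc (rho.+1 * 2).+1; exists n => _.
  have := szc (mpow s n c); rewrite -extend1 => /(_ (factor_mpow n (letter_factor c))).
  rewrite extend1 => le; have := leq_trans Hn le; rewrite ltn_mul2l; lia.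
pose q := \max_c projT1 (cid (ex c)).
have Hq c : gro c -> 2 <= count gro (mpow s q c).
  move=> gc; have Hc : 2 <= count gro (mpow s (projT1 (cid (ex c))) c) by case: cid => n /= /(_ gc).
  apply: leq_trans Hc _; have le : projT1 (cid (ex c)) <= q by apply: (leq_bigmax c).
  by rewrite -[q in X in _ <= X](subnK le) mpowD; apply: count_mpow.
have Hqw w : 2 * count gro w <= count gro (extend (mpow s q) w).
  elim: w => // c w IHw; rewrite extend_cons count_cat /= mulnDr leq_add //.
  by case gc: (gro c) => //; rewrite muln1; apply: Hq.
have Hqj j w : 2 ^ j * count gro w <= count gro (extend (mpow s (q * j)) w).
  elim: j => [|j IHj]; first by rewrite mul1n muln0 extend_mpow0.
  by rewrite expnS mulnS extend_mpowD -mulnA; apply: leq_trans (Hqw _); rewrite leq_mul2l IHj.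
(* With [n] growing letters, [n > 0], the doubled size is at most [2 * M * rho.+1 * n.+1], hence at
   most [j * n], and [j < 2 ^ j]. *)
pose M := \max_c size (f c); pose j := 4 * M * rho.+1.
have j2 : j < 2 ^ j := ltn_expl j (isT : 1 < 2).
exists (q * j).+1 => // w k fw hw.
set w' := extend (mpow s k) w.
have fw' : factor x w' by apply: factor_mpow.
have cw' : 0 < count gro w' by rewrite -has_count; apply: has_growing_mpow.
have le1 : size (extend (W k) w) <= M * size w'.
  by rewrite extend_wpow; apply: size_extend_le => c; apply: (leq_bigmax c).
have le2 := szc _ fw'.
have le3 : 2 ^ j * count gro w' <= size (extend (W (k + (q * j).+1)) w).
  rewrite extend_wpow; apply: leq_trans (size_extend_ge _ fne).
  apply: leq_trans (Hqj j w') _; apply: leq_trans (count_size gro _) _.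
  rewrite -extend_mpowD; apply: leq_size_mpow => //; lia.
apply: leq_trans le3; apply: leq_trans (leq_mul (ltnW j2) (leqnn _)).
apply: leq_trans (leq_mul (leqnn 2) le1) _.
apply: leq_trans (leq_mul (leqnn 2) (leq_mul (leqnn M) le2)) _.
rewrite /j; nia.
Qed.
End Rep.

(** * Linear recurrence *)

(** A shortest factor [v'] whose image contains [w] will do: if [w] did not reach into the first or
    the last block, that letter could be dropped. *)
Lemma minimal_cover A B (f : A -> seq B) v p w z : extend f v = p ++ w ++ z -> w <> [::] ->
  exists v1 v' v2, [/\ v = v1 ++ v' ++ v2, exists p' z', extend f v' = p' ++ w ++ z' &
    forall a1 mid a2, v' = a1 :: rcons mid a2 ->
      exists w1 w2, [/\ w = w1 ++ extend f mid ++ w2, w1 <> [::] & w2 <> [::]]].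
Proof.
move=> e new.
pose covers m := exists v1 v' v2, [/\ v = v1 ++ v' ++ v2, exists p' z', extend f v' = p' ++ w ++ z' & size v' = m].
have [m [v1 [v' [v2 [vE [p' [z' e']] szv']]]] min] : exists2 m, covers m & forall k, k < m -> ~ covers k.
  by apply: ex_least; exists (size v), [::], v, [::]; split; rewrite ?cats0 //; exists p, z.
exists v1, v', v2; split=> //; first by exists p', z'.
move=> a1 mid a2 v'E; move: e'; rewrite v'E extend_cons -cats1 extend_cat extend1 => e'.
have lt1 : size p' < size (f a1).
  rewrite ltnNge; apply/negP => le; have [t _ e2] := cat_prefix e' le.
  apply: (min (size (rcons mid a2))); first by rewrite -szv' v'E.
  exists (rcons v1 a1), (rcons mid a2), v2; split=> //; first by rewrite vE v'E cat_rcons.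
  by exists t, z'; rewrite -cats1 extend_cat extend1.
have lt2 : size z' < size (f a2).
  rewrite ltnNge; apply/negP => le.
  have [t z'E e2] := cat_prefix (u := rev (f a2)) (x := rev (f a1 ++ extend f mid)) (v := rev z') (y := rev (p' ++ w))
     (etrans (esym (rev_cat _ _)) (etrans (congr1 rev (etrans (esym (catA _ _ _)) (etrans e' (catA _ _ _)))) (rev_cat _ _)))
     (eq_ind_r (fun k => k <= size (rev z')) (eq_ind_r (leq (size (f a2))) le (size_rev _)) (size_rev _)).
  apply: (min (size (a1 :: mid))); first by rewrite -szv' v'E /= size_rcons.
  exists v1, (a1 :: mid), (a2 :: v2); split=> //; first by rewrite vE v'E /= cat_rcons.
  exists p', (rev t); rewrite extend_cons.
  by have := congr1 rev e2; rewrite revK rev_cat revK => ->; rewrite -catA.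
have [w1 fa1 e2] := cat_prefix (esym e') (ltnW lt1).
have ne1 : w1 <> [::] by move=> w10; move: lt1; rewrite fa1 w10 cats0 ltnn.
move: e2; rewrite catA => e2; have sz := congr1 size e2; rewrite !size_cat in sz.
have [|w2 wE fa2] := cat_prefix (esym e2); first by rewrite size_cat; lia.
exists w1, w2; split=> //; first by rewrite wE -catA.
by move=> w20; move: lt2; rewrite fa2 w20 ltnn.
Qed.

Section LeafRecurrence.
Variables (A : finType) (B : Type) (s : A -> seq A) (f : A -> seq B).
Variables (x : nat -> A) (y : nat -> B).
Hypotheses (imx : img s x x) (imy : img f x y).
Hypotheses (sne : forall c, s c <> [::]) (fne : forall c, f c <> [::]).
Hypotheses (allx : forall c, exists j, x j = c) (grow0 : growing s (x 0)).
Hypotheses (ur : uniformly_recurrent y) (aper : forall d, 0 < d -> ~ forall i, y (i + d) = y i).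
Local Notation W := (wpow s f).
Local Notation gro := (gro s).
Variable c : A.
Hypotheses (gc : gro c) (cc : c \in s c).
Hypothesis leaf : forall d k, gro d -> d \in mpow s k c -> exists k', c \in mpow s k' d.

Lemma mem_mpow_trans b d e k l : d \in mpow s k b -> e \in mpow s l d -> e \in mpow s (l + k) b.
Proof.
by rewrite mpowD => /splitPr[u v] he; rewrite extend_cat extend_cons !mem_cat he orbT.
Qed.

Lemma mem_loop i : c \in mpow s i c.
Proof.
elim: i => [|i IHi]; first by rewrite mpow0 inE.
by rewrite -addn1; apply: mem_mpow_trans IHi; rewrite mpow1.
Qed.

(** The waiting time can be made uniform because [c] occurs in [s c]: once [c] is reached it
    persists. *)
Lemma leaf_time : exists q, forall d k, gro d -> d \in mpow s k c -> c \in mpow s q d.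
Proof.
have ex d : exists q, (exists2 k, gro d & d \in mpow s k c) -> c \in mpow s q d.
  have [[k gd dk]|no] := pselect (exists2 k, gro d & d \in mpow s k c); last by exists 0.
  by have [q Hq] := leaf gd dk; exists q.
exists (\max_d projT1 (cid (ex d))) => d k gd dk.
have le : projT1 (cid (ex d)) <= \max_d projT1 (cid (ex d)) by apply: (leq_bigmax d).
rewrite -(subnK le); apply: mem_mpow_trans (mem_loop _).
by case: cid => q /=; apply; exists k.
Qed.

Lemma infix_loop k i v u w : mpow s k c = u ++ v ++ w -> exists u' w', mpow s (k + i) c = u' ++ v ++ w'.
Proof.
move=> e; have := mem_loop i; rewrite mpowD => /splitPr[u1 u2].
rewrite extend_cat extend_cons e.
by exists (extend (mpow s k) u1 ++ u), (w ++ extend (mpow s k) u2); rewrite -!catA.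
Qed.

Lemma infix_time m : exists j, forall v k u w, size v <= m -> mpow s k c = u ++ v ++ w ->
  exists u' w', mpow s j c = u' ++ v ++ w'.
Proof.
pose P (v : m.-bseq A) j := exists u' w', mpow s j c = u' ++ v ++ w'.
have ex (v : m.-bseq A) : exists j, (exists k, P v k) -> P v j.
  have [[k Pk]|no] := pselect (exists k, P v k); last by exists 0.
  by exists k.
exists (\max_v projT1 (cid (ex v))) => v k u w le e.
have vE : (insub_bseq m v : seq A) = v by apply: insubdK; apply: le.
have lej : projT1 (cid (ex (insub_bseq m v))) <= \max_v projT1 (cid (ex v)) by apply: (leq_bigmax (insub_bseq m v)).
have [u' [w' e']] : P (insub_bseq m v) (projT1 (cid (ex (insub_bseq m v)))).
  by case: cid => j /=; apply; exists k, u, w; rewrite vE.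
by rewrite vE in e'; have := infix_loop (\max_v projT1 (cid (ex v)) - projT1 (cid (ex (insub_bseq m v)))) e'; rewrite subnKC.
Qed.

(** The level [m] is chosen so that [sigma^m(c)] has about the size of [w]. Then [w] occurs in
    [W m2 d] for every growing descendant [d] of [c], with [m2 - m] independent of [w], and a
    segment of length a constant times [size w] contains such a block. *)
Lemma leaf_recurrence : exists K, forall w, factor y w -> w <> [::] -> window y w (K * size w).
Proof.
have [rho runs] := bounded_runs imx imy sne fne allx grow0 ur aper.
have szc w : factor x w -> size w <= rho.+1 * (count gro w).+1.
  move=> fw; apply: size_by_count => u v v' e; apply: runs.
  by apply: (@factor_infix _ x u v v'); rewrite -e.
have [q Hq] := leaf_time; have [j Hj] := infix_time (rho.+1 * 3).
(* [kb] bounds the time at which [c] produces any of its descendants [b], growing or not; sizes at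
   [b] are thereby bounded by sizes at [c]. *)
have exb b : exists k, (exists k', b \in mpow s k' c) -> b \in mpow s k c.
  have [[k bk]|no] := pselect (exists k, b \in mpow s k c); last by exists 0.
  by exists k.
pose kb := \max_b projT1 (cid (exb b)).
pose M0 := \max_c size (f c); pose kap := sigma_max s.
pose K := rho.+2 * (M0 * (kap ^ (q + j + q + kb) * kap)).
exists K => w fw new i.
have [Lw win] := ur_window ur fw.
have fcm k : factor x (mpow s k c).
  by rewrite -extend1; apply: (factor_mpow imx); apply: letter_factor.
have Wbig L : exists k, forall n, k <= n -> L <= size (W n c).
  have /asboolP grc := gc; have [k Hk] := grc L; exists k => n le; apply: leq_trans Hk _.
  apply: leq_trans (size_extend_ge _ fne); rewrite -[mpow s k c]extend1 -[mpow s n c]extend1.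
  exact: leq_size_mpow.
(* The words [W n c] are arbitrarily long factors, so they contain every factor of [y]: the
   descendants of [c] are enough to describe [y]. *)
have inW v : factor y v -> (exists L, window y v L) -> forall k, exists n z1 z2, k <= n /\ W n c = z1 ++ v ++ z2.
  move=> fv [L' winv] k; have [k' Hk'] := Wbig (L' + size v); exists (k + k').
  have [|z1 [z2 e]] := window_infix winv _ (Hk' (k + k') (leq_addl _ _)).
    by rewrite -[W _ c]extend1; apply: (factor_wpow imx imy); apply: letter_factor.
  by exists z1, z2; rewrite leq_addr.
have [m szm minm] : exists2 m, size w <= size (mpow s m c) & forall k, k < m -> ~ size w <= size (mpow s k c).
  by apply: ex_least; have /asboolP grc := gc; apply: grc.
have szm2 : size (mpow s m c) <= kap * size w.
  case: m szm minm => [|m] szm minm.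
    by rewrite mpow0 /= muln_gt0 (sigma_max_gt0 sne c) /=; case: (w) new.
  have := minm m (ltnSn m) => /negP; rewrite -ltnNge => lt.
  have := size_mpow_add s m 1 [:: c]; rewrite expn1 !extend1 addn1 => le; apply: leq_trans le _.
  by rewrite leq_mul2l (ltnW lt) orbT.
have wd d k : gro d -> d \in mpow s k c -> size w <= size (W (m + q) d).
  move=> gd dk; apply: leq_trans (size_extend_ge _ fne); apply: leq_trans szm _.
  exact: mem_mpow_size (Hq d k gd dk).
(* By [wd] a growing letter inside a minimal cover would have an image as long as [w], so only the
   two end letters can grow. The cover has at most [rho.+1 * 3] letters and [infix_time] finds it in
   [sigma^j(c)]. *)
have wc : exists z1 z2, W (m + q + j) c = z1 ++ w ++ z2.
  have [n [z1 [z2 [le e]]]] := inW w fw (ex_intro _ Lw win) (m + q).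
  have e' : extend (W (m + q)) (mpow s (n - (m + q)) c) = z1 ++ w ++ z2 by rewrite -wpowD subnKC.
  have [v1 [v' [v2 [vE [p' [z' ev']] mid]]]] := minimal_cover e' new.
  have fv' : factor x v' by apply: (@factor_infix _ x v1 v' v2); rewrite -vE.
  have cnt : count gro v' <= 2.
    rewrite leqNgt; apply/negP => lt.
    case: v' vE ev' mid fv' lt => [|a1 v'] // vE ev' mid fv' lt.
    case/lastP: v' vE ev' mid fv' lt => [|v' a2] vE ev' mid fv' lt; first by move: lt => /=; case: gro.
    have hm : has gro v'.
      by move: lt; rewrite has_count /= -cats1 count_cat /=; case: gro; case: gro; lia.
    have [w1 [w2 [wE ne1 ne2]]] := mid _ _ _ erefl.
    have /hasP[d dv' gd] := hm.
    have dm : d \in mpow s (n - (m + q)) c.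
      by rewrite vE !mem_cat inE mem_rcons inE dv' !orbT.
    have [d1 [d2 v'E]] : exists d1 d2, v' = d1 ++ d :: d2 by have /splitPr[d1 d2] := dv'; exists d1, d2.
    have := wd d _ gd dm; rewrite wE v'E extend_cat extend_cons !size_cat; case: (w1) ne1 => // b w1' _ /=; lia.
  have [|u' [w' ej]] := Hj v' _ v1 v2 _ vE.
    by apply: leq_trans (szc _ fv') _; apply: leq_mul.
  rewrite wpowD ej !extend_cat ev'.
  by exists (extend (W (m + q)) u' ++ p'), (z' ++ extend (W (m + q)) w'); rewrite -!catA.
pose m2 := m + q + j + q.
have wd2 d k : gro d -> d \in mpow s k c -> exists z1 z2, W m2 d = z1 ++ w ++ z2.
  move=> gd dk; have := Hq d k gd dk; rewrite /m2 wpowD => /splitPr[u v].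
  have [z1 [z2 e]] := wc; rewrite extend_cat extend_cons e.
  by exists (extend (W (m + q + j)) u ++ z1), (z2 ++ extend (W (m + q + j)) v); rewrite -!catA.
have szb b k : b \in mpow s k c -> size (W m2 b) <= M0 * (kap ^ (q + j + q + kb) * kap) * size w.
  move=> bk; apply: leq_trans (_ : M0 * size (mpow s m2 b) <= _).
    by apply: size_extend_le => d; apply: (leq_bigmax d).
  rewrite -!mulnA leq_mul2l; apply/orP; right.
  have bk' : b \in mpow s (projT1 (cid (exb b))) c by case: cid => k' /=; apply; exists k.
  apply: leq_trans (@mem_mpow_size _ s _ _ m2 _ bk') _.
  have lek : projT1 (cid (exb b)) <= kb by apply: (leq_bigmax b).
  rewrite -[mpow _ _ c]extend1; apply: leq_trans (leq_size_mpow sne [:: c] (_ : _ <= m + (q + j + q + kb))) _.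
    by rewrite /m2; lia.
  apply: leq_trans (size_mpow_add _ _ _ _) _; rewrite extend1 leq_mul2l szm2 orbT //.
(* So long a segment needs a cover of more than [rho.+2] letters; more than [rho] of them are
   interior, so one of these grows. *)
pose L := K * size w + size w.
have fs : factor y (seg y i L) by apply: factor_seg.
have nes : seg y i L <> [::].
  by move/(congr1 size); rewrite size_seg /L; case: (w) new => //= b w' _; lia.
have [n [z1 [z2 [le e]]]] := inW _ fs (ur_window ur fs) m2.
have e' : extend (W m2) (mpow s (n - m2) c) = z1 ++ seg y i L ++ z2 by rewrite -wpowD subnKC.
have [v1 [v' [v2 [vE [p' [z' ev']] mid]]]] := minimal_cover e' nes.
have fv' : factor x v' by apply: (@factor_infix _ x v1 v' v2); rewrite -vE.
have szv' : rho.+2 < size v'.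
  rewrite ltnNge; apply/negP => lev.
  have : size (extend (W m2) v') <= K * size w.
    apply: leq_trans (_ : size v' * (M0 * (kap ^ (q + j + q + kb) * kap) * size w) <= _); last first.
      by rewrite /K -!mulnA leq_mul.
    have sub b : b \in v' -> b \in mpow s (n - m2) c by rewrite vE !mem_cat => ->; rewrite orbT.
    elim: (v') sub => // b v3 IHv sub; rewrite extend_cons size_cat mulSn leq_add //.
      by apply: szb (sub b _); rewrite inE eqxx.
    by apply: IHv => b' hb'; apply: sub; rewrite inE hb' orbT.
  rewrite ev' !size_cat size_seg /L; case: (w) new => //= b w' _; lia.
case: v' vE ev' mid fv' szv' => [|a1 v'] // vE ev' mid fv' szv'.
case/lastP: v' vE ev' mid fv' szv' => [|v' a2] vE ev' mid fv' szv' //.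
have [w1 [w2 [wE _ _]]] := mid _ _ _ erefl.
have hm : has gro v'.
  apply: contraLR szv' => nv; rewrite -leqNgt /= size_rcons !ltnS; apply: runs nv.
  by apply: (@factor_infix _ x [:: a1] v' [:: a2]); rewrite cats1.
have /hasP[d dv' gd] := hm.
have dm : d \in mpow s (n - m2) c by rewrite vE !mem_cat inE mem_rcons inE dv' !orbT.
have [t1 [t2 dE]] := wd2 d _ gd dm.
have [d1 [d2 v'E]] : exists d1 d2, v' = d1 ++ d :: d2 by have /splitPr[d1 d2] := dv'; exists d1, d2.
move: wE; rewrite v'E extend_cat extend_cons dE => wE.
have segE : seg y i L = (w1 ++ extend (W m2) d1 ++ t1) ++ w ++ (t2 ++ extend (W m2) d2 ++ w2).
  by rewrite wE -!catA.
exists (i + size (w1 ++ extend (W m2) d1 ++ t1)).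
  by have := congr1 size segE; rewrite size_seg size_cat [size (w ++ _)]size_cat /L; lia.
by have := occurs_seg y i L; rewrite segE => /occurs_cat[_ /occurs_cat[]].
Qed.
End LeafRecurrence.

Section LinearRecurrence.
Variables (A : finType) (B : Type) (s : A -> seq A) (f : A -> seq B).
Variables (x : nat -> A) (y : nat -> B).
Hypotheses (imx : img s x x) (imy : img f x y).
Hypotheses (sne : forall c, s c <> [::]) (fne : forall c, f c <> [::]).
Hypotheses (allx : forall c, exists j, x j = c) (grow0 : growing s (x 0)).
Hypotheses (ur : uniformly_recurrent y) (aper : forall d, 0 < d -> ~ forall i, y (i + d) = y i).

(* A leaf: a growing letter whose set of growing descendants is smallest.       *)
Lemma exists_leaf : exists c p, [/\ (gro s) c, 0 < p, c \in mpow s p c &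
  forall d k, (gro s) d -> d \in mpow s k c -> exists k', c \in mpow s k' d].
Proof.
pose R c := [set d | (gro s) d && `[< exists2 k, 0 < k & d \in mpow s k c >]].
have RP c d : reflect ((gro s) d /\ exists2 k, 0 < k & d \in mpow s k c) (d \in R c).
  by rewrite inE; apply: (iffP andP) => -[gd] => [/asboolP H|H]; split=> //; apply/asboolP.
have g0 : (gro s) (x 0) by apply/asboolP.
have [c0 gc0 minc0] := @arg_minnP _ (x 0) (gro s) (fun c => #|R c|) g0.
have sub c d : d \in R c -> R d \subset R c.
  move=> /RP[_ [k k0 dk]]; apply/subsetP => e /RP[ge [l l0 el]]; apply/RP; split=> //.
  by exists (l + k); [lia | apply: mem_mpow_trans el].
have /hasP[c1 c1s gc1] := growing_step gc0.
have c1R : c1 \in R c0 by apply/RP; split=> //; exists 1; rewrite ?mpow1.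
have full d : d \in R c0 -> R d = R c0.
  move=> dR; apply/eqP; rewrite eqEcard (sub _ _ dR) /=; apply: minc0.
  by have /RP[] := dR.
have c1c1 : c1 \in R c1 by rewrite (full _ c1R).
have /RP[_ [p p0 c1p]] := c1c1; exists c1, p; split=> // d [|k] gd.
  by rewrite mpow0 inE => /eqP->; exists 0; rewrite mpow0 inE.
move=> dk; have dR : d \in R c0 by rewrite -(full _ c1R); apply/RP; split=> //; exists k.+1.
have : c1 \in R d by rewrite (full _ dR).
by move=> /RP[_ [k' _ Hk']]; exists k'.
Qed.

Lemma linear_recurrence : exists K, forall w, factor y w -> w <> [::] -> window y w (K * size w).
Proof.
have [c [p [gc p0 cp leaf]]] := exists_leaf.
have groE d : gro (mpow s p) d = (gro s) d.
  apply/asboolP/asboolP => g L; have [n Hn] := g L.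
    by exists (p * n); rewrite -mpow_mpow.
  exists n; rewrite mpow_mpow; apply: leq_trans Hn _.
  by have := leq_size_mpow sne [:: d] (leq_pmull n p0); rewrite !extend1.
apply: (@leaf_recurrence A B (mpow s p) f x y (img_iter p imx) imy _ fne allx _ ur aper c) => //.
- by move=> d e; have := mpow_gt0 sne p d; rewrite e.
- by apply/asboolP; rewrite -/(gro (mpow s p) (x 0)) groE; apply/asboolP.
- by rewrite groE.
move=> d k; rewrite groE mpow_mpow => gd dk; have [k' ck'] := leaf d _ gd dk.
(* The total time has to be a multiple of [p]: the path of length [k'] from [d] to [c] is followed
   by [p.-1] rounds of the loop of length [k' + p * k] at [c]. *)
exists (p.-1 * k + k'); rewrite mpow_mpow.
have loop i : c \in mpow s (i * (k' + p * k)) c.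
  elim: i => [|i IHi]; first by rewrite mul0n mpow0 inE.
  by rewrite mulSn; apply: mem_mpow_trans IHi _; apply: mem_mpow_trans dk ck'.
have := mem_mpow_trans ck' (loop p.-1); congr (_ \in mpow s _ _).
by case: (p) p0 => // p' _ /=; nia.
Qed.

Variable K : nat.
Hypothesis LR : forall w, factor y w -> w <> [::] -> window y w (K * size w).

(** Occurrences at distance [d] overlap into agreement at distance [d]. A longer [w] would contain
    every factor of length [d.+1], and [y] would have period [d]. *)
Lemma gap_lower w i d : occurs y w i -> occurs y w (i + d) -> 0 < d -> size w < K.+1 * d.+1.
Proof.
move=> o1 o2 d0; rewrite ltnNge; apply/negP => le; apply: (aper d0) => k.
have [|j /andP[lej1 lej2] oj] := LR (factor_seg y k d.+1) _ i; first by move/(congr1 size); rewrite size_seg.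
rewrite size_seg in lej2.
have e1 : y j = y (j + d).
  have e := etrans (esym (occursE o1)) (occursE o2).
  have := eq_seg (k := j - i) e; case/(_ _)/Wrap; first by lia.
  by rewrite -addnA [d + _]addnC addnA subnKC.
have e2 := occursE oj; rewrite size_seg in e2.
have h0 := eq_seg (k := 0) e2 (ltn0Sn _); have hd := eq_seg (k := d) e2 (ltnSn _).
by rewrite !addn0 in h0; rewrite hd -e1 h0.
Qed.

(* Words with long ends are determined by the approximate positions of these  *)
(* ends in a long prefix of [y].                                              *)
Lemma few_words M : exists k, forall D al be, 0 < D -> D <= size al -> D <= size be ->
  exists code : seq B -> 'I_k * 'I_k, forall w w',
    (forall v, v = w \/ v = w' -> [/\ factor y v, size v <= M * D, exists z, v = al ++ z & exists z, v = z ++ be]) ->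
    code w = code w' -> w = w'.
Proof.
(* Positions are recorded in buckets of length [S], about [D / c]. By [gap_lower] a word of length
   at least [D] starts at most once in a bucket, and an early occurrence of a word of length at most
   [M * D] meets only the first [k] buckets. *)
pose c := 2 * K.+1; pose k := (K.+1 * M * c).+1.
have mulm p q r t u : t <= u * r -> p * (q * t) <= p * q * r * u.
  by move=> le; rewrite -!mulnA leq_mul // leq_mul // mulnC.
exists k => D al be D0 leal lebe; pose S := (D %/ c).+1.
have sep v i j : D <= size v -> occurs y v i -> occurs y v j -> i %/ S = j %/ S -> i = j.
  suff key a b : D <= size v -> occurs y v a -> occurs y v b -> a %/ S = b %/ S -> a < b -> False.
    by move=> leD oi oj e; case: (ltngtP i j) => // lt; [case: (key i j) | case: (key j i)].
  move=> leD oa ob e lt; have ltS : b - a < S.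
    have := divn_eq a S; have := divn_eq b S; rewrite e.
    have := @ltn_pmod a S isT; have := @ltn_pmod b S isT; lia.
  have ob' : occurs y v (a + (b - a)) by rewrite subnKC // ltnW.
  have := gap_lower oa ob'; rewrite subn_gt0 => /(_ lt) lt2.
  have : (b - a) * c <= D by apply: leq_trans (leq_trunc_div D c); rewrite leq_mul2r; apply/orP; right.
  rewrite /c; nia.
have posex w : exists i, factor y w -> w <> [::] -> i <= K * size w /\ occurs y w i.
  have [[fw ne]|no] := pselect (factor y w /\ w <> [::]); last by exists 0 => fw ne; case: no.
  by have [j /andP[_ le] oj] := LR fw ne 0; exists j.
pose pos w := projT1 (cid (posex w)).
have posP w : factor y w -> w <> [::] -> pos w <= K * size w /\ occurs y w (pos w) by rewrite /pos; case: cid.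
exists (fun w => (inord (pos w %/ S), inord ((pos w + (size w - size be)) %/ S))) => w w' H.
have {}H v : v = w \/ v = w' -> [/\ pos v %/ S < k, (pos v + (size v - size be)) %/ S < k & occurs y v (pos v)] /\
    [/\ occurs y al (pos v), occurs y be (pos v + (size v - size be)) & size be <= size v].
  move=> /H[fv szv [z1 e1] [z2 e2]].
  have nev : v <> [::] by move=> v0; have := congr1 size e1; rewrite v0 size_cat /=; lia.
  have [lep op] := posP v fv nev.
  have szv2 : size v = size z2 + size be by rewrite e2 size_cat.
  have bnd i : i <= K.+1 * size v -> i %/ S < k.
    move=> lei; rewrite ltnS; apply: leq_trans (leq_div2r S (leq_trans lei (leq_mul (leqnn _) szv))) _.
    have DS : D <= S * c by rewrite mulnC /S; have := divn_eq D c; have := @ltn_pmod D c isT; nia.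
    apply: leq_trans (leq_div2r S (_ : _ <= K.+1 * M * c * S)) _; last by rewrite mulnK.
    exact: mulm.
  split; split=> //; try by apply: bnd; lia.
  - by move: op; rewrite {1}e1 => /occurs_cat[].
  - by move: op; rewrite {1}e2 => /occurs_cat[_]; congr occurs; lia.
  - by lia.
have [[l1 l2 o] [oa ob lb]] := H w (or_introl erefl); have [[l1' l2' o'] [oa' ob' lb']] := H w' (or_intror erefl).
move=> [/(congr1 val) e1 /(congr1 val) e2]; rewrite /= !inordK // in e1 e2.
have p1 := sep _ _ _ leal oa oa' e1; have p2 := sep _ _ _ lebe ob ob' e2.
have sz : size w = size w'.
  by rewrite p1 in p2; rewrite -(subnK lb) -(subnK lb') (addnI p2).
by rewrite (occursE o) (occursE o') p1 sz.
Qed.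
End LinearRecurrence.

(** * Comparable growth *)

Lemma split_first T (P : pred T) w : has P w -> exists u c v, [/\ w = u ++ c :: v, P c & all (predC P) u].
Proof.
elim: w => //= c w IHw; case Pc: (P c); first by exists [::], c, w.
rewrite orFb => /IHw[u [d [v [-> Pd au]]]].
by exists (c :: u), d, v; rewrite /= Pc.
Qed.

Lemma split_last T (P : pred T) w : has P w -> exists u c v, [/\ w = u ++ c :: v, P c & all (predC P) v].
Proof.
rewrite -has_rev => /split_first[u [c [v [e Pc au]]]]; exists (rev v), c, (rev u); rewrite all_rev; split=> //.
by rewrite -[w]revK e rev_cat rev_cons cat_rcons.
Qed.

(** Each [a k] is at most [a (k + e) - a k], and the sum of these differences telescopes. *)
Lemma doubling_sum (a : nat -> nat) e n : 0 < e -> (forall k, 2 * a k <= a (k + e)) ->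
  \sum_(0 <= k < n) a k <= \sum_(n <= k < n + e) a k.
Proof.
move=> e0 dbl; elim: n => [|n IHn]; first by rewrite big_geq.
rewrite big_nat_recr //= addSn big_nat_recr /=; last by lia.
have := IHn; rewrite (@big_ltn _ _ _ n); last by lia.
by have := dbl n; lia.
Qed.

Section Comparable.
Variables (A : finType) (B : Type) (s : A -> seq A) (f : A -> seq B).
Variables (x : nat -> A) (y : nat -> B).
Hypotheses (imx : img s x x) (imy : img f x y).
Hypotheses (sne : forall c, s c <> [::]) (fne : forall c, f c <> [::]).
Hypotheses (allx : forall c, exists j, x j = c) (grow0 : growing s (x 0)).
Hypotheses (ur : uniformly_recurrent y) (aper : forall d, 0 < d -> ~ forall i, y (i + d) = y i).
Local Notation W := (wpow s f).
Local Notation gro := (gro s).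

Lemma growing_mem c d : d \in s c -> gro d -> gro c.
Proof.
move=> dc /asboolP gd; apply/asboolP => L; have [n Hn] := gd L; exists n.+1.
apply: leq_trans Hn _; rewrite -addn1; apply: mem_mpow_size; by rewrite mpow1.
Qed.

Lemma bounded_mpow n w : ~~ has gro w -> ~~ has gro (extend (mpow s n) w).
Proof.
elim: n => [|n IHn]; first by rewrite extend_mpow0.
move=> /IHn; rewrite extend_mpowS; elim: (extend _ w) => // c v IHv.
rewrite -cat1s has_cat has_seq1 negb_or extend_cat extend1 has_cat negb_or => /andP[gc /IHv ->]; rewrite andbT.
by apply: contra gc => /hasP[d dc gd]; apply: growing_mem dc gd.
Qed.

Definition top n := \max_c size (mpow s n c).

Lemma top_ge n c : size (mpow s n c) <= top n.
Proof. exact: (leq_bigmax c). Qed.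

Lemma top_mono n : top n <= top n.+1.
Proof.
apply/bigmax_leqP => c _; apply: leq_trans (top_ge n.+1 c).
by have := leq_size_mpow sne [:: c] (leqnSn n); rewrite !extend1.
Qed.

Definition small (S : {set A}) k n := forall d, d \in S -> k * size (mpow s n d) <= top n.

Lemma smallW S k k' n : k <= k' -> small S k' n -> small S k n.
Proof. by move=> le sm d dS; apply: leq_trans (sm d dS); rewrite leq_mul2r le orbT. Qed.

Lemma small_shift S k n : small S (k * sigma_max s) n -> small S k n.+1.
Proof.
move=> sm d dS; apply: leq_trans (top_mono n); apply: leq_trans (sm d dS).
have := size_mpow_add s n 1 [:: d]; rewrite expn1 !extend1 addn1 -mulnA => le.
by rewrite leq_mul2l le orbT.
Qed.

Lemma small_word S k n w : small S k n -> all (mem S) w -> k * size (extend (mpow s n) w) <= size w * top n.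
Proof.
move=> sm; elim: w => [|c w IHw] /=; first by rewrite muln0.
by move=> /andP[/sm le /IHw le2]; rewrite extend_cons size_cat mulnDr mulSn leq_add.
Qed.

(* [S] is a maximal set of letters that are simultaneously negligible with     *)
(* respect to [top n] for infinitely many [n]; the other letters are then      *)
(* comparable with [top n] for those [n].                                      *)
Lemma maximal_small : exists S kst nst, [/\ 0 < kst,
  forall k n0, exists2 n, n0 <= n & small S k n &
  forall n, nst <= n -> small S kst n -> forall c, c \notin S -> top n < kst * size (mpow s n c)].
Proof.
pose good (S : {set A}) := forall k n0, exists2 n, n0 <= n & small S k n.
have good0 : `[< good set0 >] by apply/asboolP => k n0; exists n0 => // d; rewrite inE.
have [S /asboolP gS maxS] := @arg_maxnP _ set0 (fun S => `[< good S >]) (fun S => #|S|) good0.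
have ex c : exists kn : nat * nat, c \notin S -> forall n, kn.2 <= n -> small S kn.1 n ->
    top n < kn.1 * size (mpow s n c).
  have [cS|cS] := boolP (c \in S); first by exists (0, 0).
  have : ~ good (c |: S).
    move=> /asboolP /maxS; rewrite cardsU1 cS /=; lia.
  move=> /existsNP[k /existsNP[n0 no]]; exists (k, n0) => _ n le sm /=.
  rewrite ltnNge; apply/negP => le2; apply: no; exists n => // d.
  by rewrite !inE => /orP[/eqP->|/sm].
pose kn c := projT1 (cid (ex c)).
exists S, (\max_c (kn c).1).+1, (\max_c (kn c).2); split=> // n len sm c cS.
have le1 : (kn c).1 <= \max_c (kn c).1 by apply: (leq_bigmax c).
have le2 : (kn c).2 <= \max_c (kn c).2 by apply: (leq_bigmax c).
apply: leq_trans (_ : _ <= (kn c).1 * size (mpow s n c)) _; last by rewrite leq_mul2r (leqW le1) orbT.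
have : forall n, (kn c).2 <= n -> small S (kn c).1 n -> top n < (kn c).1 * size (mpow s n c).
  by rewrite /kn; case: cid => p /= /(_ cS).
by apply; [apply: leq_trans len | apply: smallW sm; apply: leqW].
Qed.

Variable K : nat.
Hypothesis LR : forall w, factor y w -> w <> [::] -> window y w (K * size w).

Section Maximal.
Variables (S : {set A}) (kst nst : nat).
Hypotheses (k0 : 0 < kst) (inf : forall k n0, exists2 n, n0 <= n & small S k n).
Hypothesis big : forall n, nst <= n -> small S kst n -> forall c, c \notin S -> top n < kst * size (mpow s n c).
Let kap := sigma_max s.

Let kap0 : 0 < kap. Proof. exact: sigma_max_gt0 sne (x 0). Qed.

(** Passing to a child costs a factor at most [kap], which the arbitrary constant in [inf]
    absorbs. *)
Lemma small_closed c d : c \in S -> d \in s c -> d \in S.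
Proof.
move=> cS dc; apply/negPn/negP => dS.
have [n le sm] := inf (kst * kap) nst.
have := big le (smallW (leq_pmulr _ kap0) sm) dS; rewrite ltnNge => /negP[].
apply: leq_trans (sm c cS); rewrite -mulnA leq_mul2l; apply/orP; right.
have dm : d \in mpow s 1 c by rewrite mpow1.
apply: leq_trans (@mem_mpow_size _ s _ _ n _ dm) _.
by have := size_mpow_add s n 1 [:: c]; rewrite expn1 !extend1.
Qed.

Lemma small_closed_word k w : all (mem S) w -> all (mem S) (extend (mpow s k) w).
Proof.
elim: k => [|k IHk]; first by rewrite extend_mpow0.
move=> /IHk; rewrite extend_mpowS; elim: (extend _ w) => // c v IHv /= /andP[cS /IHv aS].
rewrite extend_cons all_cat aS andbT; apply/allP => d dc; exact: small_closed cS dc.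
Qed.

(** If all children lay in [S], then [c] would be negligible one level later, as [top] does not
    decrease. *)
Lemma big_image c : c \notin S -> has (fun d => d \notin S) (s c).
Proof.
move=> cS; apply: contraT; rewrite -all_predC => aS.
have {}aS : all (mem S) (s c) by apply: sub_all aS => d /=; rewrite negbK.
have [n le sm] := inf (kst * kap * kap) nst.
have smS : small S kst n.+1 by apply: (smallW (leq_pmulr _ kap0)); apply: small_shift.
have := big (leqW le) smS cS; rewrite ltnNge => /negP[].
apply: leq_trans (top_mono n); rewrite mpowSr.
have := small_word (smallW (leq_pmulr _ kap0) sm) aS => le2.
have le3 : size (s c) * top n <= kap * top n by rewrite leq_mul2r; apply/orP; right; apply: (leq_bigmax c).
have := leq_trans le2 le3; rewrite mulnAC mulnC leq_pmul2l //.
Qed.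

Lemma big_mpow k c : c \notin S -> has (fun d => d \notin S) (mpow s k c).
Proof.
elim: k c => [|k IHk] c cS; first by rewrite /= cS.
have /hasP[d dc dS] := big_image cS; have /hasP[e ed eS] := IHk d dS.
apply/hasP; exists e => //; rewrite -addn1; apply: mem_mpow_trans ed; by rewrite mpow1.
Qed.

Lemma first_big : x 0 \notin S.
Proof.
apply/negP => x0S.
have allS c : c \in S.
  have [k [u [v e]]] := factor_in_mpow imx grow0 (letter_factor allx c).
  have aS : all (mem S) (mpow s k (x 0)).
    by rewrite -[mpow _ _ _]extend1; apply: small_closed_word; rewrite /= x0S.
  by move/allP: aS; apply; rewrite e mem_cat mem_head orbT.
have [n _ sm] := inf 2 0.
have [c e] : exists c, top n = size (mpow s n c).
  have A0 : 0 < #|A| by apply/card_gt0P; exists (x 0).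
  by have [c e] := @eq_bigmax A (fun c => size (mpow s n c)) A0; exists c.
by have := sm c (allS c); have := mpow_gt0 sne n c; rewrite e; lia.
Qed.

(** Let [x j] be the last letter outside [S]. Its image contains such a letter at a position at
    least [j], hence exactly at [j], and growth of [x 0] forces [j = 0]: [s (x 0) = x 0 :: v] with
    [v] over [S]. By doubling, [W_n(x 0)] is then bounded by a constant plus a multiple of
    [sigma^n(v)] in size, so [x 0] would be negligible. *)
Lemma big_infinite i : exists2 j, i <= j & x j \notin S.
Proof.
apply: contrapT => no.
have [j bj maxj] : exists2 j, x j \notin S & forall m, j < m -> ~ x m \notin S.
  apply: (@ex_greatest (fun m => x m \notin S) i); first by exists 0; apply: first_big.
  move=> m bm; case: (leqP m i) => // /ltnW le; case: no; by exists m.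
have cutj : j <= cut s x j by have := size_extend_ge (mkseq x j) sne; rewrite size_mkseq.
have sxE := img_letter j imx.
have [u [d [v [sE dS _]]]] := split_first (big_image bj).
have xd : x (cut s x j + size u) = d.
  have sz : size u < size (s (x j)) by rewrite sE size_cat /=; lia.
  by have := congr1 (fun w => nth d w (size u)) sxE; rewrite nth_seg // => <-; rewrite sE nth_cat ltnn subnn.
have [u0 cj] : size u = 0 /\ cut s x j = j.
  have : ~ j < cut s x j + size u by move=> /maxj; rewrite xd.
  by move/negP; rewrite -leqNgt; lia.
have j0 : j = 0.
  apply/eqP; rewrite -leqn0 leqNgt; apply/negP => jp.
  have fixp n : extend (mpow s n) (mkseq x j) = mkseq x j.
    elim: n => [|n IHn]; first by rewrite extend_mpow0.
    by rewrite extend_mpowS IHn; rewrite {1}(occursE (imx.1 j)) -/(cut s x j) cj.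
  have [n Hn] := grow0 j.+1; have := congr1 size (fixp n); rewrite size_mkseq.
  rewrite mkseq_seg -(subnKC jp) segD extend_cat size_cat /seg /mkseq /= extend1 -/(mpow s n (x 0)).
  by rewrite subnKC // -[x (0 + 0)]/(x 0); lia.
rewrite j0 in sxE sE bj maxj xd cj; rewrite (size0nil u0) /= in sE xd.
rewrite addn0 cut0 in xd.
have vS : all (mem S) v.
  have vE : v = seg x 1 (size v).
    move: sxE; rewrite sE cut0 /= -[(size v).+1]add1n segD => -[_]; by [].
  rewrite vE; apply/allP => e /mapP[l _ ->] /=; apply/negPn/negP; apply: maxj; lia.
have sx0 : s (x 0) = x 0 :: v by rewrite sE xd.
have [rho runs] := bounded_runs imx imy sne fne allx grow0 ur aper.
have gv : has gro v.
  apply: contraT => nv.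
  have cnt n : count gro (mpow s n (x 0)) <= 1.
    elim: n => [|n IHn]; first by rewrite /= addn0; case: gro.
    rewrite mpowSr sx0 extend_cons count_cat; have := bounded_mpow n nv.
    by rewrite has_count -leqNgt leqn0 => /eqP->; rewrite addn0.
  have [n Hn] := grow0 (rho.+1 * 2).+1.
  have : size (mpow s n (x 0)) <= rho.+1 * (count gro (mpow s n (x 0))).+1.
    apply: size_by_count => u1 v1 v2 e; apply: runs; apply: (@factor_infix _ x u1 v1 v2).
    by rewrite -e; exists 0; apply: prefix_mpow.
  move=> le; have := leq_trans Hn le; rewrite ltn_mul2l => /andP[_]; have := cnt n; lia.
have fv : factor x v.
  by apply: (@factor_infix _ x [:: x 0] v [::]); rewrite cats0 /= -sx0 -[s _]extend1 -extend_mpow1; apply: (factor_mpow imx); apply: letter_factor.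
have [e e0 dbl] := doubling imx imy sne fne allx grow0 ur aper.
(* The constant and the multiple of [sigma^n(v)], both multiplied by [kst], are each made at most
   half of [top n]; hence the factors [2] below. *)
pose M0 := \max_c size (f c); pose C := kst * (e * (M0 * kap ^ e)).
have [n1 Hn1] := grow0 (2 * (kst * size (f (x 0)))).
have [n le sm] := inf (maxn kst (2 * C * size v)) (maxn nst n1).
have topn : 2 * (kst * size (f (x 0))) <= top n.
  apply: leq_trans (top_ge n (x 0)); apply: leq_trans Hn1 _.
  by have := leq_size_mpow sne [:: x 0] (leq_trans (leq_maxr nst n1) le); rewrite !extend1.
have := big (leq_trans (leq_maxl nst n1) le) (smallW (leq_maxl _ _) sm) bj.
have vp : 0 < size v by case: (v) gv.
have lev : 2 * C * size (extend (mpow s n) v) <= top n.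
  have := small_word (smallW (leq_maxr _ _) sm) vS; rewrite mulnAC mulnC leq_pmul2l //.
have leW : size (mpow s n (x 0)) <= size (f (x 0)) + e * (M0 * kap ^ e) * size (extend (mpow s n) v).
  apply: leq_trans (size_extend_ge _ fne) _; rewrite -[size _]/(size (W n (x 0))) (size_wpow_fix f sx0) leq_add2l.
  rewrite -(big_mkord xpredT (fun i => size (extend (W i) v))).
  apply: leq_trans (@doubling_sum (fun i => size (extend (W i) v)) e n e0 (fun k => dbl v k fv gv)) _.
  apply: leq_trans (_ : \sum_(n <= k < n + e) M0 * kap ^ e * size (extend (mpow s n) v) <= _); last first.
    by rewrite sum_nat_const_nat addKn mulnA.
  rewrite big_nat_cond [X in _ <= X]big_nat_cond; apply: leq_sum => k /andP[/andP[le1 le2] _].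
  rewrite extend_wpow; apply: leq_trans (size_extend_le _ (fun c => leq_bigmax c)) _.
  rewrite -mulnA leq_mul2l; apply/orP; right.
  have -> : k = n + (k - n) by lia.
  apply: leq_trans (size_mpow_add _ _ _ _) _; rewrite leq_mul2r; apply/orP; right.
  apply: leq_pexp2l => //; lia.
move: lev leW topn; rewrite /C.
set X := size (extend _ _); set E := e * _; set m := size (mpow _ _ _); set F := top n; set q := size (f _).
nia.
Qed.

(** Such factors survive under [sigma]: between the last letter outside [S] in the image of [g] and
    the first one in that of [g'] there is again a pattern, with a longer middle part
    ([pattern_next]). *)
Definition pattern (p : A * seq A * A) := let: (g, T, g') := p in
  [/\ factor x (g :: rcons T g'), g \notin S, g' \notin S, all (mem S) T & has gro T].

Lemma pattern_next k p : pattern p -> exists2 p', pattern p' &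
  exists u v, p'.1.2 = u ++ extend (mpow s k) p.1.2 ++ v.
Proof.
case: p => [[g T] g'] [fp gS gS' TS gT].
have [u1 [h [u2 [e1 hS u2S]]]] := split_last (big_mpow k gS).
have [v1 [h' [v2 [e2 hS' v1S]]]] := split_first (big_mpow k gS').
have neg w : all (predC (fun d => d \notin S)) w -> all (mem S) w by apply: sub_all => d /=; rewrite negbK.
exists (h, u2 ++ extend (mpow s k) T ++ v1, h'); last by exists u2, v1.
split=> //; last by rewrite !has_cat (has_growing_mpow _ gT) orbT.
  apply: (@factor_infix _ x u1 _ v2); have := factor_mpow imx k fp.
  by rewrite extend_cons -cats1 extend_cat extend1 e1 e2 -!cats1 -!catA /= -!catA.
by rewrite !all_cat (neg _ u2S) (neg _ v1S) small_closed_word.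
Qed.

(** A growing letter of [S] lies between two letters outside [S], hence in a pattern, and
    [pattern_next] gives infinitely many patterns with the same ends [g], [g']. At a level where
    enough of the middle parts are negligible, the images have size of order [top n] and share the
    long ends [W n g] and [W n g']. [few_words] bounds their number, yet their lengths are
    distinct. *)
Lemma small_bounded c : c \in S -> ~~ gro c.
Proof.
move=> cS; apply/negP => gc.
have [e e0 dbl] := doubling imx imy sne fne allx grow0 ur aper.
have [p0 pat0] : exists p, pattern p.
  have [i xi] := allx c.
  have i0 : 0 < i by case: (i) xi => // x0; have := first_big; rewrite x0 cS.
  have [j1 [lt1 b1] mx] := @ex_greatest (fun m => m < i /\ x m \notin S) i
    (ex_intro _ 0 (conj i0 first_big)) (fun m H => ltnW H.1).
  have [j2 [le2 b2] mn] := @ex_least (fun m => i <= m /\ x m \notin S)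
    (let: ex_intro2 j l b := big_infinite i in ex_intro _ j (conj l b)).
  have lt2 : i < j2 by rewrite ltn_neqAle le2 andbT; apply/eqP => ij; move: b2; rewrite -ij xi cS.
  exists (x j1, seg x j1.+1 (j2 - j1.+1), x j2); split=> //.
  - have -> : x j1 :: rcons (seg x j1.+1 (j2 - j1.+1)) (x j2) = seg x j1 (1 + ((j2 - j1.+1) + 1)).
      rewrite segD segD /seg /mkseq /= !addn0 addn1 -cats1; congr (_ :: (_ ++ [:: x _])); lia.
    exact: factor_seg.
  - apply/allP => d /mapP[l]; rewrite mem_iota add0n => /andP[_ ltl] -> /=.
    apply/negPn/negP => bl; case: (ltnP (j1.+1 + l) i) => li; first by apply: (mx (j1.+1 + l)) => //; lia.
    by apply: (mn (j1.+1 + l)) => //; lia.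
  - apply/hasP; exists c => //; apply/mapP; exists (i - j1.+1); first by rewrite mem_iota; lia.
    by rewrite -xi; congr x; lia.
(* Steps of length [e] from [doubling] make the images of the middle parts strictly longer at every
   level. *)
pose nxt (p : {p | pattern p}) : {p | pattern p} :=
  let h := cid2 (pattern_next e (projT2 p)) in exist _ (s2val h) (s2valP h).
have nxtP (p : {p | pattern p}) : exists u v, (sval (nxt p)).1.2 = u ++ extend (mpow s e) (sval p).1.2 ++ v.
  by rewrite /nxt /=; case: cid2.
pose P i := sval (iter i nxt (exist _ p0 pat0)).
pose T i := (P i).1.2.
have patP i : pattern (P i) := svalP (iter i nxt (exist _ p0 pat0)).
have fT i : factor x (T i).
  have := patP i; rewrite /T; case: (P i) => [[g t] g'] [fp _ _ _ _] /=.
  by apply: (@factor_infix _ x [:: g] t [:: g']); rewrite cats1.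
have gT i : has gro (T i) by have := patP i; rewrite /T; case: (P i) => [[g t] g'] [].
have TS i : all (mem S) (T i) by have := patP i; rewrite /T; case: (P i) => [[g t] g'] [].
have inc k i j : i < j -> size (extend (W k) (T i)) < size (extend (W k) (T j)).
  have step l : size (extend (W k) (T l)) < size (extend (W k) (T l.+1)).
    have [u [v E]] := nxtP (iter l nxt (exist _ p0 pat0)); rewrite {2}/T {1}/P iterS E !extend_cat !size_cat.
    have := dbl (T l) k (fT l) (gT l); rewrite extend_wpowD -/(T l).
    have : 0 < size (extend (W k) (T l)).
      have := gT l; case: (T l) => // d t _; rewrite extend_cons size_cat ltn_addr //.
      have := size_extend_ge (mpow s k d) fne; have := mpow_gt0 sne k d; rewrite /wpow; lia.
    by rewrite /T; lia.
  by elim: j => // j IHj; rewrite ltnS leq_eqVlt => /orP[/eqP->|/IHj lt] //; apply: ltn_trans lt _.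
have [[g g'] Hg] := @pigeonhole_inf _ (fun=> True) (fun i => ((P i).1.1, (P i).2)) (fun n => ex_intro2 _ _ n (leqnn n) I).
pose M0 := \max_c size (f c).
have [k Hk] := few_words aper LR (3 * M0 * kst).
have [idx idxP] : exists idx : nat -> nat, forall i, (P (idx i)).1.1 = g /\ (P (idx i)).2 = g' /\ idx i < idx i.+1.
  pose m n := s2val (cid2 (Hg n)).
  have mP n : n <= m n /\ (P (m n)).1.1 = g /\ (P (m n)).2 = g'.
    by rewrite /m; case: cid2 => i /= le [_ [-> ->]].
  exists (fun i => iter i (fun l => m l.+1) (m 0)) => i; split; [|split].
  - by case: i => [|i] /=; [apply: (mP 0).2.1 | apply: (mP _).2.1].
  - by case: i => [|i] /=; [apply: (mP 0).2.2 | apply: (mP _).2.2].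
  - by rewrite iterS; apply: (mP _).1.
have idx_inc i j : i < j -> idx i < idx j.
  by elim: j => // j IHj; rewrite ltnS leq_eqVlt => /orP[/eqP->|/IHj lt]; [have [_ []] := idxP j | apply: ltn_trans lt _; have [_ []] := idxP j].
pose Nw := (k * k).+1.
(* Smallness by a factor at least the number of letters of each [T (idx i)] keeps the image of the
   whole word below [top n]. *)
pose bigk := maxn kst (\max_(i < Nw) size (T (idx i))).
have [n le sm] := inf bigk nst.
have bign := big le (smallW (leq_maxl _ _) sm).
pose D := (top n %/ kst).+1.
have Dle d : d \notin S -> D <= size (W n d).
  move=> dS; apply: leq_trans (size_extend_ge _ fne); have := bign d dS.
  by rewrite /D mulnC -ltn_divLR.
have gS : g \notin S by have := patP (idx 0); have [<- _] := idxP 0; case: (P _) => [[? ?] ?] [].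
have gS' : g' \notin S by have := patP (idx 0); have [_ [<- _]] := idxP 0; case: (P _) => [[? ?] ?] [].
have [code Hc] := Hk D (W n g) (W n g') isT (Dle g gS) (Dle g' gS').
pose w (i : nat) := W n g ++ extend (W n) (T (idx i)) ++ W n g'.
have topD : top n <= kst * D by rewrite /D mulnS; have := divn_eq (top n) kst; have := @ltn_pmod (top n) kst k0; lia.
have wP l : l < Nw -> [/\ factor y (w l), size (w l) <= 3 * M0 * kst * D,
    exists z, w l = W n g ++ z & exists z, w l = z ++ W n g'].
  move=> ltl; have leM v : size (extend (W n) v) <= M0 * size (extend (mpow s n) v).
    by rewrite extend_wpow; apply: size_extend_le => d; apply: (leq_bigmax d).
  split; [|..|by eexists|by rewrite /w catA; eexists].
    have := patP (idx l); have [] := idxP l; rewrite /w /T; case: (P _) => [[a1 t] a2] /= -> [-> _] [fp _ _ _ _].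
    by have := factor_wpow imx imy n fp; rewrite extend_cons -cats1 extend_cat extend1.
  have lt1 : size (extend (mpow s n) (T (idx l))) <= top n.
    have lel : size (T (idx l)) <= bigk.
      by apply: leq_trans (leq_maxr _ _); apply: (@leq_bigmax _ (fun i : 'I_Nw => size (T (idx i))) (Ordinal ltl)).
    have := small_word (smallW lel sm) (TS (idx l)); rewrite leq_pmul2l //.
    by case: (T _) (gT (idx l)).
  have le1 := leM [:: g]; have le2 := leM [:: g']; have le3 := leM (T (idx l)); rewrite !extend1 in le1 le2.
  have t1 := top_ge n g; have t2 := top_ge n g'.
  have M1 := leq_mul (leqnn M0) t1; have M2 := leq_mul (leqnn M0) t2; have M3 := leq_mul (leqnn M0) lt1.
  have M4 := leq_mul (leqnn (3 * M0)) topD.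
  apply: leq_trans (_ : 3 * M0 * top n <= _); last by rewrite -(mulnA (3 * M0)).
  rewrite /w !size_cat -mulnA; lia.
have inj : injective (fun i : 'I_Nw => code (w i)).
  move=> i j /Hc e1; have ew : w i = w j by apply: e1 => v [] ->; apply: wP.
  have e2 : size (extend (W n) (T (idx i))) = size (extend (W n) (T (idx j))).
    by have := congr1 size ew; rewrite /w !size_cat => /eqP; rewrite eqn_add2l eqn_add2r => /eqP.
  apply: ord_inj; case: (ltngtP i j) => // /idx_inc /(inc n); by rewrite e2 ltnn.
by have := leq_card _ inj; rewrite card_ord card_prod !card_ord /Nw ltnn.
Qed.
End Maximal.

Lemma comparable_growth : exists2 k, 0 < k & forall n0, exists2 n, n0 <= n &
  forall c g, gro g -> size (mpow s n c) <= k * size (mpow s n g).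
Proof.
have [S [kst [nst [k0 inf big]]]] := maximal_small.
exists kst => // n0; have [n le sm] := inf kst (maxn nst n0).
exists n => [|c g gg]; first exact: leq_trans (leq_maxr _ _) le.
have gS : g \notin S by apply: contraL gg => gS; apply: (small_bounded k0 inf big gS).
apply: leq_trans (top_ge n c) _; apply: ltnW.
by apply: big => //; apply: leq_trans (leq_maxl _ _) le.
Qed.
End Comparable.

(** * Return words *)

Lemma map_iota_shift T (g : nat -> T) a r : map g (iota a r) = [seq g (a + k) | k <- iota 0 r].
Proof. by rewrite -{1}[a]addn0 iotaDl -map_comp. Qed.

Section ReturnTimes.
Variables (B : Type) (y : nat -> B) (l : nat).
Let u := seg y 0 l.
Hypothesis rec : forall i, exists2 j, i <= j & occurs y u j.

Lemma next_ex i : exists2 j, (i < j /\ occurs y u j) & forall m, m < j -> ~ (i < m /\ occurs y u m).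
Proof. by apply: ex_least; have [j le o] := rec i.+1; exists j. Qed.

Definition next i := s2val (cid2 (next_ex i)).
Lemma nextP i : [/\ i < next i, occurs y u (next i) & forall m, i < m < next i -> ~ occurs y u m].
Proof.
rewrite /next; case: cid2 => j /= [lt o] min; split=> // m /andP[lt1 lt2] om.
exact: (min m lt2).
Qed.

Definition ot k := iter k next 0.

Lemma ot0 : ot 0 = 0. Proof. by []. Qed.
Lemma otS k : ot k.+1 = next (ot k). Proof. by []. Qed.
Lemma ot_occurs k : occurs y u (ot k).
Proof. by case: k => [|k]; [apply: occurs_seg | have [] := nextP (ot k)]. Qed.
Lemma ot_lt k : ot k < ot k.+1. Proof. by have [] := nextP (ot k). Qed.
Lemma ot_ge k : k <= ot k.
Proof. by elim: k => // k IHk; apply: leq_ltn_trans IHk (ot_lt k). Qed.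
Lemma ot_mono j k : j <= k -> ot j <= ot k.
Proof. by move=> /subnKC <-; elim: (k - j) => [|m IHm]; rewrite ?addn0 // addnS; apply: leq_trans IHm (ltnW (ot_lt _)). Qed.
Lemma ot_mono_lt j k : j < k -> ot j < ot k.
Proof. by move=> lt; apply: leq_trans (ot_lt j) (ot_mono lt). Qed.
Lemma ot_lt_inv j k : ot j < ot k -> j < k.
Proof. by rewrite !ltnNge; apply: contra; apply: ot_mono. Qed.

Lemma ot_ex i : occurs y u i -> exists k, i = ot k.
Proof.
move=> o; have [k le mx] : exists2 k, ot k <= i & forall m, k < m -> ~ ot m <= i.
  by apply: (@ex_greatest (fun k => ot k <= i) i); [exists 0 | move=> k le; apply: leq_trans (ot_ge k) le].
exists k; apply/eqP; rewrite eqn_leq le andbT leqNgt; apply/negP => lt.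
have [_ _ no] := nextP (ot k); apply: (no i) => //; rewrite lt -otS ltnNge.
by apply/negP; apply: mx.
Qed.

(* The number of complete occurrences of [u] after the [k]th one inside the    *)
(* window of length [m] starting there.                                        *)
Lemma cnt_ex k m : exists2 r, (r = 0 \/ ot (k + r) + l <= ot k + m) &
  forall r', r < r' -> ~ (r' = 0 \/ ot (k + r') + l <= ot k + m).
Proof.
apply: (@ex_greatest (fun r => r = 0 \/ ot (k + r) + l <= ot k + m) m); first by exists 0; left.
move=> r [->|le] //; have : ot k + r <= ot (k + r); last by lia.
by elim: (r) => [|r' IH]; rewrite ?addn0 // !addnS; apply: leq_ltn_trans IH (ot_lt _).
Qed.
Definition cnt k m := s2val (cid2 (cnt_ex k m)).
Lemma cntP k m : cnt k m = 0 \/ ot (k + cnt k m) + l <= ot k + m.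
Proof. by rewrite /cnt; case: cid2. Qed.
Lemma cnt_max k m r : ot (k + r) + l <= ot k + m -> r <= cnt k m.
Proof.
rewrite /cnt; case: cid2 => r' /= _ mx le; rewrite leqNgt; apply/negP => lt.
by apply: (mx r lt); right.
Qed.
Lemma cnt_next k m : ot k + m < ot (k + cnt k m).+1 + l.
Proof.
by rewrite ltnNge -addnS; apply/negP => /cnt_max; rewrite ltnn.
Qed.

Lemma cnt_add k m m' : m <= m' ->
  cnt k m' = cnt k m + cnt (k + cnt k m) (ot k + m' - ot (k + cnt k m)).
Proof.
move=> le; set k1 := k + cnt k m.
have le1 : ot k1 <= ot k + m'.
  by rewrite /k1; case: (cntP k m) => [->|]; rewrite ?addn0; lia.
have E : ot k1 + (ot k + m' - ot k1) = ot k + m' by lia.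
apply/eqP; rewrite eqn_leq; apply/andP; split.
  case: (leqP (cnt k m') (cnt k m)) => [le2|/ltnW le2]; first by apply: leq_trans le2 (leq_addr _ _).
  rewrite -(subnKC le2) leq_add2l; case: (cntP k m') => [c0|H]; first by rewrite c0.
  by apply: cnt_max; rewrite E /k1 -addnA subnKC.
case: (cntP k1 (ot k + m' - ot k1)) => [->|H].
  rewrite addn0; case: (cntP k m) => [->|H2] //; apply: cnt_max; lia.
by apply: cnt_max; rewrite addnA -/k1 -[X in _ <= X]E.
Qed.

Lemma occurs_same i i' e m : seg y i m = seg y i' m -> e + l <= m -> occurs y u (i + e) -> occurs y u (i' + e).
Proof.
move=> E le o; have := occursE o; rewrite size_seg => ->.
suff -> : seg y (i + e) l = seg y (i' + e) l by apply: occurs_seg.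
apply: seg_eq => k lt; rewrite -!addnA; apply: eq_seg E _; lia.
Qed.

Lemma ot_same k k' m r : seg y (ot k) m = seg y (ot k') m -> ot (k + r) + l <= ot k + m ->
  ot (k' + r) = ot k' + (ot (k + r) - ot k).
Proof.
move=> E; elim: r => [|r IHr]; first by rewrite !addn0; lia.
rewrite !addnS => le; have lt := ot_lt (k + r); have IH := IHr (leq_trans (leq_add (ltnW lt) (leqnn l)) le).
have ge : ot k <= ot (k + r) by apply: ot_mono; apply: leq_addr.
set d := ot (k + r).+1 - ot k; set d0 := ot (k + r) - ot k in IH.
have o' : occurs y u (ot k' + d).
  apply: (occurs_same E); first by rewrite /d; lia.
  by have := ot_occurs (k + r).+1; congr occurs; rewrite /d; lia.
have [_ _ no] := nextP (ot (k + r)); have [lt' on' no'] := nextP (ot (k' + r)).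
apply/eqP; rewrite eqn_leq otS; apply/andP; split; rewrite leqNgt; apply/negP => lt2.
  by apply: (no' _ _ o'); rewrite lt2 andbT IH /d /d0; lia.
apply: (no (ot k + (next (ot (k' + r)) - ot k'))).
  by move: lt2 lt'; rewrite IH -otS /d /d0; lia.
apply: (occurs_same (esym E)); first by move: lt2; rewrite /d; lia.
by move: on'; congr occurs; move: lt'; rewrite IH; lia.
Qed.

Lemma cnt_same k k' m : seg y (ot k) m = seg y (ot k') m -> cnt k m = cnt k' m.
Proof.
have key a b : seg y (ot a) m = seg y (ot b) m -> cnt a m <= cnt b m.
  move=> E; case: (cntP a m) => [-> //|H]; apply: cnt_max; rewrite (ot_same E H).
  have : ot a <= ot (a + cnt a m) by apply: ot_mono; apply: leq_addr.
  lia.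
by move=> E; apply/eqP; rewrite eqn_leq !key.
Qed.

Definition ret k := seg y (ot k) (ot k.+1 - ot k).

Lemma ret_same k k' m r : seg y (ot k) m = seg y (ot k') m -> ot (k + r).+1 + l <= ot k + m ->
  ret (k + r) = ret (k' + r).
Proof.
move=> E le; rewrite /ret -!addnS.
have le0 : ot (k + r) + l <= ot k + m by have := ot_lt (k + r); lia.
have e1 := ot_same E le0; have e2 := ot_same (r := r.+1) E; rewrite addnS in e2; have {}e2 := e2 le.
have ge : ot k <= ot (k + r) by apply: ot_mono; apply: leq_addr.
have lt := ot_lt (k + r); rewrite addnS e1 e2.
have -> : ot k' + (ot (k + r).+1 - ot k) - (ot k' + (ot (k + r) - ot k)) = ot (k + r).+1 - ot (k + r) by lia.
apply: seg_eq => i lti; have := eq_seg (k := ot (k + r) - ot k + i) E; case/(_ _)/Wrap; first by lia.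
by rewrite !addnA subnKC.
Qed.

Lemma ret_follow k : seg y (ot k) (ot k.+1 - ot k + l) = ret k ++ u.
Proof.
rewrite segD subnKC ?(ltnW (ot_lt k)) //; congr (_ ++ _).
by have e := occursE (ot_occurs k.+1); rewrite size_seg in e; exact: esym e.
Qed.

Lemma flatten_ret k r : flatten [seq ret i | i <- iota k r] = seg y (ot k) (ot (k + r) - ot k).
Proof.
elim: r k => [|r IHr] k; first by rewrite addn0 subnn.
rewrite /= IHr /ret; have lt := ot_lt k; have le : ot k.+1 <= ot (k.+1 + r) by apply: ot_mono; apply: leq_addr.
have {2}-> : ot k.+1 = ot k + (ot k.+1 - ot k) by lia.
by rewrite -segD -addSnnS; congr seg; lia.
Qed.

Lemma ot_inj j k : ot j = ot k -> j = k.
Proof. by move=> e; case: (ltngtP j k) => // /ot_mono_lt; rewrite e ltnn. Qed.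

Lemma cnt_from k0 P : ot k0 <= P -> k0 <= cnt 0 P -> cnt 0 P = k0 + cnt k0 (P - ot k0).
Proof.
move=> leP lek; have E : ot k0 + (P - ot k0) = P by rewrite subnKC.
apply/eqP; rewrite eqn_leq; apply/andP; split.
  rewrite -{1}(subnKC lek) leq_add2l; case: (cntP 0 P) => [c0|H]; first by rewrite c0.
  by apply: cnt_max; rewrite E subnKC.
by case: (cntP k0 (P - ot k0)) => [->|H]; [rewrite addn0 | apply: cnt_max; rewrite E in H].
Qed.

Lemma cnt_mono P P' : P <= P' -> cnt 0 P <= cnt 0 P'.
Proof. by move=> /(cnt_add 0) ->; apply: leq_addr. Qed.

Lemma ot_cnt P : ot (cnt 0 P) <= P.
Proof. by case: (cntP 0 P) => [->|] //=; rewrite add0n; lia. Qed.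

(** Only occurrences of [u] that end inside the window are used, and these can be read off its
    text. *)
Lemma window_same a b m : seg y (ot a) m = seg y (ot b) m -> [/\ cnt a m = cnt b m,
  forall r, r < cnt a m -> ret (a + r) = ret (b + r) &
  seg y (ot (a + cnt a m)) (ot a + m - ot (a + cnt a m)) = seg y (ot (b + cnt b m)) (ot b + m - ot (b + cnt b m))].
Proof.
move=> E; have Ec := cnt_same E; split=> // [r lt|].
  apply: (ret_same E); case: (cntP a m) => [c0|H]; first by rewrite c0 in lt.
  by have := ot_mono (_ : (a + r).+1 <= a + cnt a m); rewrite -addnS leq_add2l => /(_ lt); lia.
rewrite -Ec; have [e|H] := cntP a m; first by rewrite e !addn0 !addKn.
have oE := ot_same E H; have ge : ot a <= ot (a + cnt a m) by apply: ot_mono; apply: leq_addr.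
rewrite oE; have -> : ot b + m - (ot b + (ot (a + cnt a m) - ot a)) = ot a + m - ot (a + cnt a m) by lia.
apply: seg_eq => i lti; have := eq_seg (k := ot (a + cnt a m) - ot a + i) E; case/(_ _)/Wrap; first by lia.
by rewrite !addnA subnKC.
Qed.
End ReturnTimes.

(** * Certificates from two levels with the same transitions *)

Section LevelCertificate.
Variables (A : finType) (B : Type) (s : A -> seq A) (f : A -> seq B).
Variables (x : nat -> A) (y : nat -> B).
Hypotheses (imx : img s x x) (imy : img f x y) (ur : uniformly_recurrent y).
Local Notation W := (wpow s f).

Lemma prefix_recurrent l i : exists2 j, i <= j & occurs y (seg y 0 l) j.
Proof. by have [L win] := ur_window ur (factor_seg y 0 l); have [j /andP[le _] o] := win i; exists j. Qed.

Local Notation o l := (ot (prefix_recurrent l)).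
Local Notation rt l := (ret (prefix_recurrent l)).
Local Notation ct l := (cnt (prefix_recurrent l)).

(** Only occurrences read entirely before the cut are counted. The transducer then works without
    look-ahead: the pending text and the next letter determine its move ([pending_det]). *)
Definition kappa n l j := ct l 0 (cut (W n) x j).
Definition pending n l j := seg y (o l (kappa n l j)) (cut (W n) x j - o l (kappa n l j)).

Lemma kappa_mono n l i j : i <= j -> kappa n l i <= kappa n l j.
Proof. by move=> le; apply: cnt_mono; apply: cut_le. Qed.

Lemma kappa_next n l j : kappa n l j.+1 =
  kappa n l j + ct l (kappa n l j) (cut (W n) x j.+1 - o l (kappa n l j)).
Proof.
apply: cnt_from; last exact: kappa_mono.
by apply: leq_trans (ot_cnt _ _) _; apply: cut_le.
Qed.

Lemma pending_cat n l j : pending n l j ++ W n (x j) =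
  seg y (o l (kappa n l j)) (cut (W n) x j.+1 - o l (kappa n l j)).
Proof.
have le := ot_cnt (prefix_recurrent l) (cut (W n) x j); rewrite -/(kappa n l j) in le.
rewrite cutS -addnBAC // segD subnKC //.
by rewrite -(img_letter j (img_wpow n imx imy)).
Qed.

Lemma pending_det n l i j : pending n l i = pending n l j -> x i = x j ->
  [/\ pending n l i.+1 = pending n l j.+1, kappa n l i.+1 - kappa n l i = kappa n l j.+1 - kappa n l j &
    forall r, r < kappa n l i.+1 - kappa n l i -> rt l (kappa n l i + r) = rt l (kappa n l j + r)].
Proof.
move=> ep ex; have := pending_cat n l i; have := pending_cat n l j; rewrite ep ex => -> E.
have sz := congr1 size E; rewrite !size_seg in sz; rewrite sz in E.
have [e1 e2 e3] := window_same (esym E).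
have lei : o l (kappa n l i) <= cut (W n) x i.+1 by apply: leq_trans (ot_cnt _ _) (cut_le _ _ _).
have lej : o l (kappa n l j) <= cut (W n) x j.+1 by apply: leq_trans (ot_cnt _ _) (cut_le _ _ _).
have mj : o l (kappa n l j) + (cut (W n) x i.+1 - o l (kappa n l i)) = cut (W n) x j.+1.
  by rewrite -sz subnKC.
rewrite (subnKC lei) mj in e3.
by rewrite /pending !kappa_next sz !addKn.
Qed.

Lemma kappa_unbounded n l k : exists j, k <= kappa n l j.
Proof.
have [j le] := img_inf (o l k + l) (img_wpow n imx imy); exists j.
by apply: cnt_max; rewrite add0n ot0 add0n.
Qed.

Lemma kappa0 n l : 0 < l -> kappa n l 0 = 0.
Proof. by move=> l0; rewrite /kappa cut0; case: (cntP (prefix_recurrent l) 0 0) => //; rewrite ot0; lia. Qed.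

Lemma pending0 n l : 0 < l -> pending n l 0 = [::].
Proof. by move=> l0; rewrite /pending kappa0. Qed.

Section TwoLevels.
Variables (K B0 : nat).

(* Level [n] of the derivation with the prefix [u] of length [l] of [y]: the    *)
(* gaps between occurrences of [u] are comparable with [D], and the pending     *)
(* words and return words are few.                                             *)
Definition level n l D := [/\ 0 < l, 0 < D & l <= K * D] /\
  [/\ forall j, size (W n (x j)) <= K * D,
      forall k, D <= K * (o l k.+1 - o l k) & forall k, o l k.+1 - o l k <= K * D].

(** Injectivity is asked only on the words that do appear, which is what [few_words] can provide. *)
Definition coded_level n l (cp cr : seq B -> 'I_B0) :=
  (forall i j, cp (pending n l i) = cp (pending n l j) -> pending n l i = pending n l j) /\
  (forall i j, cr (rt l i) = cr (rt l j) -> rt l i = rt l j).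

(** [ord0] is reserved for the empty pending word, since a certificate starts in state [0] with
    nothing pending. *)
Definition state n l (cp : seq B -> 'I_B0) j : 'I_B0.+1 :=
  if nilp (pending n l j) then ord0 else inord (cp (pending n l j)).+1.
Definition label l (cr : seq B -> 'I_B0) k := cr (rt l k).
Definition output n l cr j := [seq label l cr k | k <- iota (kappa n l j) (kappa n l j.+1 - kappa n l j)].

Lemma state_inj n l cp cr i j : coded_level n l cp cr -> state n l cp i = state n l cp j ->
  pending n l i = pending n l j.
Proof.
move=> [cpP _] /(congr1 val); rewrite /state; case: nilP => [-> |ni]; case: nilP => [-> |nj] //=.
- by rewrite inordK // ltnS ltn_ord.
- by rewrite inordK // ltnS ltn_ord.
- by rewrite !inordK ?ltnS ?ltn_ord // => -[/ord_inj /cpP].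
Qed.

Lemma state_det n l cp cr i j : coded_level n l cp cr -> state n l cp i = state n l cp j -> x i = x j ->
  state n l cp i.+1 = state n l cp j.+1 /\ output n l cr i = output n l cr j.
Proof.
move=> cl /(state_inj cl) ep ex; have [e1 e2 e3] := pending_det ep ex.
rewrite /state e1 /output e2; split=> //.
rewrite (map_iota_shift _ (kappa n l i)) (map_iota_shift _ (kappa n l j)).
by apply/eq_in_map => r; rewrite mem_iota add0n -e2 => /andP[_ lt] /=; rewrite /label e3.
Qed.

(** The pending text and the next block together span at most [3 * (K * D)] letters, and consecutive
    occurrences are at least [D / K] apart. *)
Lemma output_size n l D cr j : level n l D -> size (output n l cr j) <= 3 * K * K * K.+1.
Proof.
move=> [[l0 D0 lD] [szW lo hi]]; rewrite size_map size_iota.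
have := kappa_next n l j; set k := kappa n l j; set r := ct l _ _ => ->; rewrite addKn.
have m1 := cnt_next (prefix_recurrent l) 0 (cut (W n) x j); rewrite -/(kappa n l j) add0n -/k ot0 add0n in m1.
have hk := hi k; have lt := ot_lt (prefix_recurrent l) k; have szj := szW j.
have [r0|H] : r = 0 \/ o l (k + r) + l <= o l k + (cut (W n) x j.+1 - o l k) := cntP _ _ _.
  by rewrite r0.
have leo : o l k <= cut (W n) x j.+1 by apply: leq_trans (ot_cnt _ _) (cut_le _ _ _).
rewrite subnKC // cutS in H.
have up : o l (k + r) - o l k <= 3 * (K * D) by lia.
have lor : r * D <= K * (o l (k + r) - o l k).
  elim: (r) => [|q IHq]; first by rewrite mul0n.
  rewrite mulSn addnS; have := lo (k + q); have ltq := ot_lt (prefix_recurrent l) (k + q).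
  have geq : o l k <= o l (k + q) by apply: ot_mono; apply: leq_addr.
  have -> : o l (k + q).+1 - o l k = (o l (k + q).+1 - o l (k + q)) + (o l (k + q) - o l k) by lia.
  by rewrite mulnDr => h; apply: leq_add.
have := leq_trans lor (leq_mul (leqnn K) up).
have -> : K * (3 * (K * D)) = 3 * K * K * D by rewrite !mulnA (mulnC K 3).
rewrite leq_pmul2r // => h; apply: leq_trans h _; exact: leq_pmulr.
Qed.

Lemma level_table n l D cp cr : level n l D -> coded_level n l cp cr ->
  exists tab : {ffun 'I_B0.+1 * A -> 'I_B0.+1 * (3 * K * K * K.+1).-bseq 'I_B0},
    forall j, (tab (state n l cp j, x j)).1 = state n l cp j.+1 /\
      (tab (state n l cp j, x j)).2 = output n l cr j :> seq _.
Proof.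
move=> lv cl.
exists [ffun qc => if pselect (exists j, state n l cp j = qc.1 /\ x j = qc.2) is left h then
  (state n l cp (projT1 (cid h)).+1, insub_bseq _ (output n l cr (projT1 (cid h)))) else (ord0, [bseq])] => j.
rewrite ffunE /=; case: pselect => [h|[]]; last by exists j.
case: cid => i /= [ei ex]; have [-> eo] := state_det cl ei ex; split=> //.
by rewrite -eo; apply: insubdK; apply: (output_size cr i lv).
Qed.

Variables (n l D n' l' D' : nat) (cp cr cp' cr' : seq B -> 'I_B0).
Hypotheses (lv : level n l D) (cl : coded_level n l cp cr).
Hypotheses (lv' : level n' l' D') (cl' : coded_level n' l' cp' cr').
Hypotheses (ltn_n : n < n') (le_l : l <= l').
Hypothesis same : forall j, state n l cp j = state n' l' cp' j /\ output n l cr j = output n' l' cr' j.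
Hypothesis gap2 : forall k, K * D < o l' k.+1 - o l' k.
Hypothesis gapW : forall k m, exists2 i, o l' k <= i < o l' k.+1 & occurs y (rt l m ++ seg y 0 l) i.

Let N := n' - n.
Let J := cut (mpow s N) x.
Let z k : nat := label l cr k.
Let slice a b := [seq z k | k <- iota a (b - a)].

Lemma slice_cat a b c : a <= b -> b <= c -> slice a b ++ slice b c = slice a c.
Proof.
move=> le1 le2; rewrite /slice -map_cat; congr map.
have -> : c - a = (b - a) + (c - b) by lia.
by rewrite iotaD subnKC.
Qed.

Lemma output_slice j : [seq val i | i <- output n l cr j] = slice (kappa n l j) (kappa n l j.+1).
Proof. by rewrite /output -map_comp. Qed.

Lemma same_kappa j : kappa n l j = kappa n' l' j.
Proof.
elim: j => [|j IHj]; first by have [[? _ _] _] := lv; have [[? _ _] _] := lv'; rewrite !kappa0.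
have := congr1 size (same j).2; rewrite !size_map !size_iota -IHj.
have := kappa_mono n l (leqnSn j); have := kappa_mono n' l' (leqnSn j); rewrite -IHj; lia.
Qed.

Lemma flatten_slices i r : flatten [seq [seq val c | c <- output n l cr k] | k <- iota i r] =
  slice (kappa n l i) (kappa n l (i + r)).
Proof.
elim: r i => [|r IHr] i; first by rewrite addn0 /slice subnn.
rewrite [LHS]/= IHr output_slice slice_cat ?addSnnS //; apply: kappa_mono => //.
by rewrite -addSnnS leq_addr.
Qed.

(** Equal outputs at all positions make the labels of the short and of the long return words one and
    the same sequence [z]. A label thus also names a long return word, which is a product of short
    ones: this is the substitution [lam] fixing [z]. *)
Lemma same_label k : z k = label l' cr' k.
Proof.
have [j lt] := kappa_unbounded n l k.+1.
have pre : [seq label l cr i | i <- iota 0 (kappa n l j)] = [seq label l' cr' i | i <- iota 0 (kappa n l j)].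
  have key m o1 : (forall i, o1 i = [seq m c | c <- iota (kappa n l i) (kappa n l i.+1 - kappa n l i)]) ->
      flatten [seq o1 i | i <- iota 0 j] = [seq m c | c <- iota 0 (kappa n l j)] :> seq 'I_B0.
    move=> H; elim: j {lt} => [|j IHj]; first by have [[? _ _] _] := lv; rewrite kappa0.
    rewrite -[in iota 0 _]addn1 iotaD map_cat flatten_cat IHj /= cats0 H -map_cat; congr map.
    by rewrite -{2}[kappa n l j]add0n -iotaD subnKC // kappa_mono.
  rewrite -(key _ (output n l cr)) // -(key _ (output n l cr)) // => i.
  by rewrite (same i).2 /output !same_kappa.
have := congr1 (fun t => nth (label l cr k) t k) pre.
rewrite (nth_map 0) ?size_iota // (nth_map 0) ?size_iota // !nth_iota // add0n => e.
by rewrite /z e.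
Qed.

Lemma sub_index_ex k : exists m, o l' k = o l m.
Proof.
apply: ot_ex; have := ot_occurs (prefix_recurrent l') k.
by rewrite -(subnKC le_l) segD => /occurs_cat[].
Qed.
Let M k := projT1 (cid (sub_index_ex k)).
Lemma MP k : o l' k = o l (M k). Proof. by rewrite /M; case: cid. Qed.
Lemma M_mono j k : j <= k -> M j <= M k.
Proof.
move=> le; rewrite leqNgt; apply/negP => /(ot_mono_lt (prefix_recurrent l)); rewrite -!MP ltnNge.
by rewrite ot_mono.
Qed.
Lemma M0 : M 0 = 0.
Proof. by apply: (@ot_inj _ _ _ (prefix_recurrent l)); rewrite -MP. Qed.

(** A long return word is followed by the long prefix, which begins with the short one, so its text
    alone shows how it splits into short return words. *)
Lemma M_same k k' : label l' cr' k = label l' cr' k' -> slice (M k) (M k.+1) = slice (M k') (M k'.+1).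
Proof.
move=> e; have [_ crP] := cl'; have er : rt l' k = rt l' k' by apply: crP.
have E := ret_follow (prefix_recurrent l') k; rewrite er -ret_follow in E.
have len := congr1 size er; rewrite !size_seg in len; rewrite -len in E.
have lt := ot_lt (prefix_recurrent l') k; have lt' := ot_lt (prefix_recurrent l') k'.
move: E; set m := o l' k.+1 - o l' k + l'; rewrite (MP k) (MP k') => E; pose r := M k.+1 - M k.
have leM := M_mono (leqnSn k); have Er : M k + r = M k.+1 by rewrite subnKC.
have H : o l (M k + r) + l <= o l (M k) + m by rewrite Er -(MP k.+1) -(MP k) /m; lia.
have oE := ot_same E H.
have ME : M k'.+1 = M k' + r.
  by apply: (@ot_inj _ _ _ (prefix_recurrent l)); rewrite oE Er -(MP k.+1) -(MP k) -(MP k') -(MP k'.+1); lia.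
rewrite /slice ME -Er !addKn (map_iota_shift _ (M k)) (map_iota_shift _ (M k')).
apply/eq_in_map => i; rewrite mem_iota add0n => /andP[_ lti]; rewrite /z /label.
congr (nat_of_ord (cr _)); apply: (ret_same E).
by have := ot_mono (prefix_recurrent l) (_ : (M k + i).+1 <= M k + r); rewrite -addnS leq_add2l => /(_ lti); lia.
Qed.

Lemma cut_J j : cut (W n) x (J j) = cut (W n') x j.
Proof.
rewrite -(img_cut_comp (W n) j (img_iter N imx)) /cut; congr size; apply: eq_extend => c.
by rewrite /= -wpowD subnKC // ltnW.
Qed.

Lemma M_le j : M (kappa n' l' j) <= kappa n l (J j).
Proof.
rewrite [kappa n l (J j)]/kappa cut_J.
have [e|H] := cntP (prefix_recurrent l') 0 (cut (W n') x j); first by rewrite /kappa e M0.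
rewrite -/(kappa n' l' j) in H.
apply: cnt_max; rewrite add0n ot0 add0n -MP; rewrite ot0 !add0n in H; exact: leq_trans (leq_add (leqnn _) le_l) H.
Qed.

Lemma kappa_J j : kappa n l (J j) = M (kappa n' l' j) +
  ct l (M (kappa n' l' j)) (cut (W n') x j - o l (M (kappa n' l' j))).
Proof.
rewrite {1}/kappa cut_J; apply: cnt_from; first by rewrite -MP; apply: ot_cnt.
by rewrite -[X in cnt _ _ X]cut_J; apply: M_le.
Qed.

(** Position [j] at level [n'] and position [J j] at level [n] are the same cut of [y] ([cut_J]), so
    the pending long text splits into complete short return words and the pending short text. *)
Lemma J_det i j : state n l cp i = state n l cp j ->
  state n l cp (J i) = state n l cp (J j) /\
  slice (M (kappa n' l' i)) (kappa n l (J i)) = slice (M (kappa n' l' j)) (kappa n l (J j)).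
Proof.
rewrite (same i).1 (same j).1 => /(state_inj cl'); rewrite /pending !MP => E.
have sz := congr1 size E; rewrite !size_seg in sz; rewrite -sz in E.
have [e1 e2 e3] := window_same E.
have le1 k : o l (M (kappa n' l' k)) <= cut (W n') x k by rewrite -MP; apply: ot_cnt.
have mj : o l (M (kappa n' l' j)) + (cut (W n') x i - o l (M (kappa n' l' i))) = cut (W n') x j.
  by rewrite sz subnKC.
rewrite (subnKC (le1 i)) mj in e3; split.
  have ep : pending n l (J i) = pending n l (J j) by rewrite /pending !kappa_J -sz !cut_J.
  by rewrite /state ep.
rewrite /slice !kappa_J !addKn -sz -e1 (map_iota_shift _ (M (kappa n' l' i))) (map_iota_shift _ (M (kappa n' l' j))).
by apply/eq_in_map => r; rewrite mem_iota add0n => /andP[_ lt]; rewrite /z /label e2.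
Qed.

Let lam c := if pselect (exists k, z k = c) is left h then
  slice (M (projT1 (cid h))) (M (projT1 (cid h)).+1) else [::].
Let Th c := if pselect (exists k, z k = c) is left h then rt l (projT1 (cid h)) else [::].
Let rs := [seq c <- iota 0 B0 | `[< exists k, z k = c >]].

Lemma lamP k : lam (z k) = slice (M k) (M k.+1).
Proof.
rewrite /lam; case: pselect => [h|[]]; last by exists k.
by case: cid => i /= e; apply: M_same; apply: ord_inj; rewrite -!same_label.
Qed.

Lemma ThP k : Th (z k) = rt l k.
Proof.
rewrite /Th; case: pselect => [h|[]]; last by exists k.
by case: cid => i /= e; have [_ crP] := cl; apply: crP; apply: ord_inj.
Qed.

Lemma rsP c : c \in rs -> exists k, z k = c.
Proof. by rewrite mem_filter => /andP[/asboolP]. Qed.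

Lemma z_rs k : z k \in rs.
Proof. by rewrite mem_filter mem_iota /= add0n ltn_ord andbT; apply/asboolP; exists k. Qed.

Lemma two_level_certificate : exists C, certifies s f (x 0) C.
Proof.
have [[l0 D0 lD] [szW lo hi]] := lv.
(* The lag consists of the short return words already complete inside the pending long one. *)
eexists; apply: (@run_certP _ _ s f x imx n N B0.+1 (fun j => state n l cp j)
  (fun j => [seq val c | c <- output n l cr j]) (pending n l) Th lam
  (fun j => slice (M (kappa n' l' j)) (kappa n l (J j))) rs).
- by rewrite subn_gt0.
- by rewrite /state pending0.
- by move=> j; apply: ltn_ord.
- exact: pending0.
- have J0 : J 0 = 0 by rewrite /J cut0.
  have l0' : 0 < l' := leq_trans l0 le_l.
  by rewrite J0 !kappa0 // M0.
- move=> i j e; have {}e : state n l cp i = state n l cp j by apply: ord_inj.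
  have [e1 e2] := J_det e; split; rewrite ?(state_inj cl e) ?e1 //.
  by move=> ex; have [-> ->] := state_det cl e ex.
- move=> j; rewrite pending_cat output_slice.
  have -> : extend Th (slice (kappa n l j) (kappa n l j.+1)) =
      flatten [seq rt l i | i <- iota (kappa n l j) (kappa n l j.+1 - kappa n l j)].
    by rewrite /extend /slice -map_comp; congr flatten; apply: eq_map => k /=; rewrite ThP.
  have le1 := kappa_mono n l (leqnSn j); rewrite flatten_ret subnKC // /pending.
  have h1 := ot_mono (prefix_recurrent l) le1; have h2 := ot_cnt (prefix_recurrent l) (cut (W n) x j.+1).
  rewrite -/(kappa n l j.+1) in h2.
  have {2}-> : o l (kappa n l j.+1) = o l (kappa n l j) + (o l (kappa n l j.+1) - o l (kappa n l j)) by rewrite subnKC.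
  by rewrite -segD; congr seg; lia.
- by move=> j; rewrite output_slice; apply/allP => c /mapP[k _ ->]; apply: z_rs.
(* Both sides are the labels of the short return words from [M (kappa n' l' j)] to
   [kappa n l (J j.+1)]. *)
- right=> j; rewrite flatten_slices.
  have JJ : J j <= J j.+1 by apply: cut_le.
  rewrite subnKC // slice_cat ?M_le //; last exact: kappa_mono.
  have -> : extend lam [seq val c | c <- output n l cr j] = slice (M (kappa n' l' j)) (M (kappa n' l' j.+1)).
    rewrite output_slice !same_kappa; have := kappa_mono n' l' (leqnSn j).
    move: (kappa n' l' j) (kappa n' l' j.+1) => a b /subnKC <-.
    elim: (b - a) => [|m IHm]; first by rewrite addn0 /slice !subnn.
    have -> : slice a (a + m.+1) = slice a (a + m) ++ slice (a + m) (a + m).+1.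
      by rewrite slice_cat ?leq_addr // addnS.
    rewrite extend_cat IHm {2}/slice subSnn /= extend1 lamP addnS slice_cat //; apply: M_mono => //.
    exact: leq_addr.
  by rewrite slice_cat ?M_le // M_mono // kappa_mono.
(* By [gap2] a long return word is longer than any short one, so it contains at least two. *)
- move=> c /rsP[k <-]; rewrite lamP size_map size_iota ltn_subRL addn1.
  have lt : M k < M k.+1.
    by apply: (@ot_lt_inv _ _ _ (prefix_recurrent l)); rewrite -!MP; apply: ot_lt.
  rewrite ltn_neqAle lt andbT; apply/eqP => e; have := gap2 k.
  by rewrite !MP -e; have := hi (M k); lia.
(* [gapW] places the short return word together with the prefix that follows it; the prefix marks
   where the return word ends, so the label found there is [z m]. *)
- move=> c c' /rsP[k <-] /rsP[m <-]; rewrite lamP.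
  have [i /andP[le lt] oi] := gapW k m.
  have oi' : occurs y (seg y 0 l) i.
    move: oi; rewrite -ret_follow addnC segD => /occurs_cat[+ _].
    by have := occursE (ot_occurs (prefix_recurrent l) m); rewrite size_seg => <-.
  have [m' e] := ot_ex (prefix_recurrent l) oi'; rewrite e in le lt oi.
  apply/mapP; exists m'; last first.
    have E := occursE oi; rewrite -ret_follow size_seg in E.
    rewrite /z /label; congr (nat_of_ord (cr _)).
    have := ret_same (r := 0) E; rewrite !addn0; apply.
    by have := ot_lt (prefix_recurrent l) m; lia.
  have le1 : M k <= m'.
    by rewrite leqNgt; apply/negP => /(ot_mono_lt (prefix_recurrent l)); rewrite -MP ltnNge le.
  have lt1 : m' < M k.+1 by apply: (@ot_lt_inv _ _ _ (prefix_recurrent l)); rewrite -MP.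
  by rewrite mem_iota; lia.
Qed.
End TwoLevels.
End LevelCertificate.

Lemma cat_cancel_r T (u v w : seq T) : u ++ w = v ++ w -> u = v.
Proof.
move=> e; have sz := congr1 size e; rewrite !size_cat in sz.
have {}sz : size u = size v by lia.
by have := congr1 (take (size u)) e; rewrite {2}sz !take_size_cat.
Qed.

Section ManyLevels.
Variables (A : finType) (B : Type) (s : A -> seq A) (f : A -> seq B).
Variables (x : nat -> A) (y : nat -> B).
Hypotheses (imx : img s x x) (imy : img f x y) (ur : uniformly_recurrent y).
Local Notation o l := (ot (prefix_recurrent ur l)).
Local Notation rt l := (ret (prefix_recurrent ur l)).

(** There are at most [B0] return words, so one window serves them all. *)
Lemma return_window B0 l (cr : seq B -> 'I_B0) :
  (forall i j, cr (rt l i) = cr (rt l j) -> rt l i = rt l j) ->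
  exists L, forall m, window y (rt l m ++ seg y 0 l) L.
Proof.
move=> crP.
have /choice[Lf HL] (c : 'I_B0) : exists L, forall m, cr (rt l m) = c -> window y (rt l m ++ seg y 0 l) L.
  have [[m0 e0]|no] := pselect (exists m, cr (rt l m) = c); last by exists 0 => m e; case: no; exists m.
  have [|L win] := @ur_window _ y (rt l m0 ++ seg y 0 l) ur.
    by rewrite -ret_follow; apply: factor_seg.
  by exists L => m e; rewrite (crP m m0) // e e0.
exists (\max_c Lf c) => m i; have [j /andP[le1 le2] oj] := HL _ m erefl i.
exists j => //; rewrite le1; apply: leq_trans le2 _; rewrite leq_add2l.
exact: (leq_bigmax (cr (rt l m))).
Qed.

(* Infinitely many levels share one transition table, and two such levels that *)
(* are far apart give a certificate.                                           *)
Lemma levels_certificate K B0 :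
  (forall n0, exists n l D (cp cr : seq B -> 'I_B0), [/\ n0 <= n, n0 <= l,
     level s f x ur K n l D & coded_level s f x ur n l cp cr]) ->
  exists C, certifies s f (x 0) C.
Proof.
move=> lvs.
pose lev n0 := {d : nat * nat * nat * (seq B -> 'I_B0) * (seq B -> 'I_B0) |
  let: (n, l, D, cp, cr) := d in [/\ n0 <= n, n0 <= l, level s f x ur K n l D & coded_level s f x ur n l cp cr]}.
have data n0 : lev n0.
  by apply: cid; have [n [l [D [cp [cr H]]]]] := lvs n0; exists (n, l, D, cp, cr).
have table n0 : {tab : {ffun 'I_B0.+1 * A -> 'I_B0.+1 * (3 * K * K * K.+1).-bseq 'I_B0} |
    let: (n, l, D, cp, cr) := projT1 (data n0) in
    forall j, (tab (state s f x ur n l cp j, x j)).1 = state s f x ur n l cp j.+1 /\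
      (tab (state s f x ur n l cp j, x j)).2 = output s f x ur n l cr j :> seq _}.
  apply: cid; case: (data n0) => -[[[[n l] D] cp] cr] /= [_ _ lv cl].
  exact: (level_table imx imy lv cl).
have [tab inf] := @pigeonhole_inf _ (fun=> True) (fun n0 => projT1 (table n0)) (fun n => ex_intro2 _ _ n (leqnn n) I).
have [m1 _ [_ e1]] := inf 0.
move: (projT2 (table m1)); rewrite e1; move: (projT2 (data m1)).
case: (projT1 (data m1)) => [[[[n l] D] cp] cr] [_ _ lv cl] tab1.
have [L win] := return_window cl.2.
(* Since [l' <= K * D'] and [D'] is at most [K] times a gap, this size of [l'] makes all gaps at the
   second level exceed [K * D + L]. *)
have [m2 le2 [_ e2]] := inf (n.+1 + l + (K * K * (K * D + L)).+1).
move: (projT2 (table m2)); rewrite e2; move: (projT2 (data m2)).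
case: (projT1 (data m2)) => [[[[n' l'] D'] cp'] cr'] [gen gel lv' cl'] tab2.
have [[l0 D0 lD] _] := lv; have [[l0' D0' lD'] [_ lo' _]] := lv'.
have gap k : K * D + L < o l' k.+1 - o l' k.
  rewrite ltnNge; apply/negP => le.
  have := leq_trans lD' (leq_mul (leqnn K) (leq_trans (lo' k) (leq_mul (leqnn K) le))).
  rewrite mulnA; lia.
apply: (two_level_certificate imx imy lv cl lv' cl').
- lia.
- lia.
- have same j : state s f x ur n l cp j = state s f x ur n' l' cp' j.
    elim: j => [|j IHj]; first by rewrite /state !pending0.
    by rewrite -(tab1 j).1 -(tab2 j).1 IHj.
  move=> j; split=> //.
  by rewrite -(tab1 j).2 -(tab2 j).2 same.
- by move=> k; have := gap k; lia.
- move=> k m; have [j /andP[le1 le3] oj] := win m (o l' k); exists j => //.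
  by rewrite le1 andTb; have := gap k; lia.
Qed.
End ManyLevels.

(** * Aperiodic sequences: levels with few return words and pending words *)

Section Aperiodic.
Variables (A A2 : finType) (B : Type) (s : A -> seq A) (f : A -> seq B).
Variables (x : nat -> A) (y : nat -> B).
Hypotheses (imx : img s x x) (imy : img f x y) (ur : uniformly_recurrent y).
Hypothesis aper : forall d, 0 < d -> ~ forall i, y (i + d) = y i.
Variables (s2 : A2 -> seq A2) (f2 : A2 -> seq B) (x2 : nat -> A2).
Hypotheses (imx2 : img s2 x2 x2) (imy2 : img f2 x2 y).
Hypotheses (sne : forall c, s2 c <> [::]) (fne : forall c, f2 c <> [::]).
Hypotheses (allx : forall c, exists j, x2 j = c) (grow0 : growing s2 (x2 0)).
Variables (d : A -> seq A2) (n0 p : nat).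
Hypotheses (p0 : 0 < p) (imd : img d x x2).
Hypothesis rep : forall k j, wpow s f (n0 + p * k) (x j) = extend (wpow s2 f2 k) (d (x j)).
Local Notation W := (wpow s f).
Local Notation W2 := (wpow s2 f2).
Local Notation o l := (ot (prefix_recurrent ur l)).
Local Notation rt l := (ret (prefix_recurrent ur l)).
Local Notation gro := (gro s2).

Lemma rep_cut k j : cut (W (n0 + p * k)) x j = cut (W2 k) x2 (cut d x j).
Proof.
rewrite -(img_cut_comp (W2 k) j imd) /cut /extend; congr (size (flatten _)).
by apply/eq_in_map => c /mapP[i _ ->]; apply: rep.
Qed.

Lemma leq_size_wpow k c : size (mpow s2 k c) <= size (W2 k c).
Proof. exact: size_extend_ge. Qed.

Lemma aperiodic_certificate : exists C, certifies s f (x 0) C.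
Proof.
have [K1 LR] := linear_recurrence imx2 imy2 sne fne allx grow0 ur aper.
have [k1 k10 cmp] := comparable_growth imx2 imy2 sne fne allx grow0 ur aper LR.
have [rho runs] := bounded_runs imx2 imy2 sne fne allx grow0 ur aper.
pose F := \max_c size (f2 c); pose dm := \max_c size (d c); pose G := F * k1.
(* [M] serves for the prolonged pending words. The [2 + K1] added to it in [few] serves for return
   words followed by the prefix. *)
pose M := (2 + K1 + G * rho.+1) * k1.
have [kw few] := few_words aper LR (M + (2 + K1)).
pose T : finType := ((rho.+1).-bseq A2 * ('I_kw * 'I_kw))%type.
(* The summands serve, in order, for the length [l = D] of the prefix, for the blocks [W n (x j)],
   and for the two bounds on gaps. *)
pose K := 1 + dm * G + 2 * K1.+1.
apply: (@levels_certificate _ _ _ _ _ _ imx imy ur K #|T|) => m0.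
have [q Hq] := grow0 m0.
have [k lek cmpk] := cmp (maxn q m0).
pose D := size (mpow s2 k (x2 0)).
have D0 : 0 < D by apply: mpow_gt0.
have gx0 : gro (x2 0) by apply/asboolP.
have szW2 c : size (W2 k c) <= G * D.
  apply: leq_trans (_ : F * size (mpow s2 k c) <= _).
    by apply: size_extend_le => e; apply: (leq_bigmax e).
  by rewrite /G -mulnA; apply: leq_mul (leqnn _) (cmpk _ _ gx0).
have Dg g : gro g -> D <= k1 * size (W2 k g).
  by move=> gg; apply: leq_trans (cmpk (x2 0) g gg) _; rewrite leq_pmul2l // leq_size_wpow.
have lem : m0 <= D.
  apply: leq_trans Hq _; have := leq_size_mpow sne [:: x2 0] (leq_trans (leq_maxl q m0) lek).
  by rewrite !extend1.
have hi j : o D j.+1 - o D j <= K1.+1 * D.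
  have [|i /andP[le1 le2] oi] := LR _ (factor_seg y 0 D) _ (o D j).+1.
    by move/(congr1 size)/eqP; rewrite size_seg /= eqn0Ngt D0.
  have [_ _ no] := nextP (prefix_recurrent ur D) (o D j); rewrite -otS in no.
  have : o D j.+1 <= i by rewrite leqNgt; apply/negP => lt; apply: (no i) => //; rewrite lt andbT.
  by move: le2; rewrite size_seg mulSn; lia.
have lo j : D < 2 * K1.+1 * (o D j.+1 - o D j).
  have lt := ot_lt (prefix_recurrent ur D) j.
  have := @gap_lower _ _ aper _ LR (seg y 0 D) (o D j) (o D j.+1 - o D j).
  rewrite subnKC ?(ltnW lt) // => /(_ (ot_occurs _ _) (ot_occurs _ _)).
  rewrite subn_gt0 lt size_seg => /(_ isT) h; apply: leq_trans h _.
  rewrite (mulnC 2) -mulnA leq_pmul2l //; lia.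
pose n := n0 + p * k.
(* A pending word may end anywhere, whereas [few_words] needs a long known right end. Prolonging it
   by the next letters up to a growing [g], at most [rho.+1] of them, makes it end with [W2 k g]. *)
have follow j : exists h : seq A2, [/\ size h <= rho.+1, exists h' g, h = rcons h' g /\ gro g &
    factor y (pending s f x ur n D j ++ extend (W2 k) h) /\
    (forall m, m <= D -> m <= size (extend (W2 k) h) -> exists z, pending s f x ur n D j ++ extend (W2 k) h = seg y 0 m ++ z)].
  set j2 := cut d x j; have : has gro (seg x2 j2 rho.+1).
    by apply: contraT => /(runs _ (factor_seg _ _ _)); rewrite size_seg ltnn.
  case/hasP => g /mapP[r]; rewrite mem_iota add0n /= => ltr -> gg.
  exists (seg x2 j2 r.+1); split; first by rewrite size_seg.
    exists (seg x2 j2 r), (x2 (j2 + r)); split=> //.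
    by rewrite -addn1 segD -cats1 {2}/seg /mkseq /= addn0.
  set h := seg x2 j2 r.+1; set b := size (extend (W2 k) h).
  have kp : o D (kappa s f x ur n D j) <= cut (W n) x j := ot_cnt _ _.
  have E : pending s f x ur n D j ++ extend (W2 k) h =
      seg y (o D (kappa s f x ur n D j)) (cut (W n) x j - o D (kappa s f x ur n D j) + b).
    rewrite segD subnKC //; congr (_ ++ _); rewrite rep_cut.
    exact: img_seg (img_wpow k imx2 imy2).
  split=> [|m leD leb]; first by rewrite E; apply: factor_seg.
  have -> : pending s f x ur n D j ++ extend (W2 k) h = seg y (o D (kappa s f x ur n D j)) (m + (cut (W n) x j - o D (kappa s f x ur n D j) + b - m)).
    by rewrite E; congr seg; rewrite subnKC //; apply: leq_trans leb (leq_addl _ _).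
  rewrite segD; eexists; congr (_ ++ _).
  have oc := occursE (ot_occurs (prefix_recurrent ur D) (kappa s f x ur n D j)); rewrite size_seg in oc.
  by apply: seg_eq => i lti; rewrite (eq_seg oc) //; lia.
have pend_size j : size (pending s f x ur n D j) <= (2 + K1) * D.
  rewrite size_seg; have := cnt_next (prefix_recurrent ur D) 0 (cut (W n) x j).
  rewrite -/(kappa s f x ur n D j) ot0 !add0n; have := hi (kappa s f x ur n D j).
  rewrite mulnDl mulSn; lia.
(* A length reached at both ends: the start agrees with a prefix of [y] up to [D], the end is
   [W2 k c]. For growing [c] it is at least [D / k1]. *)
pose D2 c := minn D (size (W2 k c)).
have D20 c : 0 < D2 c by rewrite leq_min D0 (leq_trans _ (leq_size_wpow k c)) // mpow_gt0.
have /choice[code codeP] c := few (D2 c) (seg y 0 (D2 c)) (W2 k c) (D20 c)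
  (eq_leq (esym (size_seg _ _ _))) (geq_minr _ _).
have [codeR codeRP] := few D (seg y 0 D) (seg y 0 D) D0 (eq_leq (esym (size_seg _ _ _))) (eq_leq (esym (size_seg _ _ _))).
have [hf hfP] := choice follow.
pose bs h : (rho.+1).-bseq A2 := insub_bseq _ h.
pose c0 := x2 0.
(* The code records the prolongation [h] as well: it selects the code function through the last
   letter of [h], and equal prolongations can be cancelled. *)
pose cp t := enum_rank (if pselect (exists j, pending s f x ur n D j = t) is left e then
  (bs (hf (projT1 (cid e))), code (last c0 (hf (projT1 (cid e)))) (t ++ extend (W2 k) (hf (projT1 (cid e)))))
  else (bs [::], codeR t) : T).
pose cr t := enum_rank ((bs [::], codeR (t ++ seg y 0 D)) : T).
exists n, D, D, cp, cr; split.
- apply: leq_trans (leq_trans (leq_maxr q m0) lek) _; rewrite /n; nia.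
- exact: lem.
- split; [split=> // | split=> j].
  + by rewrite /K; nia.
  + rewrite /n rep; apply: leq_trans (size_extend_le _ szW2) _.
    have : size (d (x j)) <= dm by apply: (leq_bigmax (x j)).
    move=> le; apply: leq_trans (_ : dm * G * D <= _).
      by rewrite mulnAC (mulnC G) !leq_mul2r le !orbT.
    by rewrite leq_mul2r /K -addnA addnCA leq_addr orbT.
  + by have := lo j; rewrite /K; nia.
  + by have := hi j; rewrite /K; nia.
- split=> [i j|i j /enum_rank_inj[] e]; last first.
    have cond m : [/\ factor y (rt D m ++ seg y 0 D), size (rt D m ++ seg y 0 D) <= (M + (2 + K1)) * D,
        exists z, rt D m ++ seg y 0 D = seg y 0 D ++ z & exists z, rt D m ++ seg y 0 D = z ++ seg y 0 D].
      split; last by eexists.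
      - by rewrite -ret_follow; apply: factor_seg.
      - by rewrite size_cat !size_seg; have := hi m; move: (M) => M'; nia.
      - rewrite -ret_follow addnC segD; eexists; congr (_ ++ _).
        by have oc := occursE (ot_occurs (prefix_recurrent ur D) m); rewrite size_seg in oc.
    by apply: (@cat_cancel_r _ _ _ (seg y 0 D)); apply: codeRP e => v [->|->]; apply: cond.
  rewrite /cp; case: pselect => [ei|[]]; last by exists i.
  case: pselect => [ej|[]]; last by exists j.
  case: cid => i' /= ei'; case: cid => j' /= ej' /enum_rank_inj[].
  have [szi [hi' [gi [ehi ggi]]] [fi pfi]] := hfP i'; have [szj _ [fj pfj]] := hfP j'.
  have bsE h : size h <= rho.+1 -> bs h = h :> seq _ by move=> le; apply: insubdK.
  move=> /(congr1 val) /=; rewrite (bsE _ szi) (bsE _ szj) => eh; rewrite -eh in szj fj pfj *.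
  rewrite ei' in fi pfi; rewrite ej' in fj pfj.
  have lg : last c0 (hf i') = gi by rewrite ehi last_rcons.
  rewrite lg => ec.
  have hD : D <= k1 * D2 gi by rewrite /D2; have := Dg _ ggi; case: (leqP D) => //; nia.
  have szh : size (extend (W2 k) (hf i')) <= G * rho.+1 * D.
    by apply: leq_trans (size_extend_le _ szW2) _; rewrite mulnAC leq_mul2r leq_mul2l szj !orbT.
  have suf : exists z, extend (W2 k) (hf i') = z ++ W2 k gi.
    by rewrite ehi -cats1 extend_cat extend1; eexists.
  have [z0 ez0] := suf.
  have le2 : D2 gi <= size (extend (W2 k) (hf i')).
    by rewrite ez0 size_cat; apply: leq_trans (geq_minr _ _) (leq_addl _ _).
  have cond m : factor y (pending s f x ur n D m ++ extend (W2 k) (hf i')) ->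
     (forall l, l <= D -> l <= size (extend (W2 k) (hf i')) -> exists z, pending s f x ur n D m ++ extend (W2 k) (hf i') = seg y 0 l ++ z) ->
     let v := pending s f x ur n D m ++ extend (W2 k) (hf i') in
     [/\ factor y v, size v <= (M + (2 + K1)) * D2 gi, exists z, v = seg y 0 (D2 gi) ++ z & exists z, v = z ++ W2 k gi].
    move=> fm pm v; split=> //.
    - rewrite size_cat; apply: leq_trans (leq_add (pend_size m) szh) _.
      rewrite -mulnDl; apply: leq_trans (leq_mul (leqnn _) hD) _.
      by rewrite mulnA -/M leq_mul // leq_addr.
    - by apply: pm => //; apply: geq_minl.
    - by rewrite /v ez0 catA; eexists.
  apply: (@cat_cancel_r _ _ _ (extend (W2 k) (hf i'))).
  by apply: codeP ec => v [->|->]; apply: cond.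
Qed.
End Aperiodic.

(** * Deleting the erased letters *)

Lemma eq_img_on A B (f g : A -> seq B) x y : (forall j, f (x j) = g (x j)) -> img f x y -> img g x y.
Proof.
move=> fg; have e n : extend f (mkseq x n) = extend g (mkseq x n).
  by rewrite /extend /mkseq -!map_comp; congr flatten; apply: eq_map => j /=.
by move=> [pre inf]; split=> [n|L]; [rewrite -e | have [n Hn] := inf L; exists n; rewrite -e].
Qed.

Lemma wpow_unbounded (A : Type) B (s : A -> seq A) (f : A -> seq B) a x y : prolongable s a -> is_fixpoint s a x ->
  img f x y -> forall L, exists N, forall n, N <= n -> L <= size (wpow s f n a).
Proof.
move=> pro fx imy L; have [j Hj] := img_inf L imy; have [N HN] := pro.2 j.
exists N => n le; apply: leq_trans Hj _; rewrite /wpow (occursE (fixpoint_occurs pro n fx)) -mkseq_seg.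
by apply: cut_le; apply: HN.
Qed.

Section Reduction.
Variables (A : finType) (B : Type) (s : A -> seq A) (f : A -> seq B) (x : nat -> A) (y : nat -> B).
Hypotheses (imx : img s x x) (imy : img f x y).
Hypothesis inf : forall L, exists N, forall n, N <= n -> L <= size (wpow s f n (x 0)).
Variables (n0 p : nat).
Local Notation W := (wpow s f).
Hypotheses (p0 : 0 < p) (em : empties s f n0 = empties s f (n0 + p)) (ne0 : W n0 (x 0) <> [::]).

(** Letters absent from [x] are discarded too, so that every letter of the new alphabet occurs in
    the new fixed point. *)
Definition live c := ~~ nilp (W n0 c) && `[< exists j, x j = c >].
Definition letter2 : finType := {c : A | live c}.
Definition del c : seq letter2 := if insub c is Some c2 then [:: c2] else [::].
Definition sub2 (c : letter2) : seq letter2 := extend del (mpow s p (val c)).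
Definition out2 (c : letter2) : seq B := W n0 (val c).

Definition in_x (w : seq A) := forall c, c \in w -> exists j, x j = c.

Lemma in_x_mpow m j : in_x (mpow s m (x j)).
Proof.
by rewrite (img_letter j (img_iter m imx)) => c /mapP[i _ ->]; eexists.
Qed.

Lemma del_live (c2 : letter2) : del (val c2) = [:: c2].
Proof. by rewrite /del valK. Qed.

Lemma del_out w : in_x w -> extend out2 (extend del w) = extend (W n0) w.
Proof.
elim: w => // c w IHw inx; rewrite !extend_cons extend_cat IHw; last first.
  by move=> e ew; apply: inx; rewrite inE ew orbT.
congr (_ ++ _); rewrite /del; case: insubP => [c2 _ <-|]; first by rewrite extend1.
rewrite /live negb_and negbK => /orP[/nilP -> //|/asboolPn[]].
by apply: inx; rewrite inE eqxx.
Qed.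

Lemma empties_letter c : nilp (W n0 c) = nilp (W (n0 + p) c).
Proof. by have := congr1 (fun h : {ffun A -> bool} => h c) em; rewrite !ffunE. Qed.

Lemma del_dead w : all (fun c => nilp (W n0 c)) w -> extend del w = [::].
Proof.
elim: w => //= c w IHw /andP[nc nw]; rewrite extend_cons IHw // cats0 /del; case: insubP => // c2.
by rewrite /live nc.
Qed.

(** By [em] a letter erased at level [n0] is erased at level [n0 + p], so all letters of its image
    under [sigma^p] are erased at level [n0]: deletion commutes with [sigma^p] on the letters of
    [x]. *)
Lemma del_sub c : extend del (mpow s p c) = extend sub2 (del c) \/ ~ exists j, x j = c.
Proof.
have [ex|] := pselect (exists j, x j = c); [left | by right].
rewrite {2}/del; case: insubP => [c2 _ <-|]; first by rewrite extend1.
rewrite /live negb_and negbK => /orP[|/asboolPn[]//]; rewrite empties_letter wpowD (extend_nilp A).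
exact: del_dead.
Qed.

Lemma del_sub_word w : in_x w -> extend del (extend (mpow s p) w) = extend sub2 (extend del w).
Proof.
elim: w => // c w IHw inx; rewrite !extend_cons !extend_cat IHw; last first.
  by move=> e ew; apply: inx; rewrite inE ew orbT.
by congr (_ ++ _); have [//|[]] := del_sub c; apply: inx; rewrite inE eqxx.
Qed.

Lemma del_mpow k j : extend del (mpow s (p * k) (x j)) = extend (mpow sub2 k) (del (x j)).
Proof.
elim: k => [|k IHk]; first by rewrite muln0 extend1 extend_mpow0.
by rewrite mulnS mpowD del_sub_word ?IHk ?extend_mpowS //; apply: in_x_mpow.
Qed.

Lemma del_rep k j : W (n0 + p * k) (x j) = extend (wpow sub2 out2 k) (del (x j)).
Proof.
by rewrite wpowD -del_out ?del_mpow ?extend_wpow //; apply: in_x_mpow.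
Qed.

Lemma reduction : exists x2, [/\ img del x x2, img sub2 x2 x2 & img out2 x2 y] /\
  [/\ forall c, sub2 c <> [::], forall c, out2 c <> [::], forall c, exists j, x2 j = c & growing sub2 (x2 0)].
Proof.
have inx n : in_x (mkseq x n) by move=> c /mapP[i _ ->]; exists i.
pose F := \max_c size (out2 c).
have leF w : size (extend out2 w) <= F * size w.
  by apply: size_extend_le => c; apply: (leq_bigmax c).
have [x2 imd] : exists x2, img del x x2.
  apply: img_ex => L; have [n Hn] := img_inf (F * L).+1 (img_wpow n0 imx imy); exists n.
  move: Hn; rewrite /cut -del_out // => Hn; have := leq_trans Hn (leF _).
  by rewrite ltn_mul2l => /andP[_ /ltnW].
have d0 : del (x 0) = [:: x2 0].
  have := img_letter 0 imd; have live0 : live (x 0).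
    by rewrite /live; apply/andP; split; [apply/nilP | apply/asboolP; exists 0].
  by rewrite /del insubT /= cut0 => e; rewrite e.
exists x2; split; split=> //.
- apply: (img_factor_through imd); apply: eq_img_on (img_comp (img_iter p imx) imd) => j /=.
  by have [//|[]] := del_sub (x j); exists j.
- apply: (img_factor_through imd); apply: eq_img_on (img_wpow n0 imx imy) => j /=.
  by rewrite -(extend1 del) del_out ?extend1 // => c; rewrite inE => /eqP ->; exists j.
- move=> c e; have /andP[/negP lc /asboolP[j xj]] := valP c; apply: lc.
  rewrite empties_letter wpowD -del_out; last by rewrite -xj; apply: in_x_mpow.
  by rewrite -/(sub2 c) e.
- by move=> c e; have /andP[/negP lc _] := valP c; apply: lc; rewrite -/(out2 c) e.
- move=> c; have /andP[_ /asboolP[j xj]] := valP c; exists (cut del x j).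
  have := img_letter j imd; rewrite xj del_live => /(congr1 (fun t => nth c t 0)) /=.
  by rewrite addn0 => ->.
move=> L; have [N HN] := inf (F * L).+1; exists N.
have := HN (n0 + p * N) (leq_trans (leq_pmull N p0) (leq_addl _ _)).
rewrite del_rep d0 extend1 => H; have := leq_trans H (leF _).
by rewrite ltn_mul2l => /andP[_ /ltnW].
Qed.
End Reduction.

Theorem ur_certificate (A : finType) B (s : A -> seq A) (f : A -> seq B) a x y :
  prolongable s a -> is_fixpoint s a x -> img f x y -> uniformly_recurrent y -> exists C, certifies s f a C.
Proof.
move=> pro fx imy ur; have imx := fixpoint_img pro fx.
rewrite -(fixpoint_0 pro fx).
have [[d [d0 per]]|aper] := pselect (exists d, 0 < d /\ forall i, y (i + d) = y i).
  exact: periodic_certificate imx imy d0 per.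
have inf := wpow_unbounded pro fx imy.
have [i1 [i2 [lt e]]] := empties_repeat s f; have [N HN] := inf 1.
pose p := i2 - i1; have p0 : 0 < p by rewrite subn_gt0.
(* Moving [N] periods up keeps the equality and makes the image of the first letter nonempty. *)
have em : empties s f (i1 + p * N) = empties s f (i1 + p * N + p).
  have e' : empties s f i1 = empties s f (i1 + p) by rewrite subnKC // ltnW.
  have := empties_period 0 N e'; have := empties_period 0 N.+1 e'.
  by rewrite !addn0 mulnSr addnA => <- <-.
rewrite -(fixpoint_0 pro fx) in inf HN.
have ne : wpow s f (i1 + p * N) (x 0) <> [::].
  have := HN (i1 + p * N) (leq_trans (leq_pmull N p0) (leq_addl _ _)).
  by case: wpow.
have [x2 [[imd imx2 imy2] [sne fne allx grow]]] := reduction imx imy inf p0 em ne.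
apply: (aperiodic_certificate imx imy ur _ imx2 imy2 sne fne allx grow p0 imd).
  by move=> d d0 per; apply: aper; exists d.
exact: (del_rep imx em).
Qed.

(** * Checking certificates *)

Definition ext (S : seq (seq nat)) (w : seq nat) := flatten [seq nth [::] S c | c <- w].
Definition mp S n w := iter n (ext S) w.
Definition wp S P n w := ext P (mp S n w).

Definition same_empties (S P : seq (seq nat)) i1 i2 :=
  (i1 < i2) && all (fun c => nilp (wp S P i1 [:: c]) == nilp (wp S P i2 [:: c])) (iota 0 (size S)).
Definition tail_empty S P a i1 i2 :=
  all (fun i => nilp (wp S P i (behead (nth [::] S a)))) (iota i1 (i2 - i1)).

(* State [0] is dead, and missing entries of the transition table lead to it. *)
Definition drun (Dt : seq (seq nat)) q (w : seq nat) := foldl (fun q b => nth 0 (nth [::] Dt q) b) q w.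

Definition dfa_ok (Dt : seq (seq nat)) (w : seq nat) :=
  all (fun row => all (fun q => q <= size Dt) row) Dt && all (fun q => q == 0) (nth [::] Dt 0) &&
  all (fun q => drun Dt q w == 0) (iota 0 (size Dt).+1).

Definition same_profile S P Dt n m :=
  all (fun c => (nilp (wp S P n [:: c]) == nilp (wp S P m [:: c])) &&
    all (fun q => drun Dt q (wp S P n [:: c]) == drun Dt q (wp S P m [:: c])) (iota 0 (size Dt).+1))
  (iota 0 (size S)).

Definition loop_ok S P Dt n q r :=
  ~~ nilp (wp S P n r) && (drun Dt q (wp S P n r) == q).

Definition loop_word (side : nat) i (t : seq nat) := if side == 0 then take i t else drop i.+1 t.

Definition pump_ok S P a Dt w m0 pos m1 i1 N i2 side n q :=
  dfa_ok Dt w && (take (size w) (drop pos (wp S P m0 [:: a])) == w) &&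
  (i1 < size (mp S m1 [:: a])) && (i2 < size (mp S N [:: nth 0 (mp S m1 [:: a]) i1])) &&
  (nth 0 (mp S N [:: nth 0 (mp S m1 [:: a]) i1]) i2 == nth 0 (mp S m1 [:: a]) i1) &&
  same_profile S P Dt n (n + N) && (q <= size Dt) && (q != 0) &&
  loop_ok S P Dt n q (loop_word side i2 (mp S N [:: nth 0 (mp S m1 [:: a]) i1])).

(* An entry [q' :: p] is a transition to [q'] with output [p]; [[::]] stands for *)
(* an undefined transition.                                                     *)
Definition entry (Et : seq (seq (seq nat))) q c := nth [::] (nth [::] Et q) c.

(** A fold replaces the recursion of [run], to fit [c_foldl]; the boolean records that all
    transitions so far were defined. *)
Definition trun_step Et (acc : bool * (nat * seq nat)) c :=
  (acc.1 && ~~ nilp (entry Et acc.2.1 c),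
   (head 0 (entry Et acc.2.1 c), acc.2.2 ++ behead (entry Et acc.2.1 c))).
Definition trun Et q w := foldl (trun_step Et) (true, (q, [::])) w.

Definition run_ok (acc : bool * (nat * seq nat)) q' lp vq vq' (rs : seq nat) :=
  acc.1 && (acc.2.1 == q') && ((size rs == 1) || (vq ++ acc.2.2 == lp ++ vq')).

Definition tstep_ok S P n N K Et tt Tt lt vt gt (rs : seq nat) q c q' (p : seq nat) :=
  (q' < K) && (nth [::] tt q ++ wp S P n [:: c] == ext Tt p ++ nth [::] tt q') &&
  all (fun r => has (fun r' => r' == r) rs) p &&
  run_ok (trun Et (nth 0 gt q) (mp S N [:: c])) (nth 0 gt q') (ext lt p) (nth [::] vt q) (nth [::] vt q') rs.

Definition trans_ok S P a n N K Et tt Tt lt vt gt (rs : seq nat) :=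
  nilp (nth [::] tt 0) && (nth 0 gt 0 == 0) && nilp (nth [::] vt 0) && ~~ nilp (entry Et 0 a) && (0 < N) &&
  all (fun q => nth 0 gt q < K) (iota 0 K) &&
  all (fun q => all (fun c => nilp (entry Et q c) ||
      tstep_ok S P n N K Et tt Tt lt vt gt rs q c (head 0 (entry Et q c)) (behead (entry Et q c)))
    (iota 0 (size (nth [::] Et q)))) (iota 0 (size Et)) &&
  all (fun r => (1 < size (nth [::] lt r)) && all (fun r' => has (fun z => z == r') (nth [::] lt r)) rs) rs.

(* [e.1] is the code of the input and [e.2] that of a certificate. *)
Definition fld (e : nat * nat) i := nth 0 (dec1 e.2) i.
Definition inp (e : nat * nat) i := nth 0 (dec1 e.1) i.
Definition tabS e := dec2 (inp e 3).
Definition tabP e := dec2 (inp e 4).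

Definition finite_check e :=
  same_empties (tabS e) (tabP e) (fld e 0) (fld e 1) && tail_empty (tabS e) (tabP e) (inp e 2) (fld e 0) (fld e 1).
Definition infinite_check e :=
  same_empties (tabS e) (tabP e) (fld e 0) (fld e 1) && ~~ tail_empty (tabS e) (tabP e) (inp e 2) (fld e 0) (fld e 1).
Definition pump_check e := pump_ok (tabS e) (tabP e) (inp e 2) (dec2 (fld e 2)) (dec1 (fld e 3))
  (fld e 4) (fld e 5) (fld e 6) (fld e 7) (fld e 8) (fld e 9) (fld e 10) (fld e 11) (fld e 12).
Definition trans_check e := trans_ok (tabS e) (tabP e) (inp e 2) (fld e 2) (fld e 3) (fld e 4)
  (dec3 (fld e 5)) (dec2 (fld e 6)) (dec2 (fld e 7)) (dec2 (fld e 8)) (dec2 (fld e 9)) (dec1 (fld e 10)) (dec1 (fld e 11)).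

(** A pumping certificate comes without a proof that the image is infinite, because a finite image
    is a negative instance as well; a transducer certificate has to come with one. *)
Definition check e : nat :=
  if finite_check e || pump_check e then 1 else if infinite_check e && trans_check e then 2 else 0.

Lemma c_check : computable check.
Proof.
have c1 : computable finite_check.
  rewrite /finite_check /same_empties /tail_empty /wp /mp /ext /tabS /tabP /fld /inp; comp.
have c2 : computable infinite_check.
  rewrite /infinite_check /same_empties /tail_empty /wp /mp /ext /tabS /tabP /fld /inp; comp.
have c3 : computable pump_check.
  rewrite /pump_check /pump_ok /dfa_ok /same_profile /loop_ok /loop_word /drun /wp /mp /ext /tabS /tabP /fld /inp; comp.
have c4 : computable trans_check.
  rewrite /trans_check /trans_ok /tstep_ok /run_ok /trun /trun_step /entry /wp /mp /ext /tabS /tabP /fld /inp; comp.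
by apply: (c_if (c_or c1 c3) (c_const 1) (c_if (c_and c2 c4) (c_const 2) (c_const 0))).
Qed.

(** * Tables, and soundness and completeness of the tests *)

Section Tables.
Variable T : finType.

Definition rk (c : T) : nat := enum_rank c.

Lemma rk_inj : injective rk.
Proof. by move=> c d /ord_inj /enum_rank_inj. Qed.

Lemma rk_lt c : rk c < #|T|. Proof. exact: ltn_ord. Qed.

Definition tab U (g : T -> U) := [seq g c | c <- enum T].

Lemma size_tab U (g : T -> U) : size (tab g) = #|T|.
Proof. by rewrite size_map -cardE. Qed.

Lemma nth_tab U (g : T -> U) d c : nth d (tab g) (rk c) = g c.
Proof. by rewrite (nth_map c) -?cardE ?rk_lt // nth_enum_rank. Qed.

Lemma all_rkP (P : pred nat) : reflect (forall c, P (rk c)) (all P (iota 0 #|T|)).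
Proof.
apply: (iffP allP) => [H c|H i]; first by apply: H; rewrite mem_iota rk_lt.
rewrite mem_iota /= add0n => lt; have := H (enum_val (Ordinal lt)).
by rewrite /rk enum_valK.
Qed.
End Tables.

Lemma occurs_map S T (g : S -> T) y w i : occurs y w i -> occurs (g \o y) (map g w) i.
Proof. by rewrite /occurs size_map /mkseq (map_comp g) => ->. Qed.

Lemma nth_map0 S T (g : S -> T) d e w i : i < size w -> nth d (map g w) i = g (nth e w i).
Proof. by move=> lt; rewrite (nth_map e). Qed.

Definition mtab (A B : finType) (f : A -> seq B) := tab (fun c => map (@rk B) (f c)).

Lemma dec2_code (A B : finType) (f : A -> seq B) : dec2 (code_morphism f) = mtab f.
Proof.
rewrite /dec2 /code_morphism CodeSeq.codeK -map_comp; apply: eq_map => c /=.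
by rewrite /dec1 /code_word CodeSeq.codeK.
Qed.

Lemma ext_tab (A B : finType) (f : A -> seq B) w : ext (mtab f) (map (@rk A) w) = map (@rk B) (extend f w).
Proof.
elim: w => // c w IHw; rewrite extend_cons map_cat -IHw /ext /= nth_tab //.
Qed.

Lemma mp_tab (A : finType) (s : A -> seq A) n w :
  mp (mtab s) n (map (@rk A) w) = map (@rk A) (extend (mpow s n) w).
Proof. by rewrite extend_mpow; elim: n => //= n ->; rewrite ext_tab. Qed.

Lemma wp_tab (A B : finType) (s : A -> seq A) (f : A -> seq B) n w :
  wp (mtab s) (mtab f) n (map (@rk A) w) = map (@rk B) (extend (wpow s f n) w).
Proof. by rewrite /wp mp_tab ext_tab extend_wpow. Qed.

Lemma mp_tab1 (A : finType) (s : A -> seq A) n c : mp (mtab s) n [:: rk c] = map (@rk A) (mpow s n c).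
Proof. by rewrite (mp_tab s n [:: c]) extend1. Qed.

Lemma wp_tab1 (A B : finType) (s : A -> seq A) (f : A -> seq B) n c :
  wp (mtab s) (mtab f) n [:: rk c] = map (@rk B) (wpow s f n c).
Proof. by rewrite (wp_tab s f n [:: c]) extend1. Qed.

Lemma nilp_map S T (g : S -> T) w : nilp (map g w) = nilp w.
Proof. by case: w. Qed.

Section Infinite.
Variables (A B : finType) (s : A -> seq A) (f : A -> seq B) (a : A).
Hypothesis pro : prolongable s a.

Lemma same_emptiesP i1 i2 : same_empties (mtab s) (mtab f) i1 i2 <-> i1 < i2 /\ empties s f i1 = empties s f i2.
Proof.
rewrite /same_empties size_tab; split=> [/andP[-> /all_rkP H]|[-> e]].
  by split=> //; apply/ffunP => c; rewrite !ffunE; have /eqP := H c; rewrite !wp_tab1 !nilp_map.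
apply/all_rkP => c; rewrite !wp_tab1 !nilp_map.
by have := congr1 (fun h : {ffun A -> bool} => h c) e; rewrite !ffunE => ->.
Qed.

Lemma tail_emptyP u i1 i2 : s a = a :: u ->
  tail_empty (mtab s) (mtab f) (rk a) i1 i2 <-> forall i, i1 <= i < i2 -> extend (wpow s f i) u = [::].
Proof.
move=> sa; rewrite /tail_empty nth_tab sa /=; split=> [/allP H i /andP[le lt]|H].
  have := H i; rewrite mem_iota subnKC ?(leq_trans le (ltnW lt)) // le lt => /(_ isT).
  by rewrite wp_tab nilp_map => /nilP.
apply/allP => i; rewrite mem_iota => lt; rewrite wp_tab nilp_map H //; lia.
Qed.

Lemma finite_sound i1 i2 x y : same_empties (mtab s) (mtab f) i1 i2 ->
  tail_empty (mtab s) (mtab f) (rk a) i1 i2 -> is_fixpoint s a x -> img f x y -> False.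
Proof.
have [[u _ sa] _] := pro.
move=> /same_emptiesP[lt e] /(tail_emptyP _ _ sa) em fx imy.
have [L HL] := image_finite sa lt e em; have [N HN] := wpow_unbounded pro fx imy L.+1.
by have := HN N (leqnn N); rewrite ltnNge HL.
Qed.

Lemma infinite_sound i1 i2 x : same_empties (mtab s) (mtab f) i1 i2 ->
  ~~ tail_empty (mtab s) (mtab f) (rk a) i1 i2 -> is_fixpoint s a x -> exists y, img f x y.
Proof.
have [[u _ sa] _] := pro.
move=> /same_emptiesP[lt e] /negP nem fx.
have [i [lti ne]] : exists i, i1 <= i < i2 /\ extend (wpow s f i) u <> [::].
  apply: contrapT => no; apply: nem; apply/(tail_emptyP _ _ sa) => i lti.
  by apply: contrapT => ne; apply: no; exists i.
apply: img_ex => L; have [n Hn] := image_infinite sa lt e lti ne L.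
exists (size (mpow s n a)); rewrite /cut mkseq_seg.
by have <- := occursE (fixpoint_occurs pro n fx).
Qed.
End Infinite.

Section Pump.
Variables (A B : finType) (s : A -> seq A) (f : A -> seq B) (a : A) (x : nat -> A) (y : nat -> B).
Hypotheses (pro : prolongable s a) (fx : is_fixpoint s a x) (imy : img f x y).

Lemma pump_sound Dt w m0 pos m1 i1 N i2 side n q :
  pump_ok (mtab s) (mtab f) (rk a) Dt w m0 pos m1 i1 N i2 side n q -> ~ uniformly_recurrent y.
Proof.
rewrite /pump_ok !mp_tab1 !wp_tab1 size_map.
case/andP=> /andP[/andP[/andP[/andP[/andP[/andP[/andP[dfa /eqP wE] lt1] lt2] gE] prof] leq] q0] loop.
pose g := nth a (mpow s m1 a) i1.
rewrite (nth_map0 _ _ a lt1) -/g mp_tab1 in gE lt2 loop.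
rewrite size_map in lt2; rewrite (nth_map0 _ _ a lt2) in gE; have {}gE := rk_inj (eqP gE).
case/andP: dfa => /andP[/allP rows /allP row0] /allP dead.
pose Q : finType := 'I_(size Dt).+1.
pose delta (q : Q) (b : B) : Q := inord (nth 0 (nth [::] Dt q) (rk b)).
have entry_le p b : nth 0 (nth [::] Dt p) b <= size Dt.
  have [lt|ge] := ltnP p (size Dt); last by rewrite (nth_default [::] ge) nth_nil.
  have [ltb|geb] := ltnP b (size (nth [::] Dt p)); last by rewrite (nth_default _ geb).
  by have /allP := rows _ (mem_nth [::] lt); apply; apply: mem_nth.
have runE (p : Q) v : foldl delta p v = drun Dt p (map (@rk B) v) :> nat.
  elim: v p => // b v IHv p; rewrite /= IHv; congr drun; rewrite inordK // ltnS; exact: entry_le.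
pose alive (p : Q) := (p : nat) != 0.
have absorb p b : alive (delta p b) -> alive p.
  apply: contra => /eqP p0; rewrite /delta inordK ?ltnS ?entry_le // p0.
  have [ltb|geb] := ltnP (rk b) (size (nth [::] Dt 0)); last by rewrite (nth_default _ geb).
  exact: row0 (mem_nth _ ltb).
have profE : profile s f delta n = profile s f delta (n + N).
  move: prof; rewrite /same_profile size_tab => /all_rkP prof.
  apply/ffunP => c; rewrite !ffunE; have /andP[/eqP e1 /allP e2] := prof c.
  rewrite !wp_tab1 !nilp_map in e1; rewrite e1; congr pair.
  apply/ffunP => p; rewrite !ffunE; apply: ord_inj; rewrite !runE -!wp_tab1.
  by apply/eqP; apply: e2; rewrite mem_iota /= add0n ltn_ord.
set t := mpow s N g in lt2 gE.
have tE : t = take i2 t ++ g :: drop i2.+1 t by rewrite -{1}(cat_take_drop i2 t) (drop_nth a lt2) gE.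
pose r := if side == 0 then take i2 t else drop i2.+1 t.
have rE : loop_word side i2 (map (@rk A) t) = map (@rk A) r.
  by rewrite /loop_word /r; case: eqP => _; rewrite ?map_take ?map_drop.
rewrite rE /loop_ok wp_tab nilp_map in loop; case/andP: loop => /nilP ne /eqP fixq.
pose v := take (size w) (drop pos (wpow s f m0 a)).
have vE : w = map (@rk B) v by rewrite -wE /v map_take map_drop.
have fx' m := fixpoint_occurs pro m fx.
have imx := fixpoint_img pro fx.
apply: (@pump_not_ur _ _ s f a x y fx' imx imy Q delta alive absorb v g m1 N n (take i2 t) (drop i2.+1 t) (inord q) r) => //.
- have : factor y (wpow s f m0 a).
    by have := img_factor imy (ex_intro _ 0 (fx' m0)).
  rewrite -(cat_take_drop pos (wpow s f m0 a)) -{1}(cat_take_drop (size w) (drop pos _)).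
  exact: factor_infix.
- by move=> p; rewrite /alive runE -vE negbK; apply: dead; rewrite mem_iota /= add0n ltn_ord.
- exact: mem_nth.
- by rewrite /alive inordK ?ltnS.
- by rewrite /r; case: eqP; [left | right].
- by apply: ord_inj; rewrite runE inordK ?ltnS.
Qed.

Section DeadState.
Variables (Q : finType) (delta : Q -> B -> Q) (d : Q).
Hypothesis dead : forall b, delta d b = d.

(** The dead state is sent to [0], the index whose transitions [dfa_ok] requires to stay at [0]; the
    others are shifted by one, and row [0] of [dtab] is left empty. *)
Definition stc q := if q == d then 0 else (rk q).+1.
Definition stv i := if i is j.+1 then nth d (enum Q) j else d.
Definition dtab := [::] :: tab (fun q => tab (fun b => stc (delta q b))).

Lemma stcK q : stv (stc q) = q.
Proof. by rewrite /stc; case: eqP => [->|_] //=; rewrite nth_enum_rank. Qed.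

Lemma size_dtab : size dtab = #|Q|.+1. Proof. by rewrite /= size_tab. Qed.

Lemma stc_le q : stc q <= #|Q|.
Proof. by rewrite /stc; case: eqP => // _; apply: rk_lt. Qed.

Lemma dtabE i b : nth 0 (nth [::] dtab i) (rk b) = stc (delta (stv i) b).
Proof.
have stc_d : stc (delta d b) = 0 by rewrite dead /stc eqxx.
case: i => [|j] /=; first by rewrite nth_nil stc_d.
have [lt|ge] := ltnP j #|Q|.
  by rewrite (nth_map d) -?cardE // nth_tab.
by rewrite !nth_default ?size_tab -?cardE // stc_d.
Qed.

Lemma drun_stc q w : drun dtab (stc q) (map (@rk B) w) = stc (foldl delta q w).
Proof. by elim: w q => // b w IHw q; rewrite -IHw /= /drun /= dtabE stcK. Qed.

(** The tests range over all indices, also those that are not of the form [stc q]; after one letter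
    such an index has become a proper code. *)
Lemma drun_ne i w : w <> [::] -> drun dtab i (map (@rk B) w) = stc (foldl delta (stv i) w).
Proof. by case: w => // b w _; rewrite /= -drun_stc /drun /= dtabE. Qed.

Lemma pump_complete w : w <> [::] -> factor y w -> (forall q, foldl delta q w = d) ->
  pump_at s f delta (fun q => q != d) a ->
  exists w' m0 pos m1 i1 N i2 side n q, pump_ok (mtab s) (mtab f) (rk a) dtab w' m0 pos m1 i1 N i2 side n q.
Proof.
move=> new [pos ow] wd [m1 [g [N [n [u [v [q [[gm N0 muv prof] [al [r ruv [ne fixq]]]]]]]]]]].
have [m0 Hm0] := wpow_unbounded pro fx imy (pos + size w).
exists (map (@rk B) w), m0, pos, m1, (index g (mpow s m1 a)), N, (size u), (~~ `[< r = u >] : nat), n, (stc q).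
have lt1 : index g (mpow s m1 a) < size (mpow s m1 a) by rewrite index_mem.
have dok : dfa_ok dtab (map (@rk B) w).
  rewrite /dfa_ok; apply/andP; split; first (apply/andP; split=> //).
    apply/allP => row; rewrite inE => /orP[/eqP -> //|/mapP[p _ ->]].
    by apply/allP => i /mapP[b _ ->]; rewrite size_dtab leqW // stc_le.
  by apply/allP => i _; rewrite drun_ne // wd /stc eqxx.
rewrite /pump_ok dok !mp_tab1 !wp_tab1 (nth_map0 _ _ a lt1) nth_index // mp_tab1 !size_map lt1 muv.
rewrite size_cat /= -addSnnS ltnS leq_addr.
rewrite (nth_map0 _ _ a) ?size_cat /= -?addSnnS ?ltnS ?leq_addr // nth_cat ltnn subnn eqxx !andbT.
rewrite -!andbA; apply/and4P; split.
- rewrite -map_drop -map_take; apply/eqP; congr map.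
  have oW : occurs y (wpow s f m0 a) 0 by have := img_occurs imy (fixpoint_occurs pro m0 fx); rewrite cut0.
  rewrite (occursE oW) (@seg_sub _ y 0 _ pos (size w)) // ?subn0 ?add0n; last exact: Hm0.
  by rewrite drop_size_cat ?size_seg // take_size_cat ?size_seg // -(occursE ow).
(* The emptiness bit makes both words empty or both nonempty, and in the second case their first
   letters turn any index into a proper code. *)
- rewrite /same_profile size_tab; apply/all_rkP => c; rewrite !wp_tab1 !nilp_map.
  have := congr1 (fun h : {ffun A -> {ffun Q -> Q} * bool} => h c) prof; rewrite !ffunE => -[/ffunP e1 e2].
  rewrite e2 eqxx andTb; apply/allP => i _; move: e2 e1.
  case: (wpow s f n c) => [|b t]; case: (wpow s f (n + N) c) => [|b' t'] //= _ e1.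
  by rewrite !dtabE !drun_stc; have := e1 (stv i); rewrite !ffunE => ->.
- by rewrite size_tab leqW // stc_le.
- rewrite /stc (negbTE al) /=.
  have -> : loop_word (~~ `[< r = u >]) (size u) (map (@rk A) (u ++ g :: v)) = map (@rk A) r.
    rewrite /loop_word; case: asboolP => [->|nu] /=; first by rewrite map_cat take_size_cat ?size_map.
    rewrite -cat_rcons map_cat drop_size_cat ?size_map ?size_rcons //.
    by case: ruv nu => // ->.
  rewrite /loop_ok wp_tab nilp_map; apply/andP; split; first by apply/nilP.
  by have := drun_stc q (extend (wpow s f n) r); rewrite fixq /stc (negbTE al) => ->.
Qed.
End DeadState.

Lemma not_ur_check : ~ uniformly_recurrent y ->
  exists Dt w m0 pos m1 i1 N i2 side n q, pump_ok (mtab s) (mtab f) (rk a) Dt w m0 pos m1 i1 N i2 side n q.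
Proof.
move=> nur; have fx' m := fixpoint_occurs pro m fx.
have [w [ne fw pa]] := not_ur_pump fx' (mpow_unbounded pro) (fixpoint_img pro fx) imy nur.
exists (dtab (@avoid_step B w) None); apply: (@pump_complete _ (@avoid_step B w) None _ w) => //.
  by move=> q; apply: avoid_dead.
move: pa => [m1 [g [N [n [u [v [q [H1 [al H2]]]]]]]]]; exists m1, g, N, n, u, v, q.
by split=> //; split=> //; case: q al {H2}.
Qed.
End Pump.

Definition tab_trans (Et : seq (seq (seq nat))) q c : option (nat * seq nat) :=
  if entry Et q c is q' :: p then Some (q', p) else None.

Definition tab_cert n N K Et tt Tt lt vt gt rs : certificate nat nat :=
  @Certificate nat nat n N K (tab_trans Et) (nth [::] tt) (nth [::] Tt) (nth [::] lt) (nth [::] vt) (nth 0 gt) rs.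

Lemma trunE Et b q o w :
  let acc := foldl (trun_step Et) (b, (q, o)) w in
  (if acc.1 then Some acc.2 else None) =
  (if b then if run (tab_trans Et) q w is Some (q', o') then Some (q', o ++ o') else None else None).
Proof.
elim: w b q o => [|c w IHw] b q o /=; first by rewrite cats0.
rewrite {}IHw /tab_trans /trun_step /=; case: b => //=.
case: (entry Et q c) => [|q' p] //=; case: run => [[q2 o2]|] //=.
by rewrite catA.
Qed.

Lemma trans_certifies S P a n N K Et tt Tt lt vt gt rs :
  trans_ok S P a n N K Et tt Tt lt vt gt rs ->
  certifies (nth [::] S) (nth [::] P) a (tab_cert n N K Et tt Tt lt vt gt rs).
Proof.
case/andP=> /andP[/andP[/andP[/andP[/andP[/andP[/nilP t0 /eqP g0] /nilP v0] E0] N0] /allP gK] /allP steps] /allP prim.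
split; split=> //=.
- by rewrite /tab_trans; case: entry E0.
- by move=> q ltq; apply: gK; rewrite mem_iota.
- move=> q c q' p; rewrite /tab_trans; case e : (entry Et q c) => [|q1 p1] // [<- <-].
  have ltq : q < size Et.
    by rewrite ltnNge; apply/negP => ge; move: e; rewrite /entry (nth_default _ ge) nth_nil.
  have ltc : c < size (nth [::] Et q).
    by rewrite ltnNge; apply/negP => ge; move: e; rewrite /entry (nth_default _ ge).
  have mq : q \in iota 0 (size Et) by rewrite mem_iota.
  have mc : c \in iota 0 (size (nth [::] Et q)) by rewrite mem_iota.
  have := allP (steps q mq) c mc; rewrite e /=.
  case/andP=> /andP[/andP[ltK /eqP text] /allP prs] /andP[/andP[ok /eqP gq'] conj].
  split=> //=.
    by apply/allP => r /prs /hasP[r' rr' /eqP <-].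
  have := trunE Et true (nth 0 gt q) [::] (mp S N [:: c]); rewrite -/(trun _ _ _) /= ok.
  set acc := trun _ _ _ in ok gq' conj *.
  case R : run => [[q2 o2]|] // [] eacc; exists o2; first by rewrite -gq' eacc.
  by case/orP: conj => /eqP; [left | rewrite eacc; right].
- by move=> r /prim /andP[].
- by move=> r r' /prim /andP[_ /allP H] /H /hasP[z zl /eqP <-].
Qed.

(** The test certifies the morphisms of the tables, over [nat], so [certificate_ur] is applied to
    the coded sequences; injectivity of [rk] brings the conclusion back to [y]. *)
Lemma trans_sound (A B : finType) (s : A -> seq A) (f : A -> seq B) a x y n N K Et tt Tt lt vt gt rs :
  prolongable s a -> is_fixpoint s a x -> img f x y ->
  trans_ok (mtab s) (mtab f) (rk a) n N K Et tt Tt lt vt gt rs -> uniformly_recurrent y.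
Proof.
move=> pro fx imy /trans_certifies cert; apply: (@ur_inj _ _ (@rk B)); first exact: rk_inj.
have itE k : iter k (extend (nth [::] (mtab s))) [:: rk a] = map (@rk A) (mpow s k a).
  exact: (mp_tab1 s k a).
apply: (certificate_ur (x := @rk A \o x) _ _ _ cert).
- have [[u ne sa] inf] := pro; split.
    by exists (map (@rk A) u); [case: (u) ne | rewrite nth_tab sa].
  move=> L; have [M HM] := inf L; exists M => k le; rewrite itE size_map; exact: HM.
- move=> i; have [M HM] := fx i; exists M => k le; rewrite itE.
  have := HM k le; rewrite -/(mpow s k a) /=; move: (x i) => z.
  by elim: (mpow s k a) i {HM} => [|c w IHw] [|i] //=; [case=> -> | exact: IHw].
- have e k : extend (nth [::] (mtab f)) (mkseq (@rk A \o x) k) = map (@rk B) (extend f (mkseq x k)).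
    by rewrite -ext_tab /mkseq (map_comp (@rk A) x).
  split=> [k|L]; first by rewrite e; apply: occurs_map; apply: imy.1.
  by have [k Hk] := imy.2 L; exists k; rewrite e size_map.
Qed.

Lemma trans_complete (A B : finType) (s : A -> seq A) (f : A -> seq B) a C : certifies s f a C ->
  exists n N K Et tt Tt lt vt gt rs, trans_ok (mtab s) (mtab f) (rk a) n N K Et tt Tt lt vt gt rs.
Proof.
case: C => n N K Ec tc Tc lc vc gc rs [[/= t0 g0 v0 E0 N0] [/= gK steps lam2 prim]].
pose ent q c := if Ec q c is Some (q', p) then q' :: p else [::].
pose Et := mkseq (fun q => tab (fun c => ent q c)) K.
(* Labels are arbitrary numbers, so the tables indexed by them extend to the largest one. *)
pose R := (\max_(r <- rs) r).+1.
have ltR r : r \in rs -> r < R by move=> rr; rewrite ltnS; apply: (@leq_bigmax_seq _ rs xpredT id r rr isT).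
pose Tt := mkseq (fun r => map (@rk B) (Tc r)) R.
exists n, N, K, Et, (mkseq (fun q => map (@rk B) (tc q)) K), Tt, (mkseq lc R), (mkseq vc K), (mkseq gc K), rs.
have K0 : 0 < K.
  by case e: (Ec 0 a) E0 => [[q p]|] // _; have [lt _ _ _] := steps _ _ _ _ e; apply: leq_ltn_trans lt.
have entE q c : q < K -> entry Et q (rk c) = ent q c by move=> lt; rewrite /entry nth_mkseq // nth_tab.
have runE q w q' o : q < K -> run Ec q w = Some (q', o) -> trun Et q (map (@rk A) w) = (true, (q', o)).
  rewrite /trun -{2}[o]/([::] ++ o); elim: w q o [::] => [|c w IHw] q o o0 lt /=.
    by case=> -> <-; rewrite cats0.
  case e: (Ec q c) => [[q1 p]|] //; have [lt1 _ _ _] := steps _ _ _ _ e.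
  case r: run => [[q2 o2]|] // [e2 <-]; rewrite e2 in r; rewrite /trun_step /= entE // /ent e /= (IHw _ _ _ lt1 r).
  by rewrite catA.
have extl p : all (mem rs) p -> ext (mkseq lc R) p = extend lc p.
  by move=> /allP H; congr flatten; apply/eq_in_map => r /H /ltR lt; rewrite nth_mkseq.
have extT p : all (mem rs) p -> ext Tt p = map (@rk B) (extend Tc p).
  rewrite /extend map_flatten -map_comp => /allP H; congr flatten; apply/eq_in_map => r /H /ltR lt.
  by rewrite nth_mkseq.
apply/andP; split; last first.
  apply/allP => r rr; rewrite nth_mkseq ?ltR // lam2 //=; apply/allP => r' rr'.
  by apply/hasP; exists r' => //; apply: prim.
rewrite !nth_mkseq // t0 g0 v0 N0 entE //.
apply/andP; split; last first.
  apply/allP => q; rewrite size_mkseq mem_iota /= add0n => ltq; rewrite nth_mkseq // size_tab.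
  apply/all_rkP => c; rewrite entE // /ent; case e: (Ec q c) => [[q' p]|] //=.
  have [lt' text prs [o ro conj]] := steps _ _ _ _ e.
  rewrite /tstep_ok !nth_mkseq // lt' wp_tab1 mp_tab1 extT // extl // -!map_cat text eqxx /=.
  apply/andP; split.
    by apply/allP => r /(allP prs) rr; apply/hasP; exists r.
  rewrite (runE _ _ _ _ (gK _ ltq) ro) /run_ok /= eqxx /=.
  by case: conj => [->|->]; rewrite eqxx ?orbT.
rewrite /= /ent andbT; apply/andP; split; first by case: (Ec 0 a) E0 => [[]|].
by apply/allP => q; rewrite mem_iota /= add0n => ltq; rewrite nth_mkseq // gK.
Qed.

Theorem theorem1 :
  exists d : recfun,
    forall (A B : finType) (sigma : A -> seq A) (a : A) (phi : A -> seq B),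
      prolongable sigma a ->
      decides d (code_input sigma a phi)
        (exists (x : nat -> A) (y : nat -> B),
           [/\ is_fixpoint sigma a x, is_image phi x y
             & uniformly_recurrent y]).
Proof.
have [d dP] := search_decides c_check.
exists d => A B s a f pro; set inpt := code_input s a f.
have inpE k i : inp (inpt, k) i = nth 0 [:: #|A|; #|B|; rk a; code_morphism s; code_morphism f] i.
  by rewrite /inp /dec1 CodeSeq.codeK.
have SE k : tabS (inpt, k) = mtab s by rewrite /tabS inpE dec2_code.
have PE k : tabP (inpt, k) = mtab f by rewrite /tabP inpE dec2_code.
have aE k : inp (inpt, k) 2 = rk a by rewrite inpE.
have [x fx _] := fixpoint_ex pro.
have fldE c i : fld (inpt, CodeSeq.code c) i = nth 0 c i by rewrite /fld /dec1 CodeSeq.codeK.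
apply: dP => [|k|k|k].
- have [i1 [i2 se]] := empties_repeat s f; have {}se := (same_emptiesP s f i1 i2).2 se.
  case te: (tail_empty (mtab s) (mtab f) (rk a) i1 i2).
    exists (CodeSeq.code [:: i1; i2]); rewrite /check.
    by rewrite {1}/finite_check !SE !PE !aE !fldE /= se te.
  have [y imy] := infinite_sound pro se (negbT te) fx.
  have [ur|nur] := pselect (uniformly_recurrent y).
    have [C cert] := ur_certificate pro fx imy ur.
    have [n [N [K [Et [tt [Tt [lt [vt [gt [rs ok]]]]]]]]]] := trans_complete cert.
    exists (CodeSeq.code [:: i1; i2; n; N; K; enc Et; enc tt; enc Tt; enc lt; enc vt; enc gt; enc rs]).
    rewrite /check; case: ifP => // _.
    rewrite /infinite_check /trans_check !SE !PE !aE !fldE ![nth 0 (_ :: _) _]/=.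
    by rewrite enc_seq3K !enc_seq2K !enc_seqK se te ok.
  have [Dt [w [m0 [pos [m1 [j1 [N [j2 [side [n [q ok]]]]]]]]]]] := not_ur_check pro fx imy nur.
  exists (CodeSeq.code [:: i1; i2; enc Dt; enc w; m0; pos; m1; j1; N; j2; side; n; q]).
  rewrite /check {1}/pump_check !SE !PE !aE !fldE ![nth 0 (_ :: _) _]/=.
  by rewrite enc_seq2K enc_seqK ok orbT.
- rewrite /check; case: ifP => [bad _ [x' [y [fx' /is_imageP imy ur]]]|_]; last by case: ifP.
  case/orP: bad.
    by rewrite /finite_check !SE !PE !aE => /andP[h1 h2]; apply: (finite_sound pro h1 h2 fx' imy).
  by rewrite /pump_check !SE !PE !aE => /(pump_sound pro fx' imy).
- rewrite /check; case: ifP => // _; case: ifP => // /andP[].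
  rewrite /infinite_check /trans_check !SE !PE !aE => /andP[h1 h2] tr _.
  have [y imy] := infinite_sound pro h1 h2 fx.
  by exists x, y; split=> //; [apply/is_imageP | apply: trans_sound pro fx imy tr].
- by rewrite /check; case: ifP => // _; case: ifP.
Qed.
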